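(* Let $S_0,S_1,S_2$ be Riemann surfaces (not necessarily compact), let $\beta_1:S_1\to S_0$ and $\beta_2:S_2\to S_0$ be surjective holomorphic maps, and let $S_1\times_{(\beta_1,\beta_2)}S_2$ be their fiber product. Suppose that $S_1\times_{(\beta_1,\beta_2)}S_2$ is connected and that its locus of singular points $\mathrm{Sing}(S_1\times_{(\beta_1,\beta_2)}S_2)$ is finite. Then the ends space $\mathrm{Ends}(S_1\times_{(\beta_1,\beta_2)}S_2)$ is homeomorphic to the ends space $\mathrm{Ends}(\widetilde{S_1\times_{(\beta_1,\beta_2)}S_2})$ of the normal fiber product.
   Context: Fiber product: $S_1\times_{(\beta_1,\beta_2)}S_2:=\{(z_1,z_2)\in S_1\times S_2:\beta_1(z_1)=\beta_2(z_2)\}$ with the topology induced from $S_1\times S_2$. It is a singular Riemann surface, i.e. a one-dimensional complex analytic space in which every point has a neighborhood holomorphically equivalent to some $V_{n,m}=\{(z,w)\in\Delta\times\Delta: z^n=w^m\}$, $n,m\ge 1$, with $\Delta$ the unit disc. A point is called singular if $n,m\ge2$ and $\gcd(n,m)\geq 2$; for the fiber product, $(z_1,z_2)$ is singular if and only if $\gcd(n_1,n_2)\ge 2$, where $n_j$ is the local degree of $\beta_j$ at $z_j$. The set of singular points is denoted $\mathrm{Sing}(\cdot)$ and is discrete. Irreducible components and normal fiber product: each connected component $\widetilde R$ of $(S_1\times_{(\beta_1,\beta_2)}S_2)\setminus \mathrm{Sing}(S_1\times_{(\beta_1,\beta_2)}S_2)$ is a Riemann surface on which the singular points define punctures; filling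 in these punctures gives a Riemann surface $R\supset\widetilde R$ called an irreducible component. The normal fiber product $\widetilde{S_1\times_{(\beta_1,\beta_2)}S_2}$ is the (disjoint) union of all irreducible components. If the singular locus is finite and the fiber product is connected, there are finitely many irreducible components $R_1,\dots,R_k$, and $\mathrm{Ends}(\widetilde{S_1\times_{(\beta_1,\beta_2)}S_2})=\bigcup_{i=1}^k\mathrm{Ends}(R_i)$ (disjoint union). Ends: for a locally compact, locally connected, connected Hausdorff space $X$, consider nested sequences $U_1\supset U_2\supset\cdots$ of non-empty connected open subsets of $X$ such that each boundary $\partial U_n$ is compact, $\bigcap_n\overline{U_n}=\emptyset$, and for every compact $K\subset X$ there is $m$ with $K\cap U_m=\emptyset$. Two such sequences $(U_n)$, $(U_n')$ are equivalent if for each $n$ there exist $j,k$ with $U_n\supset U_j'$ and $U_n'\supset U_k$. Equivalence classes $[U_n]_{n\in\mathbb{N}}$ are the ends of $X$; $\mathrm{Ends}(X)$ is the set of ends with the topology having as basis the sets $U^*=\{[U_n]_{n\in\mathbb{N}}: U_j\subset U\text{ for some }j\}$, with $U$ a non-empty connected open subset of $X$ with compact boundary. *)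

(* Defs.v *)
From HB Require Import structures.
From mathcomp Require Import all_boot all_order all_algebra.
From mathcomp Require Import all_classical all_reals all_analysis.
From mathcomp Require Import complex.

Set Implicit Arguments.
Unset Strict Implicit.
Unset Printing Implicit Defensive.

Import Order.TTheory GRing.Theory Num.Theory.
Import numFieldNormedType.Exports.
Local Open Scope classical_set_scope.
Local Open Scope ring_scope.

(* The named constant lets the norm topology and the normed module structure
   of numClosedFieldType be inferred; R[i] itself carries no topology. *)
Definition cplx (R : realType) : numClosedFieldType := R[i].

Definition homeomorphic (X Y : topologicalType) : Prop :=
  exists (f : X -> Y) (g : Y -> X),
    [/\ continuous f, continuous g, cancel f g & cancel g f].

Definition equiv_classes (T : Type) (D : set T) (E : T -> T -> Prop) :
    set (set T) :=
  [set c | exists2 u, D u & c = [set v | D v /\ E u v]].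

(** * Ends of a topological space *)

Definition boundary (X : topologicalType) (U : set X) : set X :=
  closure U `\` interior U.

Definition end_domain (X : topologicalType) (U : set X) : Prop :=
  [/\ U !=set0, connected U, open U & compact (boundary U)].

Definition end_sequence (X : topologicalType) : set (nat -> set X) :=
  [set U | [/\ forall n, U n.+1 `<=` U n,
               forall n, end_domain (U n),
               \bigcap_n closure (U n) = set0 &
               forall K, compact K -> exists m, K `&` U m = set0]].

Definition end_equiv (X : topologicalType) (U V : nat -> set X) : Prop :=
  forall n, exists j k, V j `<=` U n /\ U k `<=` V n.

Definition Ends (X : topologicalType) : Type :=
  set_type (equiv_classes (@end_sequence X) (@end_equiv X)).

HB.instance Definition _ (X : topologicalType) := gen_eqMixin (Ends X).
HB.instance Definition _ (X : topologicalType) := gen_choiceMixin (Ends X).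

Definition ends_in (X : topologicalType) (U : set X) : set (Ends X) :=
  [set e | exists2 u, set_val e u & exists j, u j `<=` U].

Lemma ends_in_cover (X : topologicalType) :
  \bigcup_(U in @end_domain X) ends_in U = [set: Ends X].
Proof.
apply/seteqP; split=> // e _; have /set_mem [u uE e_def] := valP e.
have [_ /(_ 0%N) u0 _ _] := uE.
exists (u 0%N) => //; exists u; last by exists 0%N.
by rewrite set_valE /= e_def; split=> // n; exists n, n; split.
Qed.

Lemma ends_in_join (X : topologicalType) (U V : set X) (e : Ends X) :
  end_domain U -> end_domain V -> ends_in U e -> ends_in V e ->
  exists W, [/\ end_domain W, ends_in W e & ends_in W `<=` ends_in U `&` ends_in V].
Proof.
move=> _ _ [u eu [j juU]] [v ev [k kvV]].
have [w wE e_def] := set_mem (valP e).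
have wuv n : exists m, w m `<=` u n /\ w m `<=` v n.
  move: eu ev; rewrite set_valE /= e_def => -[_ wu] [_ wv].
  have [_ [a [_ wa]]] := wu n; have [_ [b [_ wb]]] := wv n.
  have [wdec _ _ _] := wE.
  have mono p q : w (p + q)%N `<=` w p.
    elim: q => [|q IH]; first by rewrite addn0.
    by rewrite addnS => x /wdec/IH.
  exists (a + b)%N; split=> x; first by move=> /mono/wa.
  by rewrite addnC => /mono/wb.
have udec m n : (m <= n)%N -> u n `<=` u m.
  move: eu; rewrite set_valE /= e_def => -[[du _ _ _] _] /subnK <-.
  elim: (n - m)%N => [|q IH]; first by rewrite add0n.
  by rewrite addSn => x /du/IH.
have vdec m n : (m <= n)%N -> v n `<=` v m.
  move: ev; rewrite set_valE /= e_def => -[[du _ _ _] _] /subnK <-.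
  elim: (n - m)%N => [|q IH]; first by rewrite add0n.
  by rewrite addSn => x /du/IH.
have [m [mu mv]] := wuv (maxn j k).
exists (w m); split.
- by case: wE => _ /(_ m).
- exists w; last by exists m.
  by rewrite set_valE /= e_def; split=> // n; exists n, n; split.
- move=> f [t ft [i tiw]]; split; exists t => //; exists i => x /tiw.
    by move=> /mu/(udec _ _ (leq_maxl _ _))/juU.
  by move=> /mv/(vdec _ _ (leq_maxr _ _))/kvV.
Qed.

HB.instance Definition _ (X : topologicalType) :=
  isBaseTopological.Build (Ends X) (@ends_in_cover X)
    (fun U V e => @ends_in_join X U V e).

(** * Riemann surfaces *)

(* cmap is a homeomorphism from the open set cdom onto an open subset of the
   complex plane, with inverse cinv; the values of cmap off cdom and of cinv
   off the image are irrelevant. *)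
Record chart (R : realType) (X : topologicalType) := Chart {
  cdom : set X;
  cmap : X -> cplx R;
  cinv : cplx R -> X;
  cdom_open : open cdom;
  cimg_open : open (cmap @` cdom);
  cmap_continuous : forall x, cdom x -> {for x, continuous cmap};
  cinv_continuous : forall w, (cmap @` cdom) w -> {for w, continuous cinv};
  cmapK : forall x, cdom x -> cinv (cmap x) = x }.

Definition compatible (R : realType) (X : topologicalType) (a b : chart R X) :=
  forall x, cdom a x -> cdom b x ->
    derivable (cmap b \o cinv a) (cmap a x) 1 /\
    derivable (cmap a \o cinv b) (cmap b x) 1.

(* The atlas is required to be maximal, so that rs_charts is the set of all
   local coordinates of the surface. *)
Record riemannSurface (R : realType) := RiemannSurface {
  rs_space :> topologicalType;
  rs_charts : set (chart R rs_space);
  rs_nonempty : [set: rs_space] !=set0;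
  rs_connected : connected [set: rs_space];
  rs_hausdorff : hausdorff_space rs_space;
  rs_cover : forall x, exists2 c, rs_charts c & cdom c x;
  rs_maximal : forall c,
    rs_charts c <-> forall a, rs_charts a -> compatible a c }.

Definition holomorphic (R : realType) (S T : riemannSurface R) (f : S -> T) :=
  continuous f /\
  forall (a : chart R S) (b : chart R T) x, rs_charts a -> rs_charts b ->
    cdom a x -> cdom b (f x) ->
    derivable (cmap b \o f \o cinv a) (cmap a x) 1.

Definition holomorphic_at (R : realType) (S : riemannSurface R)
    (g : cplx R -> S) (w : cplx R) :=
  {for w, continuous g} /\
  forall b : chart R S, rs_charts b -> cdom b (g w) ->
    derivable (cmap b \o g) w 1.

(* f has local degree n at x: it reads w |-> w ^ n in suitable local
   coordinates centred at x and at f x. *)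
Definition local_degree (R : realType) (S T : riemannSurface R) (f : S -> T)
    (x : S) (n : nat) :=
  exists (a : chart R S) (b : chart R T),
    [/\ rs_charts a /\ rs_charts b, cdom a x /\ cmap a x = 0,
        cdom b (f x) /\ cmap b (f x) = 0 &
        forall y, cdom a y -> cdom b (f y) /\ cmap b (f y) = cmap a y ^+ n].

(** * Fiber products *)

Section FiberProduct.
Context {R : realType} {S0 S1 S2 : riemannSurface R}.
Variables (b1 : S1 -> S0) (b2 : S2 -> S0).

Definition fiber_product : topologicalType :=
  set_type [set z : S1 * S2 | b1 z.1 = b2 z.2].

Definition fp1 (z : fiber_product) : S1 := (set_val z).1.
Definition fp2 (z : fiber_product) : S2 := (set_val z).2.

Definition fp_sing : set fiber_product :=
  [set z | exists n1 n2, [/\ local_degree b1 (fp1 z) n1,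
     local_degree b2 (fp2 z) n2 & (2 <= gcdn n1 n2)%N]].

(* Local coordinates of the Riemann surface structure of the complement of the
   singular points: where the local degrees n1, n2 are coprime, the set
   z1 ^ n1 = z2 ^ n2 is parametrized by t |-> (t ^ n2, t ^ n1), so that a
   coordinate is a chart whose inverse has holomorphic components. *)
Definition fp_chart (c : chart R fiber_product) :=
  cdom c `<=` ~` fp_sing /\
  forall w, (cmap c @` cdom c) w ->
    holomorphic_at (fp1 \o cinv c) w /\ holomorphic_at (fp2 \o cinv c) w.

Definition components : set (set fiber_product) :=
  connected_component (~` fp_sing) @` (~` fp_sing).

(* A coordinate of the component C onto the punctured unit disc, whose points
   converge to a singular point of the fiber product at the centre. *)
Definition puncture_chart (C : set fiber_product) :
    set (chart R fiber_product) :=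
  [set c | [/\ fp_chart c, cdom c `<=` C,
               cmap c @` cdom c = [set w | 0 < `|w| < 1] &
               exists2 p, fp_sing p & cinv c w @[w --> 0^'] --> p]].

Definition puncture_nbhs (c : chart R fiber_product) (r : cplx R) :
    set fiber_product :=
  [set x | cdom c x /\ `|cmap c x| < r].

Definition puncture_equiv (c d : chart R fiber_product) :=
  forall r : cplx R, 0 < r -> exists2 s : cplx R, 0 < s &
    puncture_nbhs d s `<=` puncture_nbhs c r /\
    puncture_nbhs c s `<=` puncture_nbhs d r.

Definition puncture (C : set fiber_product) : Type :=
  set_type (equiv_classes (puncture_chart C) puncture_equiv).

(* The component C with its punctures over singular points filled in. As a
   Riemann surface, its coordinates are those of C and the puncture charts
   extended by 0; the ends space only depends on its topology. *)
Definition irreducible_component (C : set fiber_product) : Type :=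
  (set_type C + puncture C)%type.

HB.instance Definition _ C := gen_eqMixin (irreducible_component C).
HB.instance Definition _ C := gen_choiceMixin (irreducible_component C).

(* The topology obtained by gluing the unit disc to C along each puncture
   chart, the centre of the disc being the puncture. *)
Definition irr_open (C : set fiber_product) :
    set_system (irreducible_component C) :=
  [set U | open [set x : set_type C | U (inl x)] /\
     forall p : puncture C, U (inr p) -> forall c, set_val p c ->
       exists2 r : cplx R, 0 < r &
         forall x : set_type C, puncture_nbhs c r (set_val x) -> U (inl x)].

Lemma irr_openT C : @irr_open C setT.
Proof.
split=> [|p _ c _]; last by exists 1.
by rewrite (_ : [set _ | _] = setT); [exact: openT | exact/seteqP].
Qed.

Lemma irr_openI C : setI_closed (@irr_open C).
Proof.
move=> U V [oU pU] [oV pV]; split; first exact: openI.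
move=> p [/= Up Vp] c pc.
have [r r0 rU] := pU _ Up _ pc; have [s s0 sV] := pV _ Vp _ pc.
have [rs|/ltW sr] := real_leP (gtr0_real r0) (gtr0_real s0).
  exists r => // x [cx xr]; split; first exact: rU.
  by apply: sV; split=> //; exact: lt_le_trans rs.
exists s => // x [cx xs]; split; last exact: sV.
by apply: rU; split=> //; exact: lt_le_trans sr.
Qed.

Lemma irr_open_bigU C (I : Type) (f : I -> set (irreducible_component C)) :
  (forall i, irr_open (f i)) -> irr_open (\bigcup_i f i).
Proof.
move=> of_; split.
  rewrite (_ : [set _ | _] = \bigcup_i [set x | f i (inl x)]) //.
  by apply: bigcup_open => i _; case: (of_ i).
move=> p [i _ fip] c pc; have [_ /(_ p fip c pc)[r r0 rf]] := of_ i.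
by exists r => // x xr; exists i => //; exact: rf.
Qed.

HB.instance Definition _ C :=
  isOpenTopological.Build (irreducible_component C)
    (@irr_openT C) (@irr_openI C) (@irr_open_bigU C).

(* The ends space of the normal fiber product is by definition the disjoint
   union (topological sum) of those of the irreducible components. *)
Definition normal_fiber_product_Ends : topologicalType :=
  {C : set_type components & Ends (irreducible_component (set_val C))}.

End FiberProduct.

Arguments fp_sing {R S0 S1 S2} b1 b2.
Arguments fp_chart {R S0 S1 S2} b1 b2 c.
Arguments components {R S0 S1 S2} b1 b2.

(* Main.v *)
Require Import Defs.
From mathcomp Require Import all_boot all_order all_algebra.
From mathcomp Require Import all_classical all_reals all_analysis.
From mathcomp Require Import complex.
From mathcomp Require Import ring lra.

Set Implicit Arguments.
Unset Strict Implicit.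
Unset Printing Implicit Defensive.

Import Order.TTheory GRing.Theory Num.Theory.
Import numFieldNormedType.Exports.
Local Open Scope classical_set_scope.
Local Open Scope ring_scope.


(** The fiber product X and its normal fiber product differ only over the finitely many
    singular points, and ends do not see compact sets. Precisely, for each component D
    of the regular part of X the normalization map sends the irreducible component of D
    to X; it is a homeomorphism over the open set D, takes singular values elsewhere,
    and is proper (normalization_proper). Let N be a compact neighbourhood of the
    singular set. Every end of X has a representative whose members avoid N; being
    connected they lie in a single component D, and their preimages represent an end of
    the corresponding irreducible component. Conversely an end of an irreducible
    component has a representative avoiding the compact preimage of N, whose image
    represents an end of X. This is a purely topological argument
    (ends_sum_homeomorphic).

    What it needs from complex analysis is that X is locally compact, that components
    are open, and that only finitely many punctures lie over a singular point. All this
    follows from the local structure of X (local_branches): every point has a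
    neighbourhood that consists of finitely many discs glued at their centres. Indeed,
    in suitable coordinates of the factors X is the curve w1 ^ n1 = w2 ^ n2, which is
    the union of d = gcd n1 n2 branches t |-> (t ^ (n2 / d), zeta * t ^ (n1 / d)). The
    punctures over a singular point are germs of such branches (puncture_branch).

    The coordinates exist by the normal form w |-> w ^ n of nonconstant holomorphic
    functions (local_normal_form). Complex differentiability at each point is the only
    assumption, so this is developed from the beginning, along the shortest way: no
    power series and no general Cauchy formula. Goursat's theorem for rectangles, with
    the explicit integral of 1 / z along a square, bounds the value of a function at the
    centre of a square by 4 times its supremum on the boundary (maximum_square).
    Applied to the powers of the function times a polynomial, this becomes the maximum
    principle for continuous functions that are differentiable off a finite set
    (maximum_principle). The latter, applied to difference quotients, gives the
    removable singularity theorem, the division of a function by powers of z - p,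
    and strict differentiability, hence the inverse function theorem and n-th roots. The
    identity theorem (nowhere_loc_const) then excludes locally constant behaviour, as
    the maps to the base are onto. *)

(** * Differential calculus of one complex variable *)

Section Modulus.
Variable R : realType.
Local Notation C := (cplx R).
Implicit Types (x y z w : C) (r e : R).

(** The norm of the field cplx R has values in cplx R itself; estimates are carried
    out with this real-valued modulus, in the ordered field R. *)
Definition cabs (z : C) : R := Normc.normc z.
Definition cR (r : R) : C := real_complex R r.

Lemma normcE z : `|z| = cR (cabs z).
Proof. by []. Qed.

Lemma cR_le r e : (cR r <= cR e) = (r <= e).
Proof. exact: lecR. Qed.

Lemma cR_lt r e : (cR r < cR e) = (r < e).
Proof. exact: ltcR. Qed.

Lemma cR_inj : injective cR. Proof. by move=> r e []. Qed.

Lemma cRM r e : cR (r * e) = cR r * cR e. Proof. exact: rmorphM. Qed.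
Lemma cRD r e : cR (r + e) = cR r + cR e. Proof. exact: rmorphD. Qed.
Lemma cRB r e : cR (r - e) = cR r - cR e. Proof. exact: rmorphB. Qed.
Lemma cR0 : cR 0 = 0. Proof. by []. Qed.
Lemma cR1 : cR 1 = 1. Proof. by []. Qed.

Lemma cabs_ge0 z : 0 <= cabs z.
Proof. by case: z => a b; rewrite /cabs /= sqrtr_ge0. Qed.

Lemma cabs_cR r : cabs (cR r) = `|r|.
Proof. by rewrite /cabs /= expr0n addr0 sqrtr_sqr. Qed.

Lemma cabs0 : cabs 0 = 0. Proof. by rewrite -cR0 cabs_cR normr0. Qed.
Lemma cabs1 : cabs 1 = 1. Proof. by rewrite -cR1 cabs_cR normr1. Qed.

Lemma cabs_eq0 z : (cabs z == 0) = (z == 0).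
Proof.
apply/eqP/eqP => [|->]; last exact: cabs0.
exact: Normc.eq0_normc.
Qed.

Lemma cabs_gt0 z : (0 < cabs z) = (z != 0).
Proof. by rewrite lt_def cabs_ge0 andbT cabs_eq0. Qed.

Lemma cabsM z w : cabs (z * w) = cabs z * cabs w.
Proof. exact: Normc.normcM. Qed.

Lemma cabsV z : cabs z^-1 = (cabs z)^-1.
Proof. exact: Normc.normcV. Qed.

Lemma cabsX z n : cabs (z ^+ n) = cabs z ^+ n.
Proof. by elim: n => [|n IH]; rewrite ?expr0 ?cabs1// !exprS cabsM IH. Qed.

Lemma cabsD z w : cabs (z + w) <= cabs z + cabs w.
Proof. by rewrite -cR_le cRD -!normcE ler_normD. Qed.

Lemma cabsN z : cabs (- z) = cabs z.
Proof. by apply: cR_inj; rewrite -!normcE normrN. Qed.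

Lemma cabsC z w : cabs (z - w) = cabs (w - z).
Proof. by rewrite -cabsN opprB. Qed.

Lemma cabs_tri u z w : cabs (z - w) <= cabs (z - u) + cabs (u - w).
Proof. by apply: le_trans (cabsD _ _); rewrite addrA subrK. Qed.

Lemma cabs_sub z w : cabs z - cabs w <= cabs (z - w).
Proof. by rewrite lerBlDr; apply: le_trans (cabsD _ _); rewrite subrK. Qed.

Lemma cabs_Re z : `|complex.Re z| <= cabs z.
Proof.
by case: z => a b; rewrite /cabs /= -sqrtr_sqr ler_wsqrtr // lerDl sqr_ge0.
Qed.

Lemma cabs_Im z : `|complex.Im z| <= cabs z.
Proof.
by case: z => a b; rewrite /cabs /= -sqrtr_sqr ler_wsqrtr // lerDr sqr_ge0.
Qed.

Lemma cabs_le_ReIm z : cabs z <= `|complex.Re z| + `|complex.Im z|.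
Proof.
case: z => a b; rewrite /cabs /= -[leRHS]ger0_norm ?addr_ge0 //.
rewrite -sqrtr_sqr ler_wsqrtr // sqrrD !real_normK ?num_real//.
by rewrite -addrA lerD2l lerDr mulrn_wge0 ?mulr_ge0.
Qed.

Lemma posC_real (e : C) : 0 < e -> exists2 r : R, 0 < r & e = cR r.
Proof.
case: e => a b; rewrite ltcE /= => /andP[/eqP -> a0].
by exists a.
Qed.

Lemma nbhsC z (A : set C) :
  nbhs z A <-> exists2 r, 0 < r & forall w, cabs (w - z) < r -> A w.
Proof.
split=> [/nbhs_ballP[e /= /posC_real[r r0 ->] sA]|[r r0 sA]].
  exists r => // w wr; apply: sA.
  by rewrite -ball_normE /= normcE cR_lt cabsC.
apply/nbhs_ballP; exists (cR r); first by rewrite /= -cR0 cR_lt.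
by move=> w; rewrite -ball_normE /= normcE cR_lt cabsC => /sA.
Qed.

Lemma near_lt z r : 0 < r -> \forall w \near z, cabs (w - z) < r.
Proof. by move=> r0; apply/nbhsC; exists r. Qed.

Definition ccont (f : C -> C) z := forall e, 0 < e -> exists2 d, 0 < d &
     forall w, cabs (w - z) < d -> cabs (f w - f z) < e.

Lemma continuousC z (f : C -> C) : {for z, continuous f} <-> ccont f z.
Proof.
split=> [cf e e0|cf A /nbhsC[e e0 eA]].
  by apply/nbhsC; apply: (cf [set v | cabs (v - f z) < e]); exact: near_lt.
have [d d0 dA] := cf e e0.
by rewrite /nbhs /=; apply/nbhsC; exists d => // w /dA/eA.
Qed.

(** b is the derivative of f at z (see derivableC). Bounding the error of the linear
    approximation by a multiple of the distance avoids dividing by w - z. *)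
Definition cderiv (f : C -> C) (z b : C) :=
  forall e, 0 < e -> exists2 d, 0 < d &
    forall w, cabs (w - z) < d -> cabs (f w - f z - b * (w - z)) <= e * cabs (w - z).

Lemma derivableC (f : C -> C) z :
  derivable f z 1 <-> exists b, cderiv f z b.
Proof.
rewrite /derivable; split.
  move=> /cvg_ex[b0 cb]; pose b : C := b0; exists b => e e0.
  have [d d0 H] : exists2 d, 0 < d & forall h, cabs h < d -> h != 0 ->
      cabs (b - h^-1 * (f (h + z) - f z)) < e.
    have /cvgrPdist_lt/(_ (cR e)) := cb; rewrite -cR0 cR_lt => /(_ e0).
    rewrite /dnbhs /within /= => /nbhsC[d d0 H]; exists d => // h hd h0.
    have := H h; rewrite subr0 => /(_ hd h0).
    by rewrite normcE cR_lt /= [h *: 1]mulr1.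
  exists d => // w wd.
  have [->|wz] := eqVneq w z; first by rewrite !subrr mulr0 subrr cabs0 mulr0.
  have h0 : w - z != 0 by rewrite subr_eq0.
  have := H _ wd h0; rewrite subrK => /ltW Hb.
  have E : f w - f z - b * (w - z) = ((w - z)^-1 * (f w - f z) - b) * (w - z).
    by rewrite mulrBl [_^-1 * _]mulrC mulrVK ?unitfE.
  rewrite E cabsM; apply: ler_wpM2r; first exact: cabs_ge0.
  by rewrite cabsC.
move=> [b H]; apply/cvg_ex; exists b; apply/cvgrPdist_le => e /posC_real[r r0 ->].
have [d d0 {}H] := H r r0.
rewrite /dnbhs /within /=; apply/nbhsC; exists d => // h; rewrite subr0 => hd h0.
have := H (h + z); rewrite addrK => /(_ hd) {}H.
rewrite normcE cR_le /= [h *: 1]mulr1 cabsC.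
have -> : h^-1 *: (f (h + z) - f z) - b = h^-1 * (f (h + z) - f z - b * h).
  by rewrite mulrBr [h^-1 * (b * h)]mulrCA mulVf// mulr1.
rewrite cabsM cabsV mulrC ler_pdivrMr ?cabs_gt0//.
Qed.

(** The value b at w is meant to be the derivative of f there, which makes the
    difference quotient continuous. *)
Definition slope (f : C -> C) (w b z : C) : C :=
  if z == w then b else (f z - f w) / (z - w).

Lemma slope_eq f w b : slope f w b w = b.
Proof. by rewrite /slope eqxx. Qed.

Lemma slope_ne f w b z : z != w -> slope f w b z = (f z - f w) / (z - w).
Proof. by rewrite /slope => /negbTE ->. Qed.

Lemma slopeK f w b z : f z - f w = slope f w b z * (z - w).
Proof.
rewrite /slope; case: eqVneq => [->|zw]; first by rewrite !subrr mulr0.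
by rewrite mulfVK // subr_eq0.
Qed.

Lemma ccont_slope_at f w b : cderiv f w b -> ccont (slope f w b) w.
Proof.
move=> H e e0; have [|d d0 {}H] := H (e / 2); first by lra.
exists d => // z /H Hz; rewrite slope_eq; have [zw|zw] := eqVneq z w.
  by rewrite zw slope_eq subrr cabs0.
have zw0 : z - w != 0 by rewrite subr_eq0.
rewrite slope_ne//.
have -> : (f z - f w) / (z - w) - b = (f z - f w - b * (z - w)) / (z - w).
  by rewrite [RHS]mulrBl mulfK.
rewrite cabsM cabsV ltr_pdivrMr ?cabs_gt0//; apply: le_lt_trans Hz _.
by rewrite ltr_pM2r ?cabs_gt0//; lra.
Qed.

(** Caratheodory's form of the derivative, which reduces the rules of calculus
    to those of continuity *)
Lemma cderiv_slope (f : C -> C) z b :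
  cderiv f z b <-> exists2 p : C -> C, ccont p z /\ p z = b &
    forall w, f w - f z = p w * (w - z).
Proof.
split=> [H|[p [cp <-] pE] e e0].
  exists (slope f z b); last by move=> w; exact: slopeK.
  by split; [exact: ccont_slope_at|exact: slope_eq].
have [d d0 H] := cp e e0; exists d => // w /H/ltW Hw.
rewrite pE -mulrBl cabsM; apply: ler_wpM2r => //; exact: cabs_ge0.
Qed.

Lemma ccont_cst a z : ccont (fun=> a : C) z.
Proof. by move=> e e0; exists 1 => // w _; rewrite subrr cabs0. Qed.

Lemma ccont_id z : ccont (fun w : C => w) z.
Proof. by move=> e e0; exists e. Qed.

Lemma ccontD (f g : C -> C) z : ccont f z -> ccont g z ->
  ccont (fun w => f w + g w) z.
Proof.
move=> cf cg e e0.
have e2 : 0 < e / 2 by lra.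
have [d d0 Hf] := cf _ e2; have [c c0 Hg] := cg _ e2.
exists (Num.min d c); first by rewrite lt_min d0.
move=> w; rewrite lt_min => /andP[/Hf fw /Hg gw].
rewrite opprD addrACA; apply: le_lt_trans (cabsD _ _) _.
by rewrite (splitr e) ltrD.
Qed.

Lemma mul_near (u0 v0 : C) e : 0 < e -> exists2 d, 0 < d & forall u v,
  cabs (u - u0) < d -> cabs (v - v0) < d -> cabs (u * v - u0 * v0) < e.
Proof.
move=> e0; pose K := cabs u0 + cabs v0 + 1.
have u00 := cabs_ge0 u0; have v00 := cabs_ge0 v0.
have K0 : 0 < K by rewrite /K; lra.
exists (Num.min 1 (e / (2 * K))).
  by rewrite lt_min ltr01 divr_gt0// mulr_gt0.
move=> u v; rewrite !lt_min => /andP[u1 uK] /andP[v1 vK].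
have -> : u * v - u0 * v0 = (u - u0) * (v - v0) + ((u - u0) * v0 + u0 * (v - v0)) by ring.
apply: le_lt_trans (cabsD _ _) _; rewrite cabsM.
have := cabsD ((u - u0) * v0) (u0 * (v - v0)); rewrite !cabsM => T.
rewrite ltr_pdivlMr ?mulr_gt0// in uK; rewrite ltr_pdivlMr ?mulr_gt0// in vK.
have := cabs_ge0 (u - u0); have := cabs_ge0 (v - v0).
move: (cabs (u - u0)) (cabs (v - v0)) (cabs u0) (cabs v0) @K T uK vK u1 v1 u00 v00 K0.
by move=> p q a b K T pK qK p1 q1 a0 b0 K0 q0 p0; rewrite /K in pK qK; nra.
Qed.

Lemma ccontM (f g : C -> C) z : ccont f z -> ccont g z ->
  ccont (fun w => f w * g w) z.
Proof.
move=> cf cg e e0; have [a a0 H] := mul_near (f z) (g z) e0.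
have [d d0 Hf] := cf _ a0; have [c c0 Hg] := cg _ a0.
exists (Num.min d c); first by rewrite lt_min d0.
by move=> w; rewrite lt_min => /andP[/Hf fw /Hg gw]; exact: H.
Qed.

Lemma ccontN (f : C -> C) z : ccont f z ->
  ccont (fun w => - f w) z.
Proof.
move=> cf e e0.
by have [d d0 H] := cf e e0; exists d => // w /H; rewrite -opprD cabsN.
Qed.

Lemma ccontB (f g : C -> C) z : ccont f z -> ccont g z ->
  ccont (fun w => f w - g w) z.
Proof. by move=> cf cg; exact: (ccontD cf (ccontN cg)). Qed.

Lemma ccontV (f : C -> C) z : ccont f z -> f z != 0 ->
  ccont (fun w => (f w)^-1) z.
Proof.
move=> cf fz0 e e0.
have fz : 0 < cabs (f z) by rewrite cabs_gt0.
pose a := cabs (f z).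
have [|d d0 H] := cf (Num.min (a / 2) (e * (a * a / 2))).
  by rewrite lt_min !(divr_gt0, mulr_gt0).
exists d => // w /H; rewrite lt_min => /andP[h1 h2].
have fw : a / 2 < cabs (f w).
  by have := cabs_sub (f z) (f w); rewrite cabsC -/a; lra.
have fw0 : f w != 0 by rewrite -cabs_gt0 (lt_trans _ fw)// divr_gt0.
have -> : (f w)^-1 - (f z)^-1 = - (f w - f z) / (f w * f z) by field; exact/andP.
rewrite cabsM cabsV cabsN cabsM ltr_pdivrMr; last by rewrite mulr_gt0 ?cabs_gt0.
apply: lt_le_trans h2 _; apply: ler_wpM2l; first exact: ltW.
by rewrite -/a; move: fz; rewrite -/a; nra.
Qed.

Lemma ccontX (f : C -> C) z n : ccont f z ->
  ccont (fun w => f w ^+ n) z.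
Proof.
move=> cf; elim: n => [|n IH]; first exact: ccont_cst.
have -> : (fun w => f w ^+ n.+1) = (fun w => f w * f w ^+ n) by apply/funext => w; rewrite exprS.
exact: ccontM.
Qed.

Lemma ccont_comp (f g : C -> C) z : ccont f z -> ccont g (f z) -> ccont (g \o f) z.
Proof.
move=> cf cg e /cg[d d0 H]; have [c c0 K] := cf d d0.
by exists c => // w /K/H.
Qed.

Lemma cderiv_cont (f : C -> C) z b : cderiv f z b -> ccont f z.
Proof.
move=> /cderiv_slope[p [cp _] pE].
have -> : f = (fun w => f z + p w * (w - z)) by apply/funext => w; rewrite -pE addrC subrK.
apply: ccontD; first exact: ccont_cst.
apply: ccontM => //; apply: ccontB; [exact: ccont_id|exact: ccont_cst].
Qed.

Lemma cderiv_cst a z : cderiv (fun=> a) z 0.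
Proof.
by move=> e e0; exists 1 => // w _; rewrite subrr mul0r subr0 cabs0 mulr_ge0 ?cabs_ge0// ltW.
Qed.

Lemma cderiv_id z : cderiv id z 1.
Proof.
by move=> e e0; exists 1 => // w _; rewrite mul1r subrr cabs0 mulr_ge0 ?cabs_ge0// ltW.
Qed.

Lemma cderivD (f g : C -> C) z b c :
  cderiv f z b -> cderiv g z c -> cderiv (fun w => f w + g w) z (b + c).
Proof.
move=> /cderiv_slope[p [cp <-] pE] /cderiv_slope[q [cq <-] qE].
apply/cderiv_slope; exists (fun w => p w + q w); first by split=> //; exact: ccontD.
by move=> w; rewrite mulrDl -pE -qE opprD addrACA.
Qed.

Lemma cderivM (f g : C -> C) z b c :
  cderiv f z b -> cderiv g z c -> cderiv (fun w => f w * g w) z (b * g z + f z * c).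
Proof.
move=> df dg; have cg := cderiv_cont dg.
move: df dg => /cderiv_slope[p [cp <-] pE] /cderiv_slope[q [cq <-] qE].
apply/cderiv_slope; exists (fun w => p w * g w + f z * q w).
  split=> //; apply: ccontD; apply: ccontM => //; exact: ccont_cst.
move=> w; rewrite mulrDl mulrAC -pE -mulrA -qE; ring.
Qed.

Lemma cderivV (f : C -> C) z b :
  cderiv f z b -> f z != 0 -> cderiv (fun w => (f w)^-1) z (- b / f z ^+ 2).
Proof.
move=> df fz0; have cf := cderiv_cont df.
have [d d0 nz] : exists2 d, 0 < d & forall w, cabs (w - z) < d -> f w != 0.
  have [|d d0 H] := cf (cabs (f z)); first by rewrite cabs_gt0.
  exists d => // w /H; apply: contraPneq => ->.
  by rewrite sub0r cabsN ltxx.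
move: df => /cderiv_slope[p [cp <-] pE].
(* A Caratheodory factor is required at every point, also where f vanishes: away
   from z the inverse of f is replaced with a function that has an obvious factor. *)
have : cderiv (fun w => if cabs (w - z) < d then (f w)^-1 else
    (f z)^-1 - p w / (f z ^+ 2) * (w - z)) z (- p z / f z ^+ 2).
  apply/cderiv_slope; exists (fun w => if cabs (w - z) < d then - p w / (f w * f z)
    else - p w / (f z ^+ 2)).
    rewrite subrr cabs0 d0; split=> //.
    move=> e e0.
    have : ccont (fun w => - p w / (f w * f z)) z.
      apply: ccontM; first exact: ccontN.
      apply: ccontV; last by rewrite mulf_neq0.
      by apply: ccontM => //; exact: ccont_cst.
    move=> /(_ e e0)[d1 d10 H]; exists (Num.min d d1); first by rewrite lt_min d0.
    by move=> w; rewrite lt_min subrr cabs0 d0 => /andP[wd /H]; rewrite wd.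
  move=> w; rewrite subrr cabs0 d0; case: ifPn => wd; last by rewrite addrAC subrr sub0r mulNr mulNr.
  have := nz _ wd => fw0.
  rewrite mulrAC mulNr -pE; field; exact/andP.
move=> H e e0; have [d1 d10 {}H] := H e e0; exists (Num.min d d1); first by rewrite lt_min d0.
by move=> w; rewrite lt_min => /andP[wd /H]; rewrite wd subrr cabs0 d0.
Qed.

Lemma cderiv_comp (f g : C -> C) z b c :
  cderiv f z b -> cderiv g (f z) c -> cderiv (g \o f) z (c * b).
Proof.
move=> df /cderiv_slope[q [cq <-] qE]; have cf := cderiv_cont df.
move: df => /cderiv_slope[p [cp <-] pE].
apply/cderiv_slope; exists (fun w => q (f w) * p w).
  split=> //; apply: ccontM => //; exact: ccont_comp cf cq.
by move=> w; rewrite /= qE pE mulrA.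
Qed.

Lemma cderiv_near (f g : C -> C) z b :
  (\forall w \near z, f w = g w) -> cderiv f z b -> cderiv g z b.
Proof.
move=> /nbhsC[r r0 fg] H e e0.
have [d d0 {}H] := H e e0; exists (Num.min d r); first by rewrite lt_min d0.
move=> w; rewrite lt_min => /andP[wd wr].
by rewrite -!fg ?subrr ?cabs0//; exact: H.
Qed.

Definition cdiff (f : C -> C) z := exists b, cderiv f z b.

Lemma cdiff_cont (f : C -> C) z : cdiff f z -> ccont f z.
Proof. by move=> [b /cderiv_cont]. Qed.

Lemma cdiff_cst a z : cdiff (fun=> a) z.
Proof. by exists 0; exact: cderiv_cst. Qed.

Lemma cdiff_id z : cdiff id z.
Proof. by exists 1; exact: cderiv_id. Qed.

Lemma cdiffD (f g : C -> C) z : cdiff f z -> cdiff g z -> cdiff (fun w => f w + g w) z.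
Proof. by move=> [b df] [c dg]; exists (b + c); exact: cderivD. Qed.

Lemma cdiffM (f g : C -> C) z : cdiff f z -> cdiff g z -> cdiff (fun w => f w * g w) z.
Proof. by move=> [b df] [c dg]; eexists; exact: cderivM df dg. Qed.

Lemma cdiffN (f : C -> C) z : cdiff f z -> cdiff (fun w => - f w) z.
Proof.
move=> df; have := cdiffM (cdiff_cst (-1) z) df.
by congr cdiff; apply/funext => w; rewrite mulN1r.
Qed.

Lemma cdiffB (f g : C -> C) z : cdiff f z -> cdiff g z -> cdiff (fun w => f w - g w) z.
Proof. by move=> df dg; apply: cdiffD => //; exact: cdiffN. Qed.

Lemma cdiffX (f : C -> C) z n : cdiff f z -> cdiff (fun w => f w ^+ n) z.
Proof.
move=> df; elim: n => [|n IH]; first exact: cdiff_cst.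
by have := cdiffM df IH; congr cdiff; apply/funext => w; rewrite exprS.
Qed.

Lemma cdiffV (f : C -> C) z : cdiff f z -> f z != 0 -> cdiff (fun w => (f w)^-1) z.
Proof. by move=> [b df] f0; eexists; exact: cderivV df f0. Qed.

Lemma cdiff_comp (f g : C -> C) z : cdiff f z -> cdiff g (f z) -> cdiff (g \o f) z.
Proof. by move=> [b df] [c dg]; eexists; exact: cderiv_comp df dg. Qed.

Lemma cdiff_near (f g : C -> C) z :
  (\forall w \near z, f w = g w) -> cdiff f z -> cdiff g z.
Proof. by move=> fg [b df]; exists b; exact: cderiv_near df. Qed.

Lemma near_slope f w b z : z != w ->
  \forall u \near z, (f u - f w) / (u - w) = slope f w b u.
Proof.
move=> zw; apply/nbhsC; exists (cabs (z - w)); first by rewrite cabs_gt0 subr_eq0.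
move=> u uz; rewrite slope_ne//; apply: contraTneq uz => ->.
by rewrite cabsC ltxx.
Qed.

Lemma ccont_near (f g : C -> C) z :
  (\forall w \near z, f w = g w) -> ccont f z -> ccont g z.
Proof.
move=> /nbhsC[r r0 fg] H e e0.
have [d d0 {}H] := H e e0; exists (Num.min d r); first by rewrite lt_min d0.
move=> w; rewrite lt_min => /andP[wd wr].
by rewrite -!fg ?subrr ?cabs0//; exact: H.
Qed.

Lemma ccont_slope f w b z : z != w -> ccont f z -> ccont (slope f w b) z.
Proof.
move=> zw cf; apply: (ccont_near (near_slope f b zw)).
apply: (ccontM (ccontB cf (ccont_cst _ z))).
by apply: (ccontV (ccontB (ccont_id z) (ccont_cst w z))); rewrite subr_eq0.
Qed.

Lemma cdiff_slope f w b z : z != w -> cdiff f z -> cdiff (slope f w b) z.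
Proof.
move=> zw df; apply: (cdiff_near (near_slope f b zw)).
apply: (cdiffM (cdiffB df (cdiff_cst _ z))).
by apply: (cdiffV (cdiffB (cdiff_id z) (cdiff_cst w z))); rewrite subr_eq0.
Qed.

End Modulus.

Arguments cabs : simpl never.
Arguments cR : simpl never.

(** * Integrals of complex functions along segments *)

Section Integral.
Variable R : realType.
Local Notation C := (cplx R).
Local Notation mu := (@lebesgue_measure R).

Definition primitive (f : R -> R) (a x : R) : R := (\int[mu]_(t in `[a, x]) f t)%R.

Lemma primitive_derive (f : R -> R) (a x : R) : continuous f -> a < x ->
  is_derive x 1 (primitive f a) (f x).
Proof.
move=> cf ax; have xx : x < x + 1 by rewrite ltrDl.
have [|dF F'] := @continuous_FTC1_closed _ f a x (x + 1) xx _ ax (cf x).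
  apply: continuous_compact_integrable; first exact: segment_compact.
  exact: continuous_subspaceT.
by split; [exact: dF | rewrite -derive1E; exact: F'].
Qed.

(** The increment of an antiderivative. The latter starts at a - 1 so as to be
    differentiable at a: the fundamental theorem of calculus gives the derivative at
    interior points only. *)
Definition IntR (f : R -> R) (a b : R) : R :=
  primitive f (a - 1) b - primitive f (a - 1) a.

Lemma derive_bound (F f : R -> R) (a b M : R) : a <= b ->
  (forall x, a <= x <= b -> is_derive x 1 F (f x)) ->
  (forall x, a <= x <= b -> `|f x| <= M) ->
  `|F b - F a| <= M * (b - a).
Proof.
move=> ab dF fM.
have [||c cab ->] := @MVT_segment _ F f a b ab.
- by move=> x; rewrite in_itv /= => /andP[/ltW ax /ltW xb]; apply: dF; rewrite ax.
- apply: derivable_within_continuous => x; rewrite in_itv /= => xab.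
  by have [] := dF x xab.
rewrite normrM (ger0_norm (_ : 0 <= b - a)) ?subr_ge0//.
by apply: ler_wpM2r; rewrite ?subr_ge0// fM.
Qed.

(** The difference of two antiderivatives has derivative 0, hence is constant. *)
Lemma IntR_spec (f F : R -> R) (a b : R) : continuous f -> a <= b ->
  (forall x, a <= x <= b -> is_derive x 1 F (f x)) -> IntR f a b = F b - F a.
Proof.
move=> cf ab dF; rewrite /IntR.
set G := primitive f (a - 1).
have dG x : a - 1 < x -> is_derive x 1 G (f x) by exact: primitive_derive.
have := @derive_bound (F \- G) (fun=> 0) a b 0 ab.
have H x : a <= x <= b -> is_derive x 1 (F \- G) 0.
  move=> xab; have -> : (0 : R) = f x - f x by rewrite subrr.
  apply: is_deriveB; first exact: dF.
  by apply: dG; move/andP: xab => [ax _]; lra.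
move=> /(_ H) /=; rewrite mul0r normr0 => /(_ (fun _ _ => lexx _)).
by rewrite normr_le0 => /eqP; lra.
Qed.

Definition dRC (F : R -> C) (x : R) (v : C) :=
  is_derive x 1 (fun t => complex.Re (F t)) (complex.Re v) /\
  is_derive x 1 (fun t => complex.Im (F t)) (complex.Im v).

Definition contRC (f : R -> C) :=
  continuous (fun t => complex.Re (f t)) /\ continuous (fun t => complex.Im (f t)).

Definition Int (f : R -> C) (a b : R) : C :=
  Complex (IntR (fun t => complex.Re (f t)) a b) (IntR (fun t => complex.Im (f t)) a b).

Lemma Int_spec (f F : R -> C) (a b : R) : contRC f -> a <= b ->
  (forall x, a <= x <= b -> dRC F x (f x)) -> Int f a b = F b - F a.
Proof.
move=> [cr ci] ab dF; rewrite /Int.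
rewrite (IntR_spec cr ab (fun x xab => (dF x xab).1)).
rewrite (IntR_spec ci ab (fun x xab => (dF x xab).2)).
by case: (F a) (F b) => [? ?] [? ?].
Qed.

Lemma anti_dRC (f : R -> C) (a : R) : contRC f ->
  exists F : R -> C, forall x, a < x -> dRC F x (f x).
Proof.
move=> [cr ci].
exists (fun t => Complex (primitive (fun t => complex.Re (f t)) a t)
                         (primitive (fun t => complex.Im (f t)) a t)) => x ax.
by split; exact: primitive_derive.
Qed.

Lemma anti_itv (f : R -> C) (a b : R) : contRC f ->
  exists F : R -> C, forall x, a <= x <= b -> dRC F x (f x).
Proof.
move=> cf; have [F dF] := anti_dRC (a - 1) cf; exists F => x /andP[ax _].
by apply: dF; lra.
Qed.

Lemma cReD (z w : C) : complex.Re (z + w) = complex.Re z + complex.Re w.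
Proof. by case: z w => [? ?] [? ?]. Qed.
Lemma cImD (z w : C) : complex.Im (z + w) = complex.Im z + complex.Im w.
Proof. by case: z w => [? ?] [? ?]. Qed.
Lemma cReM (z w : C) : complex.Re (z * w) =
  complex.Re z * complex.Re w - complex.Im z * complex.Im w.
Proof. by case: z w => [? ?] [? ?]. Qed.
Lemma cImM (z w : C) : complex.Im (z * w) =
  complex.Re z * complex.Im w + complex.Im z * complex.Re w.
Proof. by case: z w => [? ?] [? ?]. Qed.

Lemma is_derive_congr (f g : R -> R) (x v w : R) :
  (forall t, f t = g t) -> v = w -> is_derive x 1 f v -> is_derive x 1 g w.
Proof. by move=> /funext -> ->. Qed.

Lemma dRC_D F G x v w : dRC F x v -> dRC G x w -> dRC (fun t => F t + G t) x (v + w).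
Proof.
move=> [a b] [c d]; split.
  by apply: is_derive_congr (is_deriveD a c) => [t|]; rewrite cReD.
by apply: is_derive_congr (is_deriveD b d) => [t|]; rewrite cImD.
Qed.

Lemma dRC_Z F x v (c : C) : dRC F x v -> dRC (fun t => c * F t) x (c * v).
Proof.
move=> [a b]; split.
  by apply: is_derive_congr (is_deriveB (is_deriveZ (complex.Re c) a)
    (is_deriveZ (complex.Im c) b)) => [t|]; rewrite cReM.
by apply: is_derive_congr (is_deriveD (is_deriveZ (complex.Re c) b)
    (is_deriveZ (complex.Im c) a)) => [t|]; rewrite cImM.
Qed.

Lemma dRC_cR (x : R) : dRC (@cR R) x 1.
Proof. by split; [exact: is_derive_id|exact: is_derive_cst]. Qed.

Lemma dRC_sqr (x : R) : dRC (fun t => cR (t ^+ 2 / 2)) x (cR x).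
Proof.
split; last exact: is_derive_cst.
apply: is_derive_congr (is_deriveZ (2^-1) (is_deriveX 2 (is_derive_id x 1))) => [t|] /=.
  by rewrite [LHS]mulrC.
by rewrite expr1 -[_ *: _]/(_ * _) -[_ *: _]/(_ * _) mulr1 -mulr_natl mulKf ?pnatr_eq0.
Qed.

Lemma contRC_D f g : contRC f -> contRC g -> contRC (fun t => f t + g t).
Proof.
move=> [a b] [c d]; split=> t.
  have -> : (fun t => complex.Re (f t + g t)) = (fun t => complex.Re (f t) + complex.Re (g t)).
    by apply/funext => u; rewrite cReD.
  exact: (continuousD (a t) (c t)).
have -> : (fun t => complex.Im (f t + g t)) = (fun t => complex.Im (f t) + complex.Im (g t)).
  by apply/funext => u; rewrite cImD.
exact: (continuousD (b t) (d t)).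
Qed.

Lemma continuous_lincomb (f g : R -> R) (a b : R) : continuous f -> continuous g ->
  continuous (fun t => a * f t + b * g t).
Proof.
move=> cf cg t; apply: (@continuousD _ _ _ (fun t => a * f t) (fun t => b * g t)).
  exact: (continuousM (@cvg_cst _ _ _ _ _) (cf t)).
exact: (continuousM (@cvg_cst _ _ _ _ _) (cg t)).
Qed.

Lemma contRC_Z f (c : C) : contRC f -> contRC (fun t => c * f t).
Proof.
move=> [a b]; split=> t.
  have -> : (fun t => complex.Re (c * f t)) =
      (fun t => complex.Re c * complex.Re (f t) + (- complex.Im c) * complex.Im (f t)).
    by apply/funext => u; rewrite cReM mulNr.
  exact: (@continuous_lincomb _ _ (complex.Re c) (- complex.Im c) a b t).
have -> : (fun t => complex.Im (c * f t)) =
    (fun t => complex.Re c * complex.Im (f t) + complex.Im c * complex.Re (f t)).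
  by apply/funext => u; rewrite cImM.
exact: (@continuous_lincomb _ _ (complex.Re c) (complex.Im c) b a t).
Qed.

Lemma contRC_cst (c : C) : contRC (fun=> c).
Proof. by split=> t; exact: cvg_cst. Qed.

Lemma contRC_cR : contRC (@cR R).
Proof. by split=> t; [exact: cvg_id|exact: cvg_cst]. Qed.

Lemma Int_split f (a b c : R) : contRC f -> a <= c -> c <= b ->
  Int f a b = Int f a c + Int f c b.
Proof.
move=> cf ac cb; have [F dF] := anti_itv a b cf.
rewrite !(@Int_spec f F)//; first by ring.
- by move=> x /andP[cx xb]; apply: dF; rewrite xb (le_trans ac).
- by move=> x /andP[ax xc]; apply: dF; rewrite ax (le_trans xc).
- exact: le_trans cb.
Qed.

Lemma Int_D f g (a b : R) : contRC f -> contRC g -> a <= b ->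
  Int (fun t => f t + g t) a b = Int f a b + Int g a b.
Proof.
move=> cf cg ab; have [F dF] := anti_itv a b cf; have [G dG] := anti_itv a b cg.
rewrite (Int_spec cf ab dF) (Int_spec cg ab dG).
rewrite (@Int_spec _ (fun t => F t + G t) a b (contRC_D cf cg) ab); first by ring.
by move=> x xab; apply: dRC_D; [exact: dF|exact: dG].
Qed.

Lemma Int_Z f (c : C) (a b : R) : contRC f -> a <= b ->
  Int (fun t => c * f t) a b = c * Int f a b.
Proof.
move=> cf ab; have [F dF] := anti_itv a b cf.
rewrite (Int_spec cf ab dF) (@Int_spec _ (fun t => c * F t) a b (contRC_Z _ cf) ab) ?mulrBr//.
by move=> x xab; apply: dRC_Z; exact: dF.
Qed.

Lemma Int_affine (p q : C) (a b : R) : a <= b ->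
  Int (fun t => p + q * cR t) a b = p * (cR b - cR a) + q * (cR (b ^+ 2 / 2) - cR (a ^+ 2 / 2)).
Proof.
move=> ab; rewrite (@Int_spec _ (fun t => p * cR t + q * cR (t ^+ 2 / 2)) _ _ _ ab).
- ring.
- exact: (contRC_D (contRC_cst p) (contRC_Z q contRC_cR)).
- move=> x _; apply: dRC_D; last exact: (dRC_Z q (dRC_sqr x)).
  by have := dRC_Z p (dRC_cR x); rewrite mulr1.
Qed.

(** The factor 2 comes from bounding the real and imaginary parts separately. Only
    the existence of a constant matters: the maximum principle removes it. *)
Lemma Int_bound f (a b M : R) : contRC f -> a <= b ->
  (forall x, a <= x <= b -> cabs (f x) <= M) -> cabs (Int f a b) <= 2 * M * (b - a).
Proof.
move=> cf ab fM; have [F dF] := anti_itv a b cf.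
rewrite (Int_spec cf ab dF); apply: le_trans (cabs_le_ReIm _) _.
have -> : 2 * M * (b - a) = M * (b - a) + M * (b - a) by ring.
have E z w : complex.Re (z - w : C) = complex.Re z - complex.Re w by case: z w => [? ?] [? ?].
have E' z w : complex.Im (z - w : C) = complex.Im z - complex.Im w by case: z w => [? ?] [? ?].
rewrite E E' lerD//.
  apply: (derive_bound ab (fun x xab => (dF x xab).1)) => x /fM.
  by apply: le_trans; exact: cabs_Re.
apply: (derive_bound ab (fun x xab => (dF x xab).2)) => x /fM.
by apply: le_trans; exact: cabs_Im.
Qed.

(** Meant for the Cauchy kernel: a lower bound for its integral around a square is
    enough, in place of the exact value 2 i pi. *)
Lemma Int_Im_lower f (a b m : R) : contRC f -> a <= b ->
  (forall x, a <= x <= b -> m <= complex.Im (f x)) -> m * (b - a) <= complex.Im (Int f a b).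
Proof.
move=> cf ab fm; have [F dF] := anti_itv a b cf.
rewrite (Int_spec cf ab dF).
have -> : complex.Im (F b - F a) = complex.Im (F b) - complex.Im (F a).
  by case: (F b) (F a) => [? ?] [? ?].
have [||c cab ->] := @MVT_segment _ (fun t => complex.Im (F t)) (fun t => complex.Im (f t)) a b ab.
- by move=> x; rewrite in_itv /= => /andP[/ltW ax /ltW xb]; apply: (dF x _).2; rewrite ax.
- apply: derivable_within_continuous => x; rewrite in_itv /= => xab.
  by have [_ []] := dF x xab.
by apply: ler_wpM2r; rewrite ?subr_ge0// fm.
Qed.

Lemma ccont_contRC (f : C -> C) (p q : C) : (forall z, ccont f z) ->
  contRC (fun t => f (p + q * cR t)).
Proof.
move=> cf; have H (t e : R) : 0 < e -> \forall u \near t,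
    cabs (f (p + q * cR u) - f (p + q * cR t)) < e.
  move=> e0; have [d d0 Hd] := cf (p + q * cR t) e e0.
  have q1 : 0 < cabs q + 1 by have := cabs_ge0 q; lra.
  have : \forall u \near t, `|t - u| < d / (cabs q + 1).
    by apply: (@cvgr_dist_lt _ _ _ _ _ id t cvg_id); rewrite divr_gt0.
  apply: filterS => u ut; apply: Hd.
  have -> : p + q * cR u - (p + q * cR t) = q * (cR u - cR t) by ring.
  rewrite cabsM -cRB cabs_cR distrC.
  move: ut; rewrite ltr_pdivlMr// => ut; apply: le_lt_trans ut.
  by rewrite mulrC; apply: ler_wpM2l => //; lra.
split=> t; apply/cvgrPdist_lt => e e0; near=> u.
- rewrite distrC; apply: (@le_lt_trans _ _ (cabs (f (p + q * cR u) - f (p + q * cR t)))).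
    apply: le_trans (cabs_Re _).
    by case: (f (p + q * cR u)) (f (p + q * cR t)) => [? ?] [? ?].
  by near: u; exact: H.
- rewrite distrC; apply: (@le_lt_trans _ _ (cabs (f (p + q * cR u) - f (p + q * cR t)))).
    apply: le_trans (cabs_Im _).
    by case: (f (p + q * cR u)) (f (p + q * cR t)) => [? ?] [? ?].
  by near: u; exact: H.
Unshelve. all: by end_near.
Qed.

End Integral.

(** * Goursat's theorem *)

Section Goursat.
Variable R : realType.
Local Notation C := (cplx R).
Local Notation cR := (@cR R).

Definition iC : C := Complex 0 1.

Lemma cabs_iC : cabs iC = 1.
Proof. by rewrite /cabs /= expr0n expr1n add0r sqrtr1. Qed.

Lemma iC_sqr : iC * iC = -1.
Proof. by rewrite /iC; simpc. Qed.

Definition pt (x y : R) : C := cR x + iC * cR y.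

Lemma ptE x y : pt x y = Complex x y.
Proof. by rewrite /pt /iC /cR; simpc. Qed.

Definition hside (f : C -> C) (y t : R) : C := f (pt t y).
Definition vside (f : C -> C) (x t : R) : C := f (pt x t).

Lemma contRC_h f y : (forall z, ccont f z) -> contRC (hside f y).
Proof.
move=> cf; have := ccont_contRC (iC * cR y) 1 cf; congr contRC.
by apply/funext => t; rewrite /hside /pt mul1r addrC.
Qed.

Lemma contRC_v f x : (forall z, ccont f z) -> contRC (vside f x).
Proof. by move=> cf; have := ccont_contRC (cR x) iC cf. Qed.

(** The contour integral of f along the boundary of [x0, x1] x [y0, y1], oriented
    counterclockwise *)
Definition rect (f : C -> C) (x0 x1 y0 y1 : R) : C :=
  Int (hside f y0) x0 x1 + iC * Int (vside f x1) y0 y1 -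
  Int (hside f y1) x0 x1 - iC * Int (vside f x0) y0 y1.

Lemma rect_splitx f (x0 m x1 y0 y1 : R) : (forall z, ccont f z) ->
  x0 <= m -> m <= x1 ->
  rect f x0 x1 y0 y1 = rect f x0 m y0 y1 + rect f m x1 y0 y1.
Proof.
move=> cf xm mx; rewrite /rect !(@Int_split _ _ x0 x1 m)//; try exact: contRC_h.
ring.
Qed.

Lemma rect_splity f (x0 x1 y0 n y1 : R) : (forall z, ccont f z) ->
  y0 <= n -> n <= y1 ->
  rect f x0 x1 y0 y1 = rect f x0 x1 y0 n + rect f x0 x1 n y1.
Proof.
move=> cf xm mx; rewrite /rect !(@Int_split _ _ y0 y1 n)//; try exact: contRC_v.
ring.
Qed.

Lemma rectD f g (x0 x1 y0 y1 : R) : (forall z, ccont f z) -> (forall z, ccont g z) ->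
  x0 <= x1 -> y0 <= y1 ->
  rect (fun z => f z + g z) x0 x1 y0 y1 = rect f x0 x1 y0 y1 + rect g x0 x1 y0 y1.
Proof.
move=> cf cg x01 y01; rewrite /rect.
have Hh y : Int (hside (fun z => f z + g z) y) x0 x1 = Int (hside f y) x0 x1 + Int (hside g y) x0 x1.
  exact: (Int_D (contRC_h y cf) (contRC_h y cg)).
have Hv x : Int (vside (fun z => f z + g z) x) y0 y1 = Int (vside f x) y0 y1 + Int (vside g x) y0 y1.
  exact: (Int_D (contRC_v x cf) (contRC_v x cg)).
rewrite !Hh !Hv; ring.
Qed.

Lemma ccont_affine (p q z : C) : ccont (fun z => p + q * z) z.
Proof.
apply: (ccontD (ccont_cst p z)); exact: (ccontM (ccont_cst q z) (ccont_id z)).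
Qed.

(** By explicit antiderivatives on the sides. In the proof of Goursat's theorem this
    removes the affine approximation of f at the limit point. *)
Lemma rect_affine (p q : C) (x0 x1 y0 y1 : R) : x0 <= x1 -> y0 <= y1 ->
  rect (fun z => p + q * z) x0 x1 y0 y1 = 0.
Proof.
move=> x01 y01; rewrite /rect.
have hE y : hside (fun z => p + q * z) y = (fun t => (p + q * (iC * cR y)) + q * cR t).
  by apply/funext => t; rewrite /hside /pt; ring.
have vE x : vside (fun z => p + q * z) x = (fun t => (p + q * cR x) + (q * iC) * cR t).
  by apply/funext => t; rewrite /vside /pt; ring.
rewrite !hE !vE !Int_affine// !cRM.
set h := cR 2^-1.
have h2 : h + h = 1 by rewrite /h -cRD -cR1; congr cR; lra.
have -> : forall a b c d : C,
  (p + q * (iC * c)) * (b - a) + q * (b * b * h - a * a * h) +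
  iC * ((p + q * b) * (d - c) + q * iC * (d * d * h - c * c * h)) -
  ((p + q * (iC * d)) * (b - a) + q * (b * b * h - a * a * h)) -
  iC * ((p + q * a) * (d - c) + q * iC * (d * d * h - c * c * h)) = 0.
  by move=> a b c d; ring.
by [].
Qed.

Lemma rect_bound f (x0 x1 y0 y1 M : R) : (forall z, ccont f z) -> x0 <= x1 -> y0 <= y1 ->
  (forall x y, x0 <= x <= x1 -> y0 <= y <= y1 -> cabs (f (pt x y)) <= M) ->
  cabs (rect f x0 x1 y0 y1) <= 4 * M * ((x1 - x0) + (y1 - y0)).
Proof.
move=> cf x01 y01 fM; rewrite /rect.
have B y : y0 <= y <= y1 -> cabs (Int (hside f y) x0 x1) <= 2 * M * (x1 - x0).
  by move=> yy; apply: Int_bound => //; [exact: contRC_h|move=> x xx; exact: fM].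
have D x : x0 <= x <= x1 -> cabs (Int (vside f x) y0 y1) <= 2 * M * (y1 - y0).
  by move=> xx; apply: Int_bound => //; [exact: contRC_v|move=> y yy; exact: fM].
have B0 := B y0; have B1 := B y1; have D0 := D x0; have D1 := D x1.
rewrite !lexx ?y01 ?x01 in B0 B1 D0 D1.
have {}B0 := B0 isT; have {}B1 := B1 isT; have {}D0 := D0 isT; have {}D1 := D1 isT.
have T := cabsD (Int (hside f y0) x0 x1 + iC * Int (vside f x1) y0 y1 -
  Int (hside f y1) x0 x1) (- (iC * Int (vside f x0) y0 y1)).
have T1 := cabsD (Int (hside f y0) x0 x1 + iC * Int (vside f x1) y0 y1)
  (- Int (hside f y1) x0 x1).
have T2 := cabsD (Int (hside f y0) x0 x1) (iC * Int (vside f x1) y0 y1).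
rewrite !cabsN !cabsM !cabs_iC !mul1r in T T1 T2.
lra.
Qed.

Section Bisection.
Variable (f : C -> C).
Hypothesis cf : forall z, ccont f z.

Variant max_quarter_spec (t a b c d : R) : Prop :=
  | MaxQ1 of t <= 4 * a | MaxQ2 of t <= 4 * b
  | MaxQ3 of t <= 4 * c | MaxQ4 of t <= 4 * d.

Lemma max_quarter (t a b c d : R) : t <= a + b + c + d -> max_quarter_spec t a b c d.
Proof.
move=> T; have [|na] := leP t (4 * a); first exact: MaxQ1.
have [|nb] := leP t (4 * b); first exact: MaxQ2.
have [|nc] := leP t (4 * c); first exact: MaxQ3.
by apply: MaxQ4; lra.
Qed.

(** The contour integrals of the four quarters add up to that of the rectangle, so
    that one of them has at least a quarter of its modulus. *)
Lemma rect_quarter (x y w h : R) : 0 <= w -> 0 <= h ->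
  exists p : R * R, [/\ x <= p.1 <= x + w / 2, y <= p.2 <= y + h / 2 &
  cabs (rect f x (x + w) y (y + h)) <=
  4 * cabs (rect f p.1 (p.1 + w / 2) p.2 (p.2 + h / 2))].
Proof.
move=> w0 h0; have w20 : 0 <= w / 2 by lra. have h20 : 0 <= h / 2 by lra.
have lo (u v : R) : 0 <= v / 2 -> u <= u <= u + v / 2 by move=> v0; lra.
have hi (u v : R) : 0 <= v / 2 -> u <= u + v / 2 <= u + v / 2 by move=> v0; lra.
have E : rect f x (x + w) y (y + h) =
   rect f x (x + w / 2) y (y + h / 2) + rect f x (x + w / 2) (y + h / 2) (y + h / 2 + h / 2) +
   (rect f (x + w / 2) (x + w / 2 + w / 2) y (y + h / 2) +
    rect f (x + w / 2) (x + w / 2 + w / 2) (y + h / 2) (y + h / 2 + h / 2)).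
  have -> : x + w / 2 + w / 2 = x + w by lra.
  have -> : y + h / 2 + h / 2 = y + h by lra.
  rewrite (@rect_splitx f x (x + w / 2)) ?lerDl//; last by lra.
  by congr (_ + _); apply: rect_splity => //; lra.
set a := rect f x (x + w / 2) y (y + h / 2) in E.
set b := rect f x (x + w / 2) (y + h / 2) (y + h / 2 + h / 2) in E.
set c := rect f (x + w / 2) (x + w / 2 + w / 2) y (y + h / 2) in E.
set d := rect f (x + w / 2) (x + w / 2 + w / 2) (y + h / 2) (y + h / 2 + h / 2) in E.
have T : cabs (rect f x (x + w) y (y + h)) <= cabs a + cabs b + cabs c + cabs d.
  rewrite E; apply: le_trans (cabsD _ _) _; rewrite -[leRHS]addrA.
  by apply: lerD; exact: cabsD.
case: (max_quarter T) => M.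
- by exists (x, y); split; [exact: lo w20|exact: lo h20|exact: M].
- by exists (x, y + h / 2); split; [exact: lo w20|exact: hi h20|exact: M].
- by exists (x + w / 2, y); split; [exact: hi w20|exact: lo h20|exact: M].
- by exists (x + w / 2, y + h / 2); split; [exact: hi w20|exact: hi h20|exact: M].
Qed.

(** The left ends increase and stay below every right end; c is their supremum. *)
Lemma nested_point (x : nat -> R) (w : R) : 0 <= w ->
  (forall n, x n <= x n.+1 <= x n + w / 2 ^+ n.+1) ->
  exists c, forall n, x n <= c <= x n + w / 2 ^+ n.
Proof.
move=> w0 H.
have E n : w / 2 ^+ n = w / 2 ^+ n.+1 + w / 2 ^+ n.+1.
  rewrite exprS invfM mulrCA; set u := w / 2 ^+ n; lra.
have up m n : x n <= x (n + m)%N.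
  elim: m => [|m IH]; first by rewrite addn0.
  by rewrite addnS (le_trans IH)//; case/andP: (H (n + m)%N).
have dn m n : x (n + m)%N + w / 2 ^+ (n + m) <= x n + w / 2 ^+ n.
  elim: m => [|m IH]; first by rewrite addn0.
  rewrite addnS (le_trans _ IH)// (E (n + m)%N).
  by case/andP: (H (n + m)%N) => _; lra.
have wn n : 0 <= w / 2 ^+ n by rewrite divr_ge0// exprn_ge0.
have hub m : ubound (range x) (x m + w / 2 ^+ m).
  move=> _ [n _ <-]; have := wn n; case: (leqP n m) => nm.
    by have := up (m - n)%N n; rewrite subnKC//; have := wn m; lra.
  have := dn (n - m)%N m; rewrite subnKC ?(ltnW nm)//; lra.
exists (sup (range x)) => n; apply/andP; split.
  by apply: ub_le_sup; [exists (x 0%N + w / 2 ^+ 0)|exists n].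
by apply: ge_sup; [exists (x 0%N), 0%N|].
Qed.

(** Bisection yields nested rectangles whose contour integrals decrease at most like
    4 ^- n. They shrink to a point p, near which f is affine up to an error e |z - p|;
    as the affine part does not contribute, the n-th integral is at most a constant
    times e 4 ^- n, with e arbitrarily small. *)
Lemma goursat (x0 x1 y0 y1 : R) : x0 <= x1 -> y0 <= y1 ->
  (forall x y, x0 <= x <= x1 -> y0 <= y <= y1 -> cdiff f (pt x y)) ->
  rect f x0 x1 y0 y1 = 0.
Proof.
move=> x01 y01 df; pose w := x1 - x0; pose h := y1 - y0.
have w0 : 0 <= w by rewrite subr_ge0.
have h0 : 0 <= h by rewrite subr_ge0.
have p2 n : 0 < 2 ^+ n :> R by rewrite exprn_gt0.
have /choice[nxt nxtP] : forall q : nat * (R * R), exists p : R * R,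
    [/\ q.2.1 <= p.1 <= q.2.1 + w / 2 ^+ q.1.+1,
        q.2.2 <= p.2 <= q.2.2 + h / 2 ^+ q.1.+1 &
     cabs (rect f q.2.1 (q.2.1 + w / 2 ^+ q.1) q.2.2 (q.2.2 + h / 2 ^+ q.1)) <=
     4 * cabs (rect f p.1 (p.1 + w / 2 ^+ q.1.+1) p.2 (p.2 + h / 2 ^+ q.1.+1))].
  move=> [n [x y]] /=.
  have [||p [p1 p22 p3]] := @rect_quarter x y (w / 2 ^+ n) (h / 2 ^+ n).
  - by rewrite divr_ge0// ltW.
  - by rewrite divr_ge0// ltW.
  by exists p; rewrite exprSr invfM !mulrA.
pose S := fix S n := if n is m.+1 then nxt (m, S m) else (x0, y0).
have SP n := nxtP (n, S n).
have big n : cabs (rect f x0 x1 y0 y1) <= 4 ^+ n *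
   cabs (rect f (S n).1 ((S n).1 + w / 2 ^+ n) (S n).2 ((S n).2 + h / 2 ^+ n)).
  elim: n => [|n IH].
    by rewrite expr0 mul1r !divr1 /= !subrKC.
  apply: le_trans IH _; rewrite exprSr -mulrA ler_wpM2l ?exprn_ge0//.
  by have [] := SP n.
have [|cx cxP] := @nested_point (fun n => (S n).1) w w0.
  by move=> n; have [] := SP n.
have [|cy cyP] := @nested_point (fun n => (S n).2) h h0.
  by move=> n; have [] := SP n.
have [b Hb] : cdiff f (pt cx cy).
  apply: df.
    by have := cxP 0%N; rewrite /= divr1 subrKC.
  by have := cyP 0%N; rewrite /= divr1 subrKC.
apply/eqP; rewrite -cabs_eq0 eq_le cabs_ge0 andbT leNgt; apply/negP => pos.
set eta := cabs (rect f x0 x1 y0 y1) in pos big.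
(* The summand 1 keeps D positive when the rectangle is degenerate; for this e the
   two estimates differ by a factor 2. *)
pose D := w + h + 1; have D0 : 0 < D by rewrite /D; lra.
pose e := eta / (8 * D * D).
have e0 : 0 < e by rewrite divr_gt0// !mulr_gt0.
have [d d0 {}Hb] := Hb e e0.
have [n Hn] : exists n, D / 2 ^+ n < d.
  pose k := Num.bound (D / d); exists k; rewrite ltr_pdivrMr// mulrC -ltr_pdivrMr//.
  have := archi_boundP (ltW (divr_gt0 D0 d0)); rewrite -/k => /lt_trans; apply.
  by rewrite -natrX ltr_nat ltn_expl.
pose r z := f z - f (pt cx cy) - b * (z - pt cx cy).
have cr z : ccont r z.
  apply: ccontB; first exact: (ccontB (cf z) (ccont_cst _ z)).
  exact: (ccontM (ccont_cst b z) (ccontB (ccont_id z) (ccont_cst _ z))).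
have fE : f = (fun z => r z + ((f (pt cx cy) - b * pt cx cy) + b * z)).
  by apply/funext => z; rewrite /r; ring.
have rE u0 u1 v0 v1 : u0 <= u1 -> v0 <= v1 -> rect f u0 u1 v0 v1 = rect r u0 u1 v0 v1.
  move=> u01 v01; rewrite [in LHS]fE.
  rewrite (rectD cr (fun z => @ccont_affine (f (pt cx cy) - b * pt cx cy) b z) u01 v01).
  by rewrite (rect_affine _ _ u01 v01) addr0.
have wn : 0 <= w / 2 ^+ n by rewrite divr_ge0// ltW.
have hn : 0 <= h / 2 ^+ n by rewrite divr_ge0// ltW.
have := big n; rewrite rE ?lerDl//.
have DE : D / 2 ^+ n = w / 2 ^+ n + h / 2 ^+ n + (2 ^+ n)^-1 by rewrite /D !mulrDl mul1r.
have i2 : 0 < (2 ^+ n)^-1 :> R by rewrite invr_gt0.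
have := @rect_bound r (S n).1 ((S n).1 + w / 2 ^+ n) (S n).2 ((S n).2 + h / 2 ^+ n)
  (e * (D / 2 ^+ n)) cr.
rewrite !lerDl wn hn => /(_ isT isT) B.
have {}B : cabs (rect r (S n).1 ((S n).1 + w / 2 ^+ n) (S n).2 ((S n).2 + h / 2 ^+ n)) <=
    4 * (e * (D / 2 ^+ n)) * (D / 2 ^+ n).
  apply: le_trans (B _) _.
    move=> x y xx yy.
    have zd : cabs (pt x y - pt cx cy) <= w / 2 ^+ n + h / 2 ^+ n.
      rewrite !ptE; apply: le_trans (cabs_le_ReIm _) _; rewrite lerD//=.
        by have := cxP n; rewrite ler_norml; lra.
      by have := cyP n; rewrite ler_norml; lra.
    apply: le_trans (Hb _ _) _; first lra.
    by apply: ler_wpM2l; [exact: ltW|lra].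
  apply: ler_wpM2l; last by rewrite DE; lra.
  apply: mulr_ge0 => //; apply: mulr_ge0; first exact: ltW.
  by apply: divr_ge0; exact: ltW.
move=> A.
have : eta <= 4 ^+ n * (4 * (e * (D / 2 ^+ n)) * (D / 2 ^+ n)).
  by apply: le_trans A _; apply: ler_wpM2l => //; rewrite exprn_ge0.
have -> : 4 ^+ n * (4 * (e * (D / 2 ^+ n)) * (D / 2 ^+ n)) = eta / 2.
  have -> : 4 ^+ n = 2 ^+ n * 2 ^+ n :> R by rewrite -exprMn; congr (_ ^+ n); ring.
  rewrite /e; field; rewrite !gt_eqF//.
lra.
Qed.

End Bisection.
End Goursat.

(** * The maximum principle with exceptional points *)

Section MaximumPrinciple.
Variable R : realType.
Local Notation C := (cplx R).
Local Notation cR := (@cR R).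
Local Notation iC := (@iC R).

(** Goursat's theorem on the four rectangles around a small square centred at 0
    reduces the contour to the boundary of that square, whose length tends to 0 while
    g stays bounded on it. *)
Lemma goursat_punctured (g : C -> C) : (forall z, ccont g z) ->
  (forall x y, -1 <= x <= 1 -> -1 <= y <= 1 -> pt x y != 0 -> cdiff g (pt x y)) ->
  rect g (-1) 1 (-1) 1 = 0.
Proof.
move=> cg dg.
have nz (x y : R) : x != 0 \/ y != 0 -> pt x y != 0.
  by rewrite ptE eq_complex /= negb_and => -[->|->] //; rewrite orbT.
have shrink s : 0 < s < 1 -> rect g (-1) 1 (-1) 1 = rect g (- s) s (- s) s.
  move=> s01.
  have h1 : -1 <= - s by lra.
  have h2 : - s <= s by lra.
  have h3 : s <= 1 by lra.
  have h4 : - s <= 1 by lra.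
  have h5 : -1 <= s by lra.
  have h6 : -1 <= 1 :> R by lra.
  rewrite (@rect_splity _ g (-1) 1 (-1) (- s) 1 cg h1 h4) (@rect_splity _ g (-1) 1 (- s) s 1 cg h2 h3).
  rewrite (@rect_splitx _ g (-1) (- s) 1 (- s) s cg h1 h4) (@rect_splitx _ g (- s) s 1 (- s) s cg h2 h3).
  rewrite (@goursat _ g cg (-1) 1 (-1) (- s) h6 h1); last first.
    by move=> x y hx hy; apply: dg; [lra|lra|apply: nz; right; lra].
  rewrite (@goursat _ g cg (-1) 1 s 1 h6 h3); last first.
    by move=> x y hx hy; apply: dg; [lra|lra|apply: nz; right; lra].
  rewrite (@goursat _ g cg (-1) (-s) (-s) s h1 h2); last first.
    by move=> x y hx hy; apply: dg; [lra|lra|apply: nz; left; lra].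
  rewrite (@goursat _ g cg s 1 (-s) s h3 h2); last first.
    by move=> x y hx hy; apply: dg; [lra|lra|apply: nz; left; lra].
  by rewrite !add0r !addr0.
apply/eqP; rewrite -cabs_eq0 eq_le cabs_ge0 andbT leNgt; apply/negP.
set eta := cabs _ => eta0.
have [d d0 Hd] := cg 0 1 ltr01.
pose M := cabs (g 0) + 1.
have M0 : 0 < M by rewrite /M; have := cabs_ge0 (g 0); lra.
pose s := Num.min (1 / 2) (Num.min (d / 4) (eta / (32 * M))).
have s0 : 0 < s by rewrite !lt_min !divr_gt0// mulr_gt0.
have s1 : s <= 1 / 2 by rewrite ge_min lexx.
have s2 : s <= d / 4 by rewrite !ge_min lexx orbT.
have s3 : s <= eta / (32 * M) by rewrite !ge_min lexx !orbT.
have ss : 0 < s < 1 by lra.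
have := @rect_bound _ g (- s) s (- s) s M cg; rewrite -shrink// -/eta.
have ns : - s <= s by lra.
move=> /(_ ns ns) H.
have {}H : eta <= 4 * M * (s - - s + (s - - s)).
  apply: H => x y hx hy.
  have : cabs (pt x y - 0) < d.
    rewrite subr0 ptE; apply: le_lt_trans (cabs_le_ReIm _) _ => /=.
    have : `|x| <= s by rewrite ler_norml.
    have : `|y| <= s by rewrite ler_norml.
    lra.
  move=> /Hd; have := cabs_sub (g (pt x y)) (g 0); rewrite /M; lra.
have : eta <= eta / 2.
  apply: le_trans H _; have -> : 4 * M * (s - - s + (s - - s)) = 16 * M * s by ring.
  have -> : eta / 2 = 16 * M * (eta / (32 * M)) by field; rewrite gt_eqF.
  by rewrite ler_pM2l// mulr_gt0.
lra.
Qed.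

(** The integrands of the four sides of the square [-1, 1] x [-1, 1], added up so that
    the contour integral becomes a single integral on [-1, 1] (see rect_around) *)
Definition around (g : C -> C) (t : R) : C :=
  hside g (-1) t + iC * vside g 1 t - hside g 1 t - iC * vside g (-1) t.

Lemma contRC_N (f : R -> C) : contRC f -> contRC (fun t => - f t).
Proof.
by move=> cf; have := contRC_Z (-1) cf; congr contRC; apply/funext => t; rewrite mulN1r.
Qed.

Lemma Int_N (f : R -> C) (a b : R) : contRC f -> a <= b ->
  Int (fun t => - f t) a b = - Int f a b.
Proof.
move=> cf ab; have := Int_Z (-1) cf ab; rewrite mulN1r => <-.
by congr Int; apply/funext => t; rewrite mulN1r.
Qed.

Lemma contRC_around g : (forall z, ccont g z) -> contRC (around g).
Proof.
move=> cg; have ch y := contRC_h y cg; have cv x := contRC_v x cg.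
exact: (contRC_D (contRC_D (contRC_D (ch _) (contRC_Z _ (cv _))) (contRC_N (ch _)))
  (contRC_N (contRC_Z _ (cv _)))).
Qed.

Lemma rect_around g : (forall z, ccont g z) ->
  rect g (-1) 1 (-1) 1 = Int (around g) (-1) 1.
Proof.
move=> cg; have ch y := contRC_h y cg; have cv x := contRC_v x cg.
have N1 : -1 <= 1 :> R by lra.
have ci x := contRC_Z iC (cv x).
have E1 := Int_D (contRC_D (contRC_D (ch (-1)) (ci 1)) (contRC_N (ch 1)))
  (contRC_N (ci (-1))) N1.
have E2 := Int_D (contRC_D (ch (-1)) (ci 1)) (contRC_N (ch 1)) N1.
have E3 := Int_D (ch (-1)) (ci 1) N1.
rewrite /rect /around E1 E2 E3.
by rewrite (Int_N (ci (-1)) N1) (Int_N (ch 1) N1) (Int_Z iC (cv _) N1) (Int_Z iC (cv _) N1).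
Qed.

(** The point of the formula is that the imaginary part is at least 2 on [-1, 1],
    which keeps the contour integral of 1 / z away from 0. *)
Lemma around_kernel (t : R) : around (fun z => z^-1) t = Complex 0 (4 / (1 + t ^+ 2)).
Proof.
have t20 : 0 < 1 + t ^+ 2 by have := sqr_ge0 t; lra.
have t2 : 1 + t ^+ 2 != 0 by rewrite gt_eqF.
have inv (a b : R) : (Complex a b : C)^-1 =
  Complex (a / (a ^+ 2 + b ^+ 2)) (- (b / (a ^+ 2 + b ^+ 2))) by [].
rewrite /around /hside /vside !ptE !inv /iC.
have -> : t ^+ 2 + (-1) ^+ 2 = 1 + t ^+ 2 by ring.
have -> : t ^+ 2 + 1 ^+ 2 = 1 + t ^+ 2 by ring.
have -> : (-1) ^+ 2 + t ^+ 2 = 1 + t ^+ 2 by ring.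
have -> : 1 ^+ 2 + t ^+ 2 = 1 + t ^+ 2 by ring.
set d := 1 + t ^+ 2 in t2 *.
rewrite -[LHS]/(Complex _ _); congr Complex; field; exact: t2.
Qed.

(** Cauchy's formula at the centre of the square. The difference quotient of f at 0 is
    continuous and differentiable off 0, so its contour integral vanishes; hence f 0
    times the integral of 1 / z equals the integral of f z / z, which is bounded by the
    values of f on the contour. *)
Lemma maximum_square (f : C -> C) (M : R) : (forall z, ccont f z) ->
  (forall x y, -1 <= x <= 1 -> -1 <= y <= 1 -> cdiff f (pt x y)) ->
  (forall x y, -1 <= x <= 1 -> -1 <= y <= 1 -> 1 <= cabs (pt x y) <= 2 ->
     cabs (f (pt x y)) <= M) -> cabs (f 0) <= 4 * M.
Proof.
move=> cf df fM.
have [b db] : cdiff f 0.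
  have E00 : pt 0 0 = 0 :> C by rewrite ptE.
  by rewrite -E00; apply: df; lra.
pose g := slope f 0 b.
have gE z : z != 0 -> g z = (f z - f 0) / z by move=> z0; rewrite /g slope_ne// subr0.
have cg z : ccont g z.
  have [->|z0] := eqVneq z 0; first exact: ccont_slope_at.
  exact: ccont_slope.
have := @goursat_punctured g cg; rewrite (rect_around cg) => H.
have {}H : Int (around g) (-1) 1 = 0.
  by apply: H => x y hx hy z0; apply: cdiff_slope => //; exact: df.
pose K (t : R) : C := Complex 0 (4 / (1 + t ^+ 2)).
have nzs (t : R) : -1 <= t <= 1 -> [/\ 1 <= cabs (pt t (-1)) <= 2, 1 <= cabs (pt t 1) <= 2,
    1 <= cabs (pt (-1) t) <= 2 & 1 <= cabs (pt 1 t) <= 2].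
  move=> t1; have tn : `|t| <= 1 by rewrite ler_norml.
  by split; rewrite ptE; apply/andP; split;
    [apply: le_trans (cabs_Im _); rewrite /= ?normrN normr1
    |apply: le_trans (cabs_le_ReIm _) _; rewrite /= ?normrN normr1; lra
    |apply: le_trans (cabs_Im _); rewrite /= ?normrN normr1
    |apply: le_trans (cabs_le_ReIm _) _; rewrite /= ?normrN normr1; lra
    |apply: le_trans (cabs_Re _); rewrite /= ?normrN normr1
    |apply: le_trans (cabs_le_ReIm _) _; rewrite /= ?normrN normr1; lra
    |apply: le_trans (cabs_Re _); rewrite /= ?normrN normr1
    |apply: le_trans (cabs_le_ReIm _) _; rewrite /= ?normrN normr1; lra].
have cK : contRC K.
  split=> t /=; first exact: cvg_cst.
  have t20 : 0 < 1 + t ^+ 2 by have := sqr_ge0 t; lra.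
  have t2 : 1 + t ^+ 2 != 0 by rewrite gt_eqF.
  apply: cvgM; first exact: cvg_cst.
  by apply: cvgV => //; apply: cvgD; [exact: cvg_cst|exact: exprn_continuous].
pose Phi t := around g t + f 0 * K t.
have cPhi : contRC Phi by exact: (contRC_D (contRC_around cg) (contRC_Z _ cK)).
have N1 : -1 <= 1 :> R by lra.
have E : Int Phi (-1) 1 = f 0 * Int K (-1) 1.
  by rewrite (Int_D (contRC_around cg) (contRC_Z _ cK) N1) H add0r (Int_Z _ cK N1).
have PhiE t : -1 <= t <= 1 -> Phi t = around (fun z => f z / z) t.
  move=> /nzs[/andP[a _] /andP[b' _] /andP[c _] /andP[d _]].
  have nn (z : C) : 1 <= cabs z -> z != 0.
    by rewrite -cabs_gt0; apply: lt_le_trans.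
  rewrite /Phi /K -around_kernel /around /hside /vside.
  rewrite !gE ?nn//; ring.
have tri (p q r s : C) : cabs p <= M -> cabs q <= M -> cabs r <= M -> cabs s <= M ->
    cabs (p + iC * q - r - iC * s) <= 4 * M.
  move=> a d b' c.
  have T1 := cabsD (p + iC * q - r) (- (iC * s)).
  have T2 := cabsD (p + iC * q) (- r).
  have T3 := cabsD p (iC * q).
  rewrite !cabsN !cabsM !cabs_iC !mul1r in T1 T2 T3.
  apply: (le_trans T1); have -> : 4 * M = M + M + M + M by ring.
  apply: lerD => //; apply: (le_trans T2); apply: lerD => //.
  by apply: (le_trans T3); apply: lerD.
have bPhi t : -1 <= t <= 1 -> cabs (Phi t) <= 4 * M.
  move=> t1; rewrite PhiE// /around /hside /vside.
  have Q x y : -1 <= x <= 1 -> -1 <= y <= 1 -> 1 <= cabs (pt x y) <= 2 ->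
      cabs (f (pt x y) / pt x y) <= M.
    move=> hx hy z12; have fz := fM _ _ hx hy z12; case/andP: z12 => z1 _.
    rewrite cabsM cabsV ler_pdivrMr; last lra.
    apply: (le_trans fz); apply: ler_peMr => //.
    exact: le_trans (cabs_ge0 _) fz.
  have n1 : ((-1 : R) <= -1) && ((-1 : R) <= 1) by rewrite lexx N1.
  have p1 : ((-1 : R) <= 1) && ((1 : R) <= 1) by rewrite lexx N1.
  have [a b' c d] := nzs t t1.
  by apply: tri; apply: Q.
have B := Int_bound cPhi N1 bPhi.
have L : 2 * (1 - -1) <= complex.Im (Int K (-1) 1).
  apply: Int_Im_lower => // t t1 /=; rewrite ler_pdivlMr; last by have := sqr_ge0 t; lra.
  by case/andP: t1 => t1 t1'; nra.
have L' : 4 <= cabs (Int K (-1) 1).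
  apply: le_trans (cabs_Im _); apply: le_trans (ler_norm _); lra.
move: B; rewrite E cabsM => B.
have := cabs_ge0 (f 0); nra.
Qed.

End MaximumPrinciple.

Section MaxExceptional.
Variable R : realType.
Local Notation C := (cplx R).
Local Notation cR := (@cR R).

(** The retraction of the plane onto the square of half side 3 / 2. Composition with
    it turns a function continuous near the square into one continuous everywhere, as
    the integrals above require, without changing it near the square of half side 1. *)
Definition clampR (a : R) : R := Num.max (- (3 / 2)) (Num.min (3 / 2) a).
Definition clamp (z : C) : C := pt (clampR (complex.Re z)) (clampR (complex.Im z)).

Lemma clampR_id a : `|a| <= 3 / 2 -> clampR a = a.
Proof. by rewrite ler_norml => /andP[? ?]; rewrite /clampR min_r// max_r. Qed.

Lemma clampR_norm a : `|clampR a| <= 3 / 2.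
Proof.
rewrite ler_norml /clampR le_max lexx /= ge_max ge_min lexx /= andbT; lra.
Qed.

Lemma clampR_lip a b : `|clampR a - clampR b| <= `|a - b|.
Proof.
have := ler_norm (a - b); have := ler_norm (b - a); rewrite [`|b - a|]distrC.
rewrite /clampR !maxEle !minEle ler_norml; do ![case: ifP => /=]; lra.
Qed.

Lemma cReB (z w : C) : complex.Re (z - w) = complex.Re z - complex.Re w.
Proof. by case: z w => [? ?] [? ?]. Qed.
Lemma cImB (z w : C) : complex.Im (z - w) = complex.Im z - complex.Im w.
Proof. by case: z w => [? ?] [? ?]. Qed.

Lemma clamp_lip z w : cabs (clamp z - clamp w) <= 2 * cabs (z - w).
Proof.
apply: (le_trans (cabs_le_ReIm _)); rewrite cReB cImB /clamp !ptE /=.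
have := clampR_lip (complex.Re z) (complex.Re w); rewrite -cReB.
have := clampR_lip (complex.Im z) (complex.Im w); rewrite -cImB.
have := cabs_Re (z - w); have := cabs_Im (z - w); lra.
Qed.

Lemma clamp_norm z : cabs (clamp z) <= 3.
Proof.
apply: (le_trans (cabs_le_ReIm _)); rewrite /clamp ptE /=.
have := clampR_norm (complex.Re z); have := clampR_norm (complex.Im z); lra.
Qed.

Lemma clamp_id (z : C) : `|complex.Re z| <= 3 / 2 -> `|complex.Im z| <= 3 / 2 -> clamp z = z.
Proof. by move=> h k; rewrite /clamp !clampR_id// ptE; case: z {h k}. Qed.

(** The preceding estimate for the square of half side s centred at p, whose boundary
    lies between the circles of radii s and 2 s. *)
Lemma maximum_scaled (f : C -> C) (p : C) (s M : R) : 0 < s ->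
  (forall z, cabs (z - p) < 4 * s -> cdiff f z) ->
  (forall z, s <= cabs (z - p) <= 2 * s -> cabs (f z) <= M) ->
  cabs (f p) <= 4 * M.
Proof.
move=> s0 df fM; pose F z := f (p + cR s * clamp z).
have cs : cabs (cR s) = s by rewrite cabs_cR gtr0_norm.
have in4 z : cabs (p + cR s * clamp z - p) < 4 * s.
  rewrite addrAC subrr add0r cabsM cs mulrC ltr_pM2r//.
  by apply: le_lt_trans (clamp_norm z) _; lra.
have cF z : ccont F z.
  move=> e /(cdiff_cont (df _ (in4 z)))[d d0 Hd].
  exists (d / (2 * s)); first by rewrite divr_gt0// mulr_gt0.
  move=> w; rewrite ltr_pdivlMr ?mulr_gt0// => wz; apply: Hd.
  have -> : p + cR s * clamp w - (p + cR s * clamp z) = cR s * (clamp w - clamp z) by ring.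
  rewrite cabsM cs; apply: le_lt_trans wz.
  have := clamp_lip w z; have := cabs_ge0 (w - z).
  by move: (cabs (clamp w - clamp z)) (cabs (w - z)) => u v; nra.
have FE z : `|complex.Re z| <= 3 / 2 -> `|complex.Im z| <= 3 / 2 -> F z = f (p + cR s * z).
  by move=> h k; rewrite /F clamp_id.
have small (x y : R) : -1 <= x <= 1 -> -1 <= y <= 1 -> F (pt x y) = f (p + cR s * pt x y).
  by move=> hx hy; rewrite FE// ptE /= ler_norml; lra.
have -> : f p = F 0.
  by rewrite FE ?mulr0 ?addr0//= normr0; lra.
apply: maximum_square cF _ _ => x y hx hy.
  apply: (@cdiff_near _ (fun z => f (p + cR s * z))).
    apply/nbhsC; exists (1 / 2) => // w; rewrite ptE => wz; rewrite FE//.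
      have := cabs_Re (w - Complex x y); rewrite cReB /= !ler_norml; lra.
    have := cabs_Im (w - Complex x y); rewrite cImB /= !ler_norml; lra.
  apply: (@cdiff_comp _ (fun z => p + cR s * z) f).
    by apply: cdiffD; [exact: cdiff_cst|apply: cdiffM; [exact: cdiff_cst|exact: cdiff_id]].
  by have := in4 (pt x y); rewrite clamp_id ?ptE /= ?ler_norml; try lra; exact: df.
move=> z12; rewrite small//; apply: fM.
rewrite addrAC subrr add0r cabsM cs; case/andP: z12 => z1 z2.
by apply/andP; split; nra.
Qed.

(** By Bernoulli's inequality, the powers of a number above 1 are unbounded. *)
Lemma bounded_powers (r K : R) : (forall n, r ^+ n <= K) -> r <= 1.
Proof.
move=> H; rewrite leNgt; apply/negP => r1.
have bern n : 1 + n%:R * (r - 1) <= r ^+ n.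
  elim: n => [|n IH]; first by rewrite mul0r addr0 expr0.
  rewrite exprS -[n.+1]addn1 natrD.
  have := ler0n R n; move: (r ^+ n) (n%:R) IH => u v IH v0.
  have r0 : 0 <= r by lra.
  have := ler_wpM2l r0 IH; have := mulr_ge0 v0 (sqr_ge0 (r - 1)); rewrite mulr1n expr2.
  move: (r * u) => ru; lra.
pose n := Num.bound (K / (r - 1)).
have K1 : 1 <= K by have := H 0%N; rewrite expr0.
have := archi_boundP (_ : 0 <= K / (r - 1)); rewrite -/n => /(_ _).
rewrite ltr_pdivrMr ?subr_gt0// => /(_ _) => Q.
have {}Q : K < n%:R * (r - 1) by apply: Q; rewrite divr_ge0//; lra.
have := bern n; have := H n; lra.
Qed.

Lemma cdiff_prod (s : seq C) z : cdiff (fun w => \prod_(q <- s) (w - q)) z.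
Proof.
elim: s => [|q s IH].
  have -> : (fun w => \prod_(q <- [::]) (w - q)) = (fun=> 1 : C).
    by apply/funext => w; rewrite big_nil.
  exact: cdiff_cst.
have -> : (fun w => \prod_(u <- q :: s) (w - u)) = (fun w => (w - q) * \prod_(u <- s) (w - u)).
  by apply/funext => w; rewrite big_cons.
by apply: cdiffM => //; apply: cdiffB; [exact: cdiff_id|exact: cdiff_cst].
Qed.

(** The difference quotient of the product at z is f itself. *)
Lemma cdiff_vanish (f : C -> C) z : ccont f z -> cdiff (fun w => (w - z) * f w) z.
Proof.
move=> cf; exists (f z); apply/cderiv_slope; exists f => // w.
by rewrite subrr mul0r subr0 mulrC.
Qed.

Lemma cdiff_prod_vanish (f : C -> C) (s : seq C) z : ccont f z -> z \in s ->
  cdiff (fun w => f w * \prod_(q <- s) (w - q)) z.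
Proof.
move=> cf zs; have := @cdiff_vanish (fun w => f w * \prod_(q <- rem z s) (w - q)) z.
have -> : (fun w => (w - z) * (f w * \prod_(q <- rem z s) (w - q))) =
    (fun w => f w * \prod_(q <- s) (w - q)).
  by apply/funext => w; rewrite (big_rem z zs) /= mulrCA.
by apply; apply: ccontM => //; exact: cdiff_cont (cdiff_prod _ _).
Qed.

(** The tensor power trick: applying the bound to f ^ n improves the constant to
    1, and the factors w - q, whose contribution disappears in the limit, allow
    exceptional points. *)
Lemma maximum_off_exceptional (f : C -> C) (p : C) (s M : R) (P : seq C) : 0 < s ->
  (forall z, cabs (z - p) < 4 * s -> ccont f z) ->
  (forall z, cabs (z - p) < 4 * s -> z \notin P -> cdiff f z) ->
  (forall z, s <= cabs (z - p) <= 2 * s -> cabs (f z) <= M) ->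
  p \notin P -> cabs (f p) <= M.
Proof.
move=> s0 cf df fM pP.
have M0 : 0 <= M.
  apply: le_trans (cabs_ge0 (f (p + cR s))) (fM _ _).
  by rewrite addrAC subrr add0r cabs_cR gtr0_norm// lexx /=; lra.
pose pr w := \prod_(q <- P) (w - q).
have prp : 0 < cabs (pr p).
  rewrite cabs_gt0 /pr prodf_seq_neq0; apply/allP => q qP /=.
  by rewrite subr_eq0; apply: contraNneq pP => ->.
pose D := \prod_(q <- P) (2 * s + cabs (p - q)).
have D0 : 0 <= D.
  by rewrite /D; apply: prodr_ge0 => q _; have := cabs_ge0 (p - q); lra.
have prD w : cabs (w - p) <= 2 * s -> cabs (pr w) <= D.
  move=> wp; rewrite /pr /D; elim: P {pP pr prp D D0 df} => [|q P IH].
    by rewrite !big_nil cabs1.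
  rewrite !big_cons cabsM; apply: ler_pM; rewrite ?cabs_ge0//.
  by have := cabs_tri p w q; lra.
have key n : cabs (f p) ^+ n * cabs (pr p) <= 4 * (M ^+ n * D).
  have := @maximum_scaled (fun z => f z ^+ n * pr z) p s (M ^+ n * D) s0.
  rewrite cabsM cabsX; apply.
    move=> z zp; have [zP|zP] := boolP (z \in P).
      by apply: cdiff_prod_vanish => //; apply: ccontX; exact: cf.
    by apply: cdiffM; [apply: cdiffX; exact: df|exact: cdiff_prod].
  move=> z /[dup] zp /andP[_ z2]; rewrite cabsM cabsX.
  apply: ler_pM; rewrite ?exprn_ge0 ?cabs_ge0 ?prD//.
  by rewrite lerXn2r ?nnegrE ?cabs_ge0//; exact: fM.
have [M00|M00] := eqVneq M 0.
  have := key 1%N; rewrite M00 expr1 expr1 mul0r mulr0 => k.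
  by have := cabs_ge0 (f p); nra.
have Mpos : 0 < M by rewrite lt_def M00.
rewrite -[leRHS]mul1r -ler_pdivrMr//.
apply: (@bounded_powers _ (4 * D / cabs (pr p))) => n.
rewrite expr_div_n ler_pdivrMr ?exprn_gt0// mulrAC ler_pdivlMr//.
by apply: le_trans (key n) _; rewrite [M ^+ n * D]mulrC mulrA.
Qed.

Lemma exists_off (P : seq C) (p : C) (r : R) : 0 < r ->
  exists z, cabs (z - p) < r /\ z \notin P.
Proof.
move=> r0; apply: contrapT => no.
have inP z : cabs (z - p) < r -> z \in P.
  by move=> zr; apply: contrapT => zP; apply: no; exists z; split=> //; exact/negP.
pose g (k : nat) : C := p + cR (r / k.+2%:R).
have : uniq (map g (iota 0 (size P).+1)).
  rewrite map_inj_uniq ?iota_uniq// => i j.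
  move=> /addrI/cR_inj/(mulfI (lt0r_neq0 r0))/invr_inj/eqP.
  by rewrite eqr_nat => /eqP[].
suff sub : {subset map g (iota 0 (size P).+1) <= P}.
  by move=> /uniq_leq_size/(_ sub); rewrite size_map size_iota ltnn.
move=> _ /mapP[k _ ->]; apply: inP.
rewrite addrAC subrr add0r cabs_cR ger0_norm; last by rewrite divr_ge0// ltW.
by rewrite ltr_pdivrMr// ltr_pMr// ltr1n.
Qed.

(** Points near p off P satisfy the bound, hence p itself by continuity. The radii
    leave room for moving the centre by s / 2. *)
Theorem maximum_principle (f : C -> C) (p : C) (s M : R) (P : seq C) : 0 < s ->
  (forall z, cabs (z - p) < 6 * s -> ccont f z) ->
  (forall z, cabs (z - p) < 6 * s -> z \notin P -> cdiff f z) ->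
  (forall z, s / 2 <= cabs (z - p) <= 3 * s -> cabs (f z) <= M) ->
  cabs (f p) <= M.
Proof.
move=> s0 cf df fM; rewrite leNgt; apply/negP => gtM.
have cfp : ccont f p by apply: cf; rewrite subrr cabs0 mulr_gt0.
have [|d d0 Hd] := cfp (cabs (f p) - M); first by rewrite subr_gt0.
have [|z [zp zP]] := @exists_off P p (Num.min d (s / 2)).
  by rewrite lt_min d0 divr_gt0.
move: zp; rewrite lt_min => /andP[zd zs].
have tri w := cabs_tri z w p.
have tri' w := cabs_tri p w z.
have : cabs (f z) <= M.
  apply: (@maximum_off_exceptional f z s M P) => //.
  - by move=> w wz; apply: cf; have := tri w; lra.
  - by move=> w wz; apply: df; have := tri w; lra.
  - move=> w wz; apply: fM; have := tri w; have := tri' w; rewrite [cabs (p - z)]cabsC; lra.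
have := Hd z zd; have := cabs_sub (f p) (f z); rewrite [cabs (f p - f z)]cabsC; lra.
Qed.

End MaxExceptional.

(** * Removable singularities and orders of vanishing *)

Section CompactDisc.
Variable R : realType.
Local Notation C := (cplx R).
Local Notation cR := (@cR R).

Lemma pt_continuous : continuous (fun xy : R * R => pt xy.1 xy.2 : C).
Proof.
move=> [x y] A /nbhsC[r r0 rA].
have r2 : 0 < r / 2 by rewrite divr_gt0.
exists (ball x (r / 2), ball y (r / 2)); first by split; exact: nbhsx_ballx.
move=> [u v] /= [xu yv]; apply: rA.
rewrite !ptE; apply: le_lt_trans (cabs_le_ReIm _) _ => /=.
move: xu yv; rewrite -!ball_normE /= [`|x - u|]distrC [`|y - v|]distrC => xu yv.
lra.
Qed.

Lemma cabs_dist (z w : C) : `|cabs z - cabs w| <= cabs (z - w).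
Proof.
by rewrite ler_norml; have := cabs_sub z w; have := cabs_sub w z; rewrite [cabs (w - z)]cabsC; lra.
Qed.

Lemma cabs_continuous (p : C) : continuous (fun z : C => cabs (z - p)).
Proof.
move=> z A /nbhs_ballP[e /= e0 eA].
suff : nbhs z ((fun w : C => cabs (w - p)) @^-1` A) by [].
apply/nbhsC; exists e => // w wz; apply: eA; rewrite -ball_normE /= distrC.
by apply: le_lt_trans (cabs_dist _ _) _; rewrite opprB addrA subrK.
Qed.

Lemma closed_disc (p : C) (r : R) : closed [set z : C | cabs (z - p) <= r].
Proof.
apply: (@closed_comp _ _ (fun z : C => cabs (z - p)) [set x | x <= r]).
  by move=> z _; exact: cabs_continuous.
exact: closed_le.
Qed.

Lemma compact_disc (p : C) (r : R) : compact [set z : C | cabs (z - p) <= r].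
Proof.
case: p => a b.
pose K : set (R * R) := `[a - r, a + r] `*` `[b - r, b + r].
have cK : compact ((fun xy : R * R => pt xy.1 xy.2 : C) @` K).
  apply: continuous_compact; last by apply: compact_setX; exact: segment_compact.
  exact: continuous_subspaceT pt_continuous.
apply: (subclosed_compact (@closed_disc _ _) cK) => -[x y] /= H.
exists (x, y); last by rewrite ptE.
have := cabs_Re (Complex x y - Complex a b); have := cabs_Im (Complex x y - Complex a b).
rewrite /= !ler_norml => h k; split; rewrite /= in_itv /=; lra.
Qed.

End CompactDisc.

Section Removable.
Variable R : realType.
Local Notation C := (cplx R).
Local Notation cR := (@cR R).

(** By completeness of R, applied to the real and imaginary parts. *)
Lemma punctured_limit (p : C) (Q : C -> C) :
  (forall e, 0 < e -> exists2 d, 0 < d & forall z w, cabs (z - p) < d -> z != p ->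
     cabs (w - p) < d -> w != p -> cabs (Q z - Q w) <= e) ->
  exists b, forall e, 0 < e -> exists2 d, 0 < d & forall z, cabs (z - p) < d -> z != p ->
     cabs (Q z - b) <= e.
Proof.
move=> H.
have real (g : C -> R) : (forall z w, `|g z - g w| <= cabs (Q z - Q w)) ->
    exists l, forall e, 0 < e -> exists2 d, 0 < d & forall z, cabs (z - p) < d -> z != p ->
      `|g z - l| <= e.
  move=> gQ; have [|l gl] := (@cvg_ex _ (g @ p^')).1.
    apply/cauchy_cvgP/cauchy_exP => e e0.
    have [|d d0 Hd] := H (e / 2); first by rewrite divr_gt0.
    have [w [wd wp]] := @exists_off _ [:: p] p d d0.
    exists (g w); rewrite /dnbhs /within /=; apply/nbhsC; exists d => // z zd zp.
    rewrite -ball_normE /=; apply: le_lt_trans (gQ _ _) _.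
    apply: le_lt_trans (Hd _ _ _ _ _ _) _; rewrite ?ltr_pdivrMr// ?ltr_pMr//; try lra.
    by move: wp; rewrite inE.
  exists l => e e0; move/cvgrPdist_le : gl => /(_ e e0).
  rewrite /dnbhs /within /= => /nbhsC[d d0 Hd]; exists d => // z zd zp.
  by rewrite distrC; exact: Hd.
have [|a Ha] := real (fun z => complex.Re (Q z)).
  by move=> z w; rewrite -cReB; exact: cabs_Re.
have [|b Hb] := real (fun z => complex.Im (Q z)).
  by move=> z w; rewrite -cImB; exact: cabs_Im.
exists (Complex a b) => e e0; have e2 : 0 < e / 2 by rewrite divr_gt0.
have [d d0 {}Ha] := Ha _ e2; have [c c0 {}Hb] := Hb _ e2.
exists (Num.min d c); first by rewrite lt_min d0.
move=> z; rewrite lt_min => /andP[zd zc] zp.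
apply: le_trans (cabs_le_ReIm _) _; rewrite cReB cImB /= (splitr e).
by apply: lerD; [exact: Ha|exact: Hb].
Qed.

(** Riemann's removable singularity theorem. For w and w' near p, the difference of the
    difference quotients of f at w and at w' is continuous, and differentiable off
    {p, w, w'}; at a fixed distance from p it is small, because f w and f w' are close
    to f p. By the maximum principle it is small at p too, where it equals the
    difference of the values at w and w' of the difference quotient of f at p: the
    latter has a limit at p. *)
Theorem removable_singularity (f : C -> C) (p : C) (r : R) : 0 < r ->
  (forall z, cabs (z - p) < r -> ccont f z) ->
  (forall z, cabs (z - p) < r -> z != p -> cdiff f z) -> cdiff f p.
Proof.
move=> r0 cf df.
have cfp : ccont f p by apply: cf; rewrite subrr cabs0.
have [d d0 Hd] := cfp 1 ltr01.
pose s := Num.min d r / 6.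
have dr0 : 0 < Num.min d r by rewrite lt_min d0.
have s0 : 0 < s by rewrite divr_gt0.
have s6 z : cabs (z - p) < 6 * s -> cabs (z - p) < d /\ cabs (z - p) < r.
  have -> : 6 * s = Num.min d r by rewrite /s; field.
  by rewrite lt_min => /andP[].
pose Q w := (f w - f p) / (w - p).
have [|b Hb] := @punctured_limit p Q.
  move=> e e0.
  have [c c0 Hc] : exists2 c, 0 < c & forall w, cabs (w - p) < c ->
      cabs (f w - f p) < e * s / 16.
    by apply: (cfp (e * s / 16)); rewrite divr_gt0// mulr_gt0.
  pose d1 := Num.min c (Num.min (s / 4) (e * s ^+ 2 / 128)).
  have d10 : 0 < d1 by rewrite !lt_min c0 !divr_gt0// mulr_gt0// exprn_gt0.
  exists d1 => // w w'; rewrite !lt_min => /and3P[wc ws we] wp /and3P[w'c w's w'e] w'p.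
  have in6 z : cabs (z - p) < s / 4 -> cabs (z - p) < 6 * s by lra.
  have [b1 db1] := df w (s6 _ (in6 _ ws)).2 wp.
  have [b2 db2] := df w' (s6 _ (in6 _ w's)).2 w'p.
  have cdr z : cabs (z - p) < 6 * s -> ccont f z by move=> /s6[_]; exact: cf.
  have cH v c' z : cderiv f v c' -> cabs (z - p) < 6 * s -> ccont (slope f v c') z.
    move=> dv zs; have [->|zv] := eqVneq z v; first exact: ccont_slope_at.
    by apply: ccont_slope => //; exact: cdr.
  have := @maximum_principle _ (fun z => slope f w b1 z - slope f w' b2 z) p s e
    [:: p; w; w'] s0.
  have QE v c' : v != p -> slope f v c' p = Q v.
    move=> vp; rewrite slope_ne 1?eq_sym// /Q.
    by rewrite -[f p - f v]opprB -[p - v]opprB invrN mulrNN.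
  rewrite !QE//; apply.
  - by move=> z zs; apply: ccontB; apply: cH.
  - move=> z zs; rewrite !inE !negb_or => /and3P[zp zw zw'].
    by apply: cdiffB; apply: cdiff_slope => //; apply: df => //; exact: (s6 _ zs).2.
  move=> z /andP[z1 z2].
  have zd : cabs (f z - f p) < 1 by apply: Hd; apply: (s6 _ _).1; lra.
  have far v : cabs (v - p) < s / 4 -> s / 4 <= cabs (z - v).
    by move=> vs; have := cabs_tri v z p; lra.
  have fw := far _ ws; have fw' := far _ w's.
  have nz v : s / 4 <= cabs (z - v) -> z - v != 0.
    by move=> vs; rewrite -cabs_gt0; lra.
  have zw := nz _ fw; have zw' := nz _ fw'.
  have zw1 : z != w by rewrite -subr_eq0.
  have zw1' : z != w' by rewrite -subr_eq0.
  rewrite (slope_ne f b1 zw1) (slope_ne f b2 zw1').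
  have -> : (f z - f w) / (z - w) - (f z - f w') / (z - w') =
     (f w' - f w) / (z - w) + (f z - f w') * ((w - w') / ((z - w) * (z - w'))).
    by field; exact/andP.
  apply: le_trans (cabsD _ _) _; rewrite !cabsM !cabsV cabsM.
  have A1 : cabs (f w' - f w) <= e * s / 8.
    have := Hc _ wc; have := Hc _ w'c; have := cabs_tri (f p) (f w') (f w).
    rewrite [cabs (f p - f w)]cabsC; lra.
  have A2 : cabs (f z - f w') <= 2.
    have : cabs (f w' - f p) < 1 by apply: Hd; apply: (s6 _ _).1; exact: in6.
    have := cabs_tri (f p) (f z) (f w'); rewrite [cabs (f p - f w')]cabsC; lra.
  have A3 : cabs (w - w') <= e * s ^+ 2 / 64.
    by have := cabs_tri p w w'; rewrite [cabs (p - w')]cabsC; lra.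
  have B1 : cabs (f w' - f w) / cabs (z - w) <= e / 2.
    rewrite ler_pdivrMr; last lra.
    have : e / 2 * (s / 4) <= e / 2 * cabs (z - w) by rewrite ler_pM2l// divr_gt0.
    lra.
  have B2 : cabs (w - w') / (cabs (z - w) * cabs (z - w')) <= e / 4.
    rewrite ler_pdivrMr; last by rewrite mulr_gt0//; lra.
    have : e / 4 * (s / 4 * (s / 4)) <= e / 4 * (cabs (z - w) * cabs (z - w')).
      rewrite ler_pM2l ?divr_gt0//; apply: ler_pM => //; lra.
    by rewrite expr2 in A3; lra.
  have B3 : cabs (f z - f w') * (cabs (w - w') / (cabs (z - w) * cabs (z - w'))) <= 2 * (e / 4).
    by apply: ler_pM => //; rewrite ?cabs_ge0// divr_ge0// ?mulr_ge0// cabs_ge0.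
  lra.
exists b => e e0; have [c c0 Hc] := Hb e e0; exists c => // w wc.
have [->|wp] := eqVneq w p; first by rewrite !subrr mulr0 subr0 cabs0 mulr0.
have wp0 : w - p != 0 by rewrite subr_eq0.
have -> : f w - f p - b * (w - p) = (Q w - b) * (w - p) by rewrite mulrBl mulfVK.
by rewrite cabsM; apply: ler_wpM2r; [exact: cabs_ge0|exact: Hc].
Qed.

Definition holo (f : C -> C) (p : C) (r : R) :=
  forall z, cabs (z - p) < r -> cdiff f z.

(** The difference quotient is continuous at p, where its singularity is therefore
    removable. *)
Lemma holo_slope f p r b : 0 < r -> holo f p r -> cderiv f p b -> holo (slope f p b) p r.
Proof.
move=> r0 hf db z zr; have [->|zp] := eqVneq z p; last first.
  by apply: cdiff_slope => //; exact: hf.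
apply: (removable_singularity r0) => w wr.
  have [->|wp] := eqVneq w p; first exact: ccont_slope_at.
  by apply: ccont_slope => //; exact: cdiff_cont (hf _ wr).
by move=> wp; apply: cdiff_slope => //; exact: hf.
Qed.

(** Divide by z - p as long as the quotient vanishes at p. *)
Lemma vanishing_order f p r : 0 < r -> holo f p r ->
  (exists n u, [/\ (0 < n)%N, holo u p r, u p != 0 &
     forall z, f z - f p = (z - p) ^+ n * u z]) \/
  (forall n, exists2 u, holo u p r & forall z, f z - f p = (z - p) ^+ n * u z).
Proof.
move=> r0 hf; apply/or_asboolP; rewrite -implyNb; apply/implyP => /asboolPn no; apply/asboolP.
elim=> [|n [u hu fu]].
  exists (fun z => f z - f p); last by move=> z; rewrite expr0 mul1r.
  by move=> z /hf dz; apply: cdiffB => //; exact: cdiff_cst.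
have up : u p = 0.
  apply/eqP; rewrite -[_ == _]negbK; apply/negP => up; apply: no; exists n, u; split=> //.
  rewrite lt0n; apply/eqP => n0; move: (fu p); rewrite n0 expr0 mul1r subrr => /esym/eqP.
  by rewrite (negbTE up).
have [b db] : cdiff u p by apply: hu; rewrite subrr cabs0.
exists (slope u p b); first exact: holo_slope.
by move=> z; rewrite fu -[u z]subr0 -up (slopeK u p b) exprSr -mulrA [_ * (z - p)]mulrC.
Qed.

(** If f z - f p = (z - p) ^ n * u z and f - f p is bounded by 1, the maximum principle
    on a disc centred at z bounds u z by (8 / (3 s)) ^ n; so for |z - p| < s / 8 one gets
    |f z - f p| <= 3 ^- n for all n. *)
Lemma flat_const f p r : 0 < r -> holo f p r ->
  (forall n, exists2 u, holo u p r & forall z, f z - f p = (z - p) ^+ n * u z) ->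
  exists2 d, 0 < d & forall z, cabs (z - p) < d -> f z = f p.
Proof.
move=> r0 hf flat.
have cfp : ccont f p by apply: cdiff_cont; apply: hf; rewrite subrr cabs0.
have [r1 r10 Hr1] := cfp 1 ltr01.
pose s := Num.min r r1 / 8.
have s8 : 8 * s = Num.min r r1 by rewrite /s; field.
have s0 : 0 < s by rewrite divr_gt0// lt_min r0.
have s8P z : cabs (z - p) < 8 * s -> cabs (z - p) < r /\ cabs (z - p) < r1.
  by rewrite s8 lt_min => /andP[].
exists (s / 8); first by rewrite divr_gt0.
move=> z zs; apply/eqP; rewrite -subr_eq0 -cabs_eq0 eq_le cabs_ge0 andbT leNgt.
apply/negP => pos; set c := cabs _ in pos.
have H n : c <= (1 / 3) ^+ n.
  have [u hu fu] := flat n.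
  have un : cabs (u z) <= (8 / (3 * s)) ^+ n.
    apply: (@maximum_principle _ u z s _ [::] s0).
    - move=> w wz; apply: cdiff_cont; apply: hu; apply: (s8P _ _).1.
      by have := cabs_tri z w p; lra.
    - move=> w wz _; apply: hu; apply: (s8P _ _).1.
      by have := cabs_tri z w p; lra.
    move=> w /andP[w1 w2].
    have wp : 3 * s / 8 <= cabs (w - p).
      by have := cabs_tri p w z; rewrite [cabs (p - z)]cabsC; lra.
    have fw : cabs (f w - f p) < 1.
      by apply: Hr1; apply: (s8P _ _).2; have := cabs_tri z w p; lra.
    have wp0 : 0 < cabs (w - p) by lra.
    have -> : u w = (f w - f p) / (w - p) ^+ n.
      by rewrite fu mulrAC mulfV ?mul1r// expf_neq0// -cabs_gt0.
    rewrite cabsM cabsV cabsX -exprVn.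
    rewrite -[leRHS]mul1r; apply: ler_pM; rewrite ?cabs_ge0 ?exprn_ge0 ?invr_ge0 ?cabs_ge0 ?(ltW fw)//.
    rewrite lerXn2r ?nnegrE ?invr_ge0 ?cabs_ge0//; first by rewrite divr_ge0//; lra.
    by rewrite -[8 / _]invf_div lef_pV2 ?posrE//; lra.
  rewrite /c fu cabsM cabsX.
  have -> : (1 / 3) ^+ n = (s / 8) ^+ n * (8 / (3 * s)) ^+ n.
    by rewrite -exprMn; congr (_ ^+ _); field; rewrite gt_eqF.
  apply: ler_pM; rewrite ?exprn_ge0 ?cabs_ge0// lerXn2r ?nnegrE ?cabs_ge0//.
    by rewrite divr_ge0// ltW.
  exact: ltW.
have : 3 <= 1 :> R.
  apply: (@bounded_powers _ _ c^-1) => n.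
  rewrite -[leLHS]invrK lef_pV2 ?posrE ?invr_gt0 ?exprn_gt0//.
  by have := H n; rewrite div1r exprVn.
lra.
Qed.

(** By the maximum principle applied to the difference quotient of f - b z at w, its
    value at a point z near p is controlled by its values at a fixed distance from p,
    where the derivative at p bounds the numerator. *)
Lemma strict_derivative f p r b : 0 < r -> holo f p r -> cderiv f p b ->
  forall e, 0 < e -> exists2 d, 0 < d & forall z w,
    cabs (z - p) < d -> cabs (w - p) < d ->
    cabs (f z - f w - b * (z - w)) <= e * cabs (z - w).
Proof.
move=> r0 hf db e e0.
have e20 : 0 < e / 20 by rewrite divr_gt0.
have [r1 r10 Hr1] := db _ e20.
pose s := Num.min r r1 / 8.
have s8 : 8 * s = Num.min r r1 by rewrite /s; field.
have s0 : 0 < s by rewrite divr_gt0// lt_min r0.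
have s8P z : cabs (z - p) < 8 * s -> cabs (z - p) < r /\ cabs (z - p) < r1.
  by rewrite s8 lt_min => /andP[].
exists (s / 8); first by rewrite divr_gt0.
move=> z w zs ws.
have [->|zw] := eqVneq z w; first by rewrite !subrr mulr0 subr0 cabs0 mulr0.
pose psi u := f u - b * u.
have hpsi : holo psi p r.
  move=> u /hf du; apply: cdiffB => //; apply: cdiffM; [exact: cdiff_cst|exact: cdiff_id].
have [c dc] : cdiff psi w by apply: hpsi; apply: (s8P _ _).1; lra.
have small u : cabs (u - p) < 8 * s -> cabs (psi u - psi p) <= e / 20 * cabs (u - p).
  move=> /s8P[_ /Hr1]; have -> // : psi u - psi p = f u - f p - b * (u - p).
  by rewrite /psi; ring.
have : cabs (slope psi w c z) <= e.
  apply: (@maximum_principle _ (slope psi w c) z s e [:: w] s0).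
  - move=> u uz; have us : cabs (u - p) < r.
      by apply: (s8P _ _).1; have := cabs_tri z u p; lra.
    have [->|uw] := eqVneq u w; first exact: ccont_slope_at.
    by apply: ccont_slope => //; exact: cdiff_cont (hpsi _ us).
  - move=> u uz; rewrite inE => uw; apply: cdiff_slope => //.
    by apply: hpsi; apply: (s8P _ _).1; have := cabs_tri z u p; lra.
  move=> u /andP[u1 u2].
  have uw : s / 4 <= cabs (u - w).
    have := cabs_tri w u z; have := cabs_tri p w z; rewrite [cabs (p - z)]cabsC; lra.
  have up : cabs (u - p) <= 4 * s by have := cabs_tri z u p; lra.
  have uw0 : u != w by rewrite -subr_eq0 -cabs_gt0; lra.
  rewrite slope_ne// cabsM cabsV ler_pdivrMr; last lra.
  have := small u; have := small w.
  have := cabs_tri (psi p) (psi u) (psi w); rewrite [cabs (psi p - psi w)]cabsC.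
  move=> T Sw Su; have {}Sw := Sw (_ : _ < _); have {}Su := Su (_ : _ < _).
  have A : cabs (psi w - psi p) <= e / 20 * s.
    apply: le_trans (Sw _) _; first lra.
    by rewrite ler_pM2l//; lra.
  have B : cabs (psi u - psi p) <= e / 20 * (4 * s).
    apply: le_trans (Su _) _; first lra.
    by rewrite ler_pM2l//; lra.
  have : e * (s / 4) <= e * cabs (u - w) by rewrite ler_pM2l.
  lra.
rewrite slope_ne// cabsM cabsV ler_pdivrMr ?cabs_gt0 ?subr_eq0//.
have -> // : psi z - psi w = f z - f w - b * (z - w).
by rewrite /psi; ring.
Qed.

End Removable.

(** * The local normal form of a holomorphic function *)

Section LocalInverse.
Variable R : realType.
Local Notation C := (cplx R).
Local Notation cR := (@cR R).

Lemma cderiv_lower (f : C -> C) z b (k : R) (d : R) : 0 < d ->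
  cderiv f z b -> (forall w, cabs (w - z) < d -> k * cabs (w - z) <= cabs (f w - f z)) ->
  k <= cabs b.
Proof.
move=> d0 df H; rewrite leNgt; apply/negP => bk.
have [|d1 d10 H1] := df ((k - cabs b) / 2); first by rewrite divr_gt0// subr_gt0.
have [|w [wd wz]] := @exists_off _ [:: z] z (Num.min d d1); first by rewrite lt_min d0.
move: wd; rewrite lt_min => /andP[/H Hd /H1 Hd1].
have w0 : 0 < cabs (w - z) by rewrite cabs_gt0 subr_eq0; move: wz; rewrite inE.
have := cabsD (f w - f z - b * (w - z)) (b * (w - z)); rewrite subrK cabsM => T.
have : k * cabs (w - z) <= ((k - cabs b) / 2 + cabs b) * cabs (w - z) by lra.
rewrite ler_pM2r//; lra.
Qed.

(** The distance from f z to w has a minimum on a closed disc, which is attained in the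
    interior because f expands distances. Unless it is 0, moving along the inverse of
    the derivative decreases it further. *)
Lemma expanding_onto (f : C -> C) p d k : 0 < d -> 0 < k -> holo f p d ->
  (forall z w, cabs (z - p) < d -> cabs (w - p) < d ->
     k * cabs (z - w) <= cabs (f z - f w)) ->
  forall w, cabs (w - f p) < k * d / 4 -> exists2 z, cabs (z - p) < d & f z = w.
Proof.
move=> d0 k0 hf exp w wfp.
have pd : cabs (p - p) < d by rewrite subrr cabs0.
pose D := [set z : C | cabs (z - p) <= d / 2].
have Dd z : D z -> cabs (z - p) < d by rewrite /D /=; lra.
have [z0 [z0D z0min]] : exists z0, D z0 /\ forall z, D z -> cabs (f z0 - w) <= cabs (f z - w).
  have D0 : D !=set0 by exists p; rewrite /D /= subrr cabs0 divr_ge0// ltW.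
  have cD : {within D, continuous (fun z => cabs (f z - w))}.
    apply: continuous_in_subspaceT => z; rewrite inE => /Dd zd.
    have cz : {for z, continuous f} by apply/continuousC; exact: cdiff_cont (hf _ zd).
    exact: (continuous_comp cz (@cabs_continuous _ w (f z))).
  have [z0 z0D z0m] := compact_EVT_min D0 (@compact_disc _ p (d / 2)) cD.
  by exists z0; split; [move: z0D; rewrite inE|move=> z zD; apply: z0m; rewrite inE].
exists z0; first exact: Dd.
apply/eqP; rewrite -subr_eq0 -cabs_eq0 eq_le cabs_ge0 andbT leNgt; apply/negP => pos.
have z0d := Dd _ z0D.
have z0in : cabs (z0 - p) < d / 2.
  have A : cabs (f z0 - w) <= cabs (f p - w).
    by apply: z0min; rewrite /D /= subrr cabs0 divr_ge0// ltW.
  rewrite cabsC [leRHS]cabsC in A.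
  have B := exp _ _ z0d pd; have := cabs_tri w (f z0) (f p).
  rewrite [cabs (f z0 - w)]cabsC => T.
  rewrite -(ltr_pM2l k0); lra.
have [c dc] := hf _ z0d.
have kc : k <= cabs c.
  apply: (@cderiv_lower f z0 c k (d / 2)) => //; first by rewrite divr_gt0.
  by move=> u uz; apply: exp => //; have := cabs_tri z0 u p; lra.
have c0 : 0 < cabs c by exact: lt_le_trans kc.
have cn0 : c != 0 by rewrite -cabs_gt0.
have [|d1 d10 H1] := dc (cabs c / 2); first by rewrite divr_gt0.
set m := cabs (f z0 - w) in pos.
(* the step t along the Newton direction h is so small that z0 + h stays in the disc
   and the linear approximation of f at z0 is accurate *)
pose t := Num.min (1 / 2) (Num.min (d1 * cabs c / (2 * m)) ((d / 2 - cabs (z0 - p)) * cabs c / (2 * m))).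
have t0 : 0 < t.
  rewrite !lt_min; apply/and3P; split; first by rewrite divr_gt0.
    by rewrite divr_gt0// mulr_gt0.
  by rewrite divr_gt0// mulr_gt0// subr_gt0.
have t1 : t <= 1 / 2 by rewrite ge_min lexx.
have t2 : t <= d1 * cabs c / (2 * m) by rewrite !ge_min lexx orbT.
have t3 : t <= (d / 2 - cabs (z0 - p)) * cabs c / (2 * m) by rewrite !ge_min lexx !orbT.
pose h := - (cR t * (f z0 - w)) / c.
have hE : cabs h = t * m / cabs c.
  by rewrite /h cabsM cabsV cabsN cabsM cabs_cR ger0_norm// ltW.
have h1 : cabs h < d1.
  rewrite hE ltr_pdivrMr//; have : t * m <= d1 * cabs c / (2 * m) * m by rewrite ler_pM2r.
  have -> : d1 * cabs c / (2 * m) * m = d1 * cabs c / 2 by field; rewrite gt_eqF.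
  have : 0 < d1 * cabs c by rewrite mulr_gt0.
  lra.
have h2 : cabs h <= d / 2 - cabs (z0 - p).
  rewrite hE ler_pdivrMr//.
  have : t * m <= (d / 2 - cabs (z0 - p)) * cabs c / (2 * m) * m by rewrite ler_pM2r.
  have -> : (d / 2 - cabs (z0 - p)) * cabs c / (2 * m) * m = (d / 2 - cabs (z0 - p)) * cabs c / 2.
    by field; rewrite gt_eqF.
  have : 0 <= (d / 2 - cabs (z0 - p)) * cabs c by rewrite mulr_ge0 ?subr_ge0 ?ltW.
  lra.
have zh : D (z0 + h).
  rewrite /D /= addrAC; apply: le_trans (cabsD _ _) _; lra.
have := z0min _ zh; apply/negP; rewrite -ltNge.
have := H1 (z0 + h); rewrite addrAC subrr add0r => /(_ h1) H2.
have -> : f (z0 + h) - w = (f (z0 + h) - f z0 - c * h) + cR (1 - t) * (f z0 - w).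
  rewrite /h mulrCA mulfV// mulr1 cRB; ring.
apply: le_lt_trans (cabsD _ _) _.
rewrite cabsM cabs_cR ger0_norm; last lra.
apply: (@le_lt_trans _ _ (cabs c / 2 * cabs h + (1 - t) * m)); first by rewrite lerD2r.
rewrite hE -/m.
have -> : cabs c / 2 * (t * m / cabs c) = t * m / 2 by field; rewrite gt_eqF.
have : 0 < t * m by rewrite mulr_gt0.
lra.
Qed.

(** By strict differentiability f expands distances near p, hence is injective there,
    covers a disc around f p, and has a Lipschitz inverse, which is then differentiable. *)
Theorem local_inverse (f : C -> C) p r b : 0 < r -> holo f p r -> cderiv f p b -> b != 0 ->
  exists d e (g : C -> C), [/\ 0 < d <= r, 0 < e,
    forall w, cabs (w - f p) < e -> [/\ cabs (g w - p) < d, f (g w) = w & cdiff g w] &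
    forall z, cabs (z - p) < d -> cabs (f z - f p) < e -> g (f z) = z].
Proof.
move=> r0 hf db b0; have b00 : 0 < cabs b by rewrite cabs_gt0.
have [|d1 d10 H] := strict_derivative r0 hf db (_ : 0 < cabs b / 2); first by rewrite divr_gt0.
pose d := Num.min d1 r.
have d0 : 0 < d by rewrite lt_min d10.
have dr : d <= r by rewrite ge_min lexx orbT.
have dd1 : d <= d1 by rewrite ge_min lexx.
pose k := cabs b / 2; have k0 : 0 < k by rewrite divr_gt0.
have exp z w : cabs (z - p) < d -> cabs (w - p) < d -> k * cabs (z - w) <= cabs (f z - f w).
  move=> zd wd; have := H z w (lt_le_trans zd dd1) (lt_le_trans wd dd1).
  have := cabsD (f z - f w) (- (f z - f w - b * (z - w))).
  rewrite cabsN opprB addrCA subrr addr0 cabsM /k; lra.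
have hd : holo f p d by move=> z zd; apply: hf; exact: lt_le_trans dr.
have onto := expanding_onto d0 k0 hd exp.
pose e := k * d / 4; have e0 : 0 < e by rewrite divr_gt0// mulr_gt0.
have inj z w : cabs (z - p) < d -> cabs (w - p) < d -> f z = f w -> z = w.
  move=> zd wd fzw; have := exp z w zd wd; rewrite fzw subrr cabs0 pmulr_rle0// => E.
  by apply/eqP; rewrite -subr_eq0 -cabs_eq0 eq_le E cabs_ge0.
have /choice[g gP] : forall w, exists z, cabs (w - f p) < e -> cabs (z - p) < d /\ f z = w.
  move=> w; have [we|we] := ltP (cabs (w - f p)) e; last by exists p.
  by have [z zd fz] := onto w we; exists z.
exists d, e, g; split=> //; first by rewrite d0.
  move=> w we; have [gd fg] := gP w we; split=> //.
  have [c dc] := hd _ gd.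
  have kc : k <= cabs c.
    apply: (@cderiv_lower f (g w) c k (d - cabs (g w - p))) => //; first by rewrite subr_gt0.
    by move=> u uz; apply: exp => //; have := cabs_tri (g w) u p; lra.
  have c0 : 0 < cabs c by exact: lt_le_trans kc.
  have cn0 : c != 0 by rewrite -cabs_gt0.
  exists c^-1 => e' e'0.
  have [|d2 d20 H2] := dc (e' * k * cabs c); first by rewrite !mulr_gt0.
  exists (Num.min (k * d2) (e - cabs (w - f p))).
    by rewrite lt_min mulr_gt0// subr_gt0.
  move=> v; rewrite lt_min => /andP[vd ve].
  have ve' : cabs (v - f p) < e by have := cabs_tri w v (f p); lra.
  have [gvd fgv] := gP v ve'.
  have lip := exp _ _ gvd gd; rewrite fg fgv in lip.
  have gv : cabs (g v - g w) < d2 by rewrite -(ltr_pM2l k0); exact: le_lt_trans lip vd.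
  have := H2 _ gv; rewrite fg fgv => H3.
  have -> : g v - g w - c^-1 * (v - w) = - (v - w - c * (g v - g w)) / c.
    by field.
  rewrite cabsM cabsN cabsV ler_pdivrMr//; apply: le_trans H3 _.
  have : e' * cabs c * (k * cabs (g v - g w)) <= e' * cabs c * cabs (v - w).
    by rewrite ler_pM2l// mulr_gt0.
  lra.
move=> z zd ze; have [gd fg] := gP _ ze.
exact: inj.
Qed.

(** The power map has a nonzero derivative at a root of u p, so that it has a local
    inverse there, to be composed with u. *)
Lemma local_root (u : C -> C) p r n : (0 < n)%N -> 0 < r -> holo u p r -> u p != 0 ->
  exists d (v : C -> C), [/\ 0 < d <= r, holo v p d, v p != 0 &
    forall z, cabs (z - p) < d -> v z ^+ n = u z].
Proof.
move=> n0 r0 hu up.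
pose y0 : C := n.-root (u p).
have y0n : y0 ^+ n = u p by rewrite /y0 rootCK.
have y00 : y0 != 0.
  by apply: contraNneq up => y0E; rewrite -y0n y0E expr0n eqn0Ngt n0.
have dpow (m : nat) (y : C) : cderiv (fun y => y ^+ m.+1) y (m.+1%:R * y ^+ m).
  elim: m => [|m IH].
    have := cderiv_id y; rewrite expr0 mulr1.
    by have -> : (fun y : C => y ^+ 1) = id by apply/funext => w; rewrite expr1.
  have := cderivM (cderiv_id y) IH.
  have -> : (fun w => id w * w ^+ m.+1) = (fun y : C => y ^+ m.+2).
    by apply/funext => w; rewrite [RHS]exprS.
  have -> // : 1 * y ^+ m.+1 + id y * (m.+1%:R * y ^+ m) = m.+2%:R * y ^+ m.+1.
  by rewrite [in RHS]mulrS mulrDl !mul1r /= exprS mulrCA.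
case: n n0 y0 y0n y00 => // n _ y0 y0n y00.
have [||||d [e [g [d01 e0 gP gK]]]] := @local_inverse (fun y => y ^+ n.+1) y0 1 (n.+1%:R * y0 ^+ n).
- exact: ltr01.
- by move=> y _; exists (n.+1%:R * y ^+ n).
- exact: dpow.
- by rewrite mulf_neq0 ?expf_neq0// pnatr_eq0.
have cu : ccont u p by apply: cdiff_cont; apply: hu; rewrite subrr cabs0.
have [d1 d10 H1] := cu e e0.
have in_e z : cabs (z - p) < Num.min d1 r -> cabs (u z - y0 ^+ n.+1) < e /\ cabs (z - p) < r.
  by rewrite lt_min => /andP[/H1 + ?]; rewrite y0n.
exists (Num.min d1 r), (g \o u); split.
- by rewrite lt_min d10 r0 ge_min lexx orbT.
- move=> z /in_e[ze zr]; apply: cdiff_comp; first exact: hu.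
  by have [] := gP _ ze.
- have [|_ + _] := gP (u p); first by rewrite -y0n subrr cabs0.
  move=> gn; apply: contraNneq up => /= g0; rewrite -gn.
  by rewrite g0 expr0n.
- by move=> z /in_e[ze _] /=; have [] := gP _ ze.
Qed.

(** In f z - f p = (z - p) ^ n * u z with u p != 0, the factor u is an n-th power v ^ n
    near p; then g z = (z - p) * v z has a nonzero derivative at p and f = f p + g ^ n.
    The local coordinate is g, with inverse h. *)
Theorem local_normal_form (f : C -> C) p r : 0 < r -> holo f p r ->
  ~ (exists2 d, 0 < d & forall z, cabs (z - p) < d -> f z = f p) ->
  exists n d e (g h : C -> C), [/\ (0 < n)%N, 0 < d <= r, [/\ 0 < e, g p = 0 & h 0 = p],
    forall w, cabs w < e -> [/\ cabs (h w - p) < d, g (h w) = w, cdiff h w &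
      f (h w) = f p + w ^+ n] &
    forall z, cabs (z - p) < d -> cdiff g z /\ (cabs (g z) < e -> h (g z) = z)].
Proof.
move=> r0 hf nc.
case: (vanishing_order r0 hf) => [[n [u [n0 hu up fu]]]|flat]; last first.
  by case: nc; exact: flat_const flat.
have [d [v [d0 hv vp vn]]] := local_root n0 r0 hu up.
case/andP: d0 => d0 dr.
pose g z := (z - p) * v z.
have hg : holo g p d.
  by move=> z zd; apply: cdiffM; [apply: cdiffB; [exact: cdiff_id|exact: cdiff_cst]|exact: hv].
have gp : g p = 0 by rewrite /g subrr mul0r.
have dg : cderiv g p (v p).
  apply/cderiv_slope; exists v.
    by split=> //; apply: cdiff_cont; apply: hv; rewrite subrr cabs0.
  by move=> w; rewrite gp subr0 /g mulrC.
have [d' [e [h [/andP[d'0 d'd] e0 hP hK]]]] := local_inverse d0 hg dg vp.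
rewrite gp in hP hK.
exists n, d', e, g, h; split=> //.
- by rewrite d'0 (le_trans d'd).
- by split=> //; rewrite -[RHS](hK p) ?gp ?subrr ?cabs0.
- move=> w we; have [] := hP w; first by rewrite subr0.
  move=> hd gh dh; split=> //.
  rewrite -[LHS](subrK (f p)) fu addrC; congr (_ + _).
  rewrite -(vn (h w)); last exact: lt_le_trans d'd.
  by rewrite -exprMn -/(g (h w)) gh.
- move=> z zd; split; first by apply: hg; exact: lt_le_trans d'd.
  by move=> gz; apply: hK => //; rewrite subr0.
Qed.

Lemma finite_roots (n : nat) (c : C) : (0 < n)%N -> exists P : seq C, forall z, z ^+ n = c -> z \in P.
Proof.
move=> n0; have [s E] := closed_field_poly_normal ('X^n - c%:P : {poly C}).
exists s => z zc; have : root ('X^n - c%:P) z.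
  by rewrite /root !hornerE zc subrr.
by rewrite E rootZ ?root_prod_XsubC// lead_coef_eq0 -size_poly_gt0 size_XnsubC.
Qed.

End LocalInverse.

(** * Holomorphic maps between Riemann surfaces *)

Section Surfaces.
Variable R : realType.
Local Notation C := (cplx R).

Lemma chart_nbhs (X : topologicalType) (c : chart R X) (x : X) (U : set X) :
  cdom c x -> nbhs x U ->
  exists2 r, 0 < r & forall z, cabs (z - cmap c x) < r ->
    [/\ cdom c (cinv c z), cmap c (cinv c z) = z & U (cinv c z)].
Proof.
move=> cx xU; have cim : (cmap c @` cdom c) (cmap c x) by exists x.
have /nbhsC[r r0 Hr] : nbhs (cmap c x) (cmap c @` cdom c).
  by apply: open_nbhs_nbhs; split => //; exact: cimg_open.
have cK := cmapK cx.
have /nbhsC[s s0 Hs] : nbhs (cmap c x) (cinv c @^-1` U).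
  by apply: (cinv_continuous cim); rewrite cK.
exists (Num.min r s); first by rewrite lt_min r0.
move=> z; rewrite lt_min => /andP[/Hr[y cy yz] /Hs Uz].
by split=> //; rewrite -yz cmapK.
Qed.

Lemma cmap_near (X : topologicalType) (c : chart R X) (x : X) (r : R) :
  cdom c x -> 0 < r ->
  \forall y \near x, cdom c y /\ cabs (cmap c y - cmap c x) < r.
Proof.
move=> cx r0; have H : nbhs (cmap c x) [set w : C | cabs (w - cmap c x) < r].
  by apply/nbhsC; exists r.
have := cmap_continuous cx H.
have : nbhs x (cdom c) by apply: open_nbhs_nbhs; split=> //; exact: cdom_open.
by apply: filterS2 => y.
Qed.

Lemma cmap_inj (X : topologicalType) (c : chart R X) (x y : X) :
  cdom c x -> cdom c y -> cmap c x = cmap c y -> x = y.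
Proof. by move=> /cmapK + /cmapK => {2}<- {2}<- ->. Qed.

Section Nonconstant.
Variables (S T : riemannSurface R) (f : S -> T).
Hypothesis hf : holomorphic f.

Lemma holo_read (a : chart R S) (b : chart R T) x :
  rs_charts a -> rs_charts b -> cdom a x -> cdom b (f x) ->
  forall U, nbhs x U ->
  exists2 r, 0 < r & holo (cmap b \o f \o cinv a) (cmap a x) r /\
    forall z, cabs (z - cmap a x) < r ->
    [/\ cdom a (cinv a z), cmap a (cinv a z) = z, cdom b (f (cinv a z)) & U (cinv a z)].
Proof.
move=> ra rb ax bx U xU; have [cf df] := hf.
have V : nbhs x (f @^-1` cdom b).
  by apply: cf; apply: open_nbhs_nbhs; split=> //; exact: cdom_open.
have [r r0 H] := chart_nbhs ax (filterI V xU).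
exists r => //; split=> [z|z] /H[az za [bz Uz]] //.
by apply/derivableC; rewrite -za; exact: df.
Qed.

Let loc_const (x : S) := \forall y \near x, f y = f x.

Lemma const_read (a : chart R S) (b : chart R T) x (F := cmap b \o f \o cinv a) :
  rs_charts a -> rs_charts b -> cdom a x -> cdom b (f x) ->
  loc_const x <-> exists2 d, 0 < d & forall z, cabs (z - cmap a x) < d -> F z = F (cmap a x).
Proof.
move=> ra rb ax bx; split=> [cx|[d d0 Hd]].
  have [d d0 Hd] := chart_nbhs ax cx; exists d => // z /Hd[az za fz].
  by rewrite /F /= fz cmapK.
have [cf _] := hf.
have V : nbhs x (f @^-1` cdom b).
  by apply: cf; apply: open_nbhs_nbhs; split=> //; exact: cdom_open.
apply: filterS2 V (cmap_near ax d0) => y by_ [ay yd].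
by apply: (cmap_inj by_ bx); have := Hd _ yd; rewrite /F /= !cmapK.
Qed.

(** In the coordinate of the normal form f is a translate of w |-> w ^ n, which takes
    each of its values finitely many times only. *)
Lemma not_loc_const_open x : ~ loc_const x -> \forall y \near x, ~ loc_const y.
Proof.
move=> ncx; have [a ra ax] := rs_cover x; have [b rb bx] := rs_cover (f x).
have [r r0 [hF inF]] := holo_read ra rb ax bx (@filterT _ _ _).
set F := cmap b \o f \o cinv a in hF.
have ncF : ~ (exists2 d, 0 < d & forall z, cabs (z - cmap a x) < d -> F z = F (cmap a x)).
  by move=> /(const_read ra rb ax bx).
have [n [d [e [g [h [n0 /andP[d0 dr] [e0 gp hp] hP gP]]]]]] := local_normal_form r0 hF ncF.
have [d' d'0 H'] : exists2 d', 0 < d' & forall z, cabs (z - cmap a x) < d' ->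
    cabs (g z) < e.
  have [|cg _] := gP (cmap a x); first by rewrite subrr cabs0.
  have [d1 d10 H1] := cdiff_cont cg e0.
  by exists d1 => // z /H1; rewrite gp subr0.
have m0 : 0 < Num.min d d' by rewrite lt_min d0.
apply: filterS (cmap_near ax m0) => y [ay]; rewrite lt_min => /andP[yd yd'].
have [_ gK] := gP _ yd; have {}gK := gK (H' _ yd').
have [_ ya fby _] := inF _ (lt_le_trans yd dr).
rewrite cmapK// in fby.
move=> /(const_read ra rb ay fby)[s s0 Hs].
have [hd ghw dh Fh] := hP _ (H' _ yd').
have [s1 s10 Hs1] := cdiff_cont dh s0.
have [P PP] := finite_roots (g (cmap a y) ^+ n) n0.
have [|w [wd /negP wP]] := @exists_off _ P (g (cmap a y)) (Num.min s1 (e - cabs (g (cmap a y)))).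
  by rewrite lt_min s10 subr_gt0 H'.
move: wd; rewrite lt_min => /andP[ws1 we].
have {}we : cabs w < e by have := cabs_tri (g (cmap a y)) w 0; rewrite !subr0; lra.
apply: wP; apply: PP; have A := Hs1 _ ws1; rewrite gK in A.
have [_ _ _ Fhw] := hP _ we; have E : F (h w) = F (cmap a y) := Hs _ A.
by rewrite gK in Fh; move: E; rewrite Fhw Fh => /addrI.
Qed.

Lemma target_not_singleton : ~ (forall y1 y2 : T, y1 = y2).
Proof.
move=> H; have [y _] := rs_nonempty T; have [b _ by_] := rs_cover y.
have [r r0 Hr] := chart_nbhs by_ (@filterT _ _ _).
have [|z [zr]] := @exists_off _ [:: cmap b y] (cmap b y) r; first exact: r0.
rewrite inE => /negP; apply; apply/eqP.
by have [_ <- _] := Hr _ zr; rewrite (H (cinv b z) y).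
Qed.

(** The identity theorem: the set of points of local constancy is open and closed, so
    it is empty, or f is locally constant, hence constant on the connected surface S,
    and not onto. *)
Theorem nowhere_loc_const : set_surj [set: S] [set: T] f -> forall x, ~ loc_const x.
Proof.
move=> sf x0 cx0.
have LT : [set x | loc_const x] = setT.
  apply: (rs_connected (r := S)).
  - by exists x0.
  - exists [set x | loc_const x]; last by rewrite setTI.
    rewrite openE => x /= cx; rewrite /interior /=.
    have := nbhs_interior cx; apply: filterS2 (cx) => y fy Iy.
    by apply: filterS Iy => z; rewrite fy.
  - exists [set x | loc_const x]; last by rewrite setTI.
    rewrite -[X in closed X]setCK closedC openE => x /= ncx.
    exact: not_loc_const_open.
have allc x : loc_const x by have : [set x | loc_const x] x by rewrite LT.
have FT : [set x | f x = f x0] = setT.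
  apply: (rs_connected (r := S)).
  - by exists x0.
  - exists [set x | f x = f x0]; last by rewrite setTI.
    by rewrite openE => x /= <-; exact: allc.
  - exists [set x | f x = f x0]; last by rewrite setTI.
    rewrite -[X in closed X]setCK closedC openE => x /= nx.
    by apply: filterS (allc x) => y /= ->.
apply: target_not_singleton => y1 y2.
have E y : y = f x0.
  have [x _ <-] := sf y I.
  by have : [set x | f x = f x0] x by rewrite FT.
by rewrite (E y1) (E y2).
Qed.

End Nonconstant.

(** A coordinate of S centred at x, defined by its inverse pc_inv on a disc, in which f
    becomes w |-> cmap b (f x) + w ^ n. The coordinate b of the target is prescribed, and
    not assumed centred, in order that the two factors of a fiber product can use the
    same one. *)
Record power_coordinate (S T : riemannSurface R) (f : S -> T) (b : chart R T) (x : S)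
    (U : set S) := PowerCoordinate {
  pc_deg : nat;
  pc_rad : R;
  pc_inv : C -> S;
  pc_map : S -> C;
  pc_deg_gt0 : (0 < pc_deg)%N;
  pc_rad_gt0 : 0 < pc_rad;
  pc_inv0 : pc_inv 0 = x;
  pc_sub : forall w, cabs w < pc_rad -> U (pc_inv w);
  pc_invK : forall w, cabs w < pc_rad -> pc_map (pc_inv w) = w;
  pc_holo : forall w, cabs w < pc_rad -> holomorphic_at pc_inv w;
  pc_dom : forall w, cabs w < pc_rad -> cdom b (f (pc_inv w));
  pc_power : forall w, cabs w < pc_rad ->
    cmap b (f (pc_inv w)) = cmap b (f x) + w ^+ pc_deg;
  pc_open : forall r, 0 < r -> r <= pc_rad ->
    open (pc_inv @` [set w | cabs w < r]);
  pc_cont : forall w e, cabs w < pc_rad -> 0 < e ->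
    \forall y \near pc_inv w, cabs (pc_map y - w) < e }.

Lemma power_coordinate_exists (S T : riemannSurface R) (f : S -> T) (b : chart R T) (x : S)
    (U : set S) :
  holomorphic f -> set_surj [set: S] [set: T] f -> rs_charts b -> cdom b (f x) ->
  nbhs x U -> inhabited (power_coordinate f b x U).
Proof.
move=> hf sf rb bx xU; have [a ra ax] := rs_cover x.
have [r r0 [hF inF]] := holo_read hf ra rb ax bx xU.
set F := cmap b \o f \o cinv a in hF.
have ncF : ~ (exists2 d, 0 < d & forall z, cabs (z - cmap a x) < d -> F z = F (cmap a x)).
  move=> H; apply: (nowhere_loc_const hf sf (x := x)).
  exact/(const_read hf ra rb ax bx).
have [n [d [e [g [h [n0 /andP[d0 dr] [e0 gp hp] hP gP]]]]]] := local_normal_form r0 hF ncF.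
have inr w : cabs w < e -> [/\ cdom a (cinv a (h w)), cmap a (cinv a (h w)) = h w,
    cdom b (f (cinv a (h w))) & U (cinv a (h w))].
  by move=> /hP[hd _ _ _]; apply: inF; exact: lt_le_trans dr.
have cg w e' : cabs w < e -> 0 < e' ->
    \forall y \near cinv a (h w), [/\ cdom a y, cabs (cmap a y - cmap a x) < d &
      cabs (g (cmap a y) - w) < e'].
  move=> we e'0; have [hd gh dh Fh] := hP _ we; have [aw aE _ _] := inr _ we.
  have [dg _] := gP _ hd; have [d1 d10 H1] := cdiff_cont dg e'0.
  have m0 : 0 < Num.min d1 (d - cabs (h w - cmap a x)) by rewrite lt_min d10 subr_gt0.
  apply: filterS (cmap_near aw m0) => y [ay]; rewrite lt_min aE => /andP[y1 y2].
  split=> //; first by have := cabs_tri (h w) (cmap a y) (cmap a x); lra.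
  by have := H1 _ y1; rewrite gh.
constructor.
refine (@PowerCoordinate S T f b x U n e (cinv a \o h) (g \o cmap a) n0 e0 _ _ _ _ _ _ _ _).
- by rewrite /= hp cmapK.
- by move=> w /inr[].
- by move=> w we; have [_ gh _ _] := hP _ we; have [_ aE _ _] := inr _ we; rewrite /= aE.
- move=> w we; have [hd gh dh Fh] := hP _ we; have [aw aE _ _] := inr _ we.
  have ch : {for w, continuous h} by apply/continuousC; exact: cdiff_cont dh.
  have ca : {for h w, continuous (cinv a)}.
    by apply: cinv_continuous; exists (cinv a (h w)).
  split; first exact: (continuous_comp ch ca).
  move=> b' rb' b'w; have [D _] := (rs_maximal b').1 rb' a ra _ aw b'w.
  apply/derivableC; rewrite aE in D.
  exact: (@cdiff_comp _ h (cmap b' \o cinv a) w dh ((derivableC _ _).1 D)).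
- by move=> w /inr[].
- move=> w we; have [_ _ _ Fh] := hP _ we; have := Fh; rewrite /F /= => ->.
  by rewrite cmapK.
- move=> s s0 se; rewrite openE => _ [w ws <-].
  have we : cabs w < e by exact: lt_le_trans ws se.
  have := cg w (s - cabs w) we; rewrite subr_gt0 => /(_ ws); apply: filterS => y [ay yd yg].
  have gs : cabs (g (cmap a y)) < s.
    by have := cabs_tri w (g (cmap a y)) 0; rewrite !subr0; lra.
  exists (g (cmap a y)) => //=.
  by have [_ ->] := gP _ yd; [exact: cmapK|exact: lt_le_trans se].
- by move=> w e' we e'0; apply: filterS (cg w e' we e'0) => y [].
Qed.

End Surfaces.

(** * The local structure of the fiber product *)

Section SubtypeTopology.

Lemma nbhs_set_type (T : topologicalType) (A : set T) (x : set_type A) (U : set (set_type A)) :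
  nbhs x U <-> exists2 V, nbhs (set_val x) V & forall y : set_type A, V (set_val y) -> U y.
Proof.
split=> [[B [[V oV <-] Vx BU]]|[V Vx VU]].
  by exists V; [apply: open_nbhs_nbhs; split|move=> y Vy; exact: BU].
move: Vx; rewrite nbhsE => -[V' [oV' V'x] V'V].
exists (set_val @^-1` V'); split=> //; first by exists V'.
by move=> y /V'V/VU.
Qed.

Lemma set_val_continuous (T : topologicalType) (A : set T) :
  continuous (set_val : set_type A -> T).
Proof. exact: (initial_continuous (f := (set_val : set_type A -> T))). Qed.

Lemma continuous_into_set_type (Z T : topologicalType) (A : set T) (f : Z -> set_type A) z :
  {for z, continuous (fun u => set_val (f u))} -> {for z, continuous f}.
Proof.
move=> cf U /nbhs_set_type[V /cf fV VU].
have {}fV : nbhs z [set u | V (set_val (f u))] := fV.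
suff : nbhs z (f @^-1` U) by [].
by apply: filterS fV => u; exact: VU.
Qed.

End SubtypeTopology.

Section ComplexValued.
Variable R : realType.
Local Notation C := (cplx R).
Variable T : topologicalType.

Definition tcont (f : T -> C) (z : T) :=
  forall e, 0 < e -> \forall y \near z, cabs (f y - f z) < e.

Lemma tcontP f z : tcont f z -> {for z, continuous f}.
Proof.
by move=> cf A /nbhsC[r r0 rA]; have := cf r r0; apply: filterS => y; exact: rA.
Qed.

Lemma tcont_comp (F : C -> C) f z : tcont f z -> ccont F (f z) -> tcont (F \o f) z.
Proof.
move=> cf cF e /cF[d d0 H]; have := cf d d0; apply: filterS => y; exact: H.
Qed.

Lemma tcontM f g z : tcont f z -> tcont g z -> tcont (fun y => f y * g y) z.
Proof.
move=> cf cg e e0; have [a a0 H] := mul_near (f z) (g z) e0.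
by apply: filterS2 (cf a a0) (cg a a0) => y; exact: H.
Qed.

Lemma tcontX f z n : tcont f z -> tcont (fun y => f y ^+ n) z.
Proof. by move=> cf; apply: (tcont_comp cf (ccontX n (ccont_id _))). Qed.

Lemma tcont_cst (c : C) z : tcont (fun=> c) z.
Proof. by move=> e e0; apply: filterE => y; rewrite subrr cabs0. Qed.

Lemma tcontV f z : f z != 0 -> tcont f z -> tcont (fun y => (f y)^-1) z.
Proof. by move=> f0 cf; apply: (tcont_comp cf (ccontV (ccont_id _) f0)). Qed.

Lemma tcont_ne0 f z : f z != 0 -> tcont f z -> \forall y \near z, f y != 0.
Proof.
move=> f0 cf; have f00 : 0 < cabs (f z) by rewrite cabs_gt0.
apply: filterS (cf _ f00) => y; apply: contraTneq => ->.
by rewrite sub0r cabsN ltxx.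
Qed.

End ComplexValued.

Section Branches.
Variable R : realType.
Local Notation C := (cplx R).
Variables (S0 S1 S2 : riemannSurface R) (b1 : S1 -> S0) (b2 : S2 -> S0).
Local Notation X := (fiber_product b1 b2).
Local Notation fp1 := (@fp1 R S0 S1 S2 b1 b2).
Local Notation fp2 := (@fp2 R S0 S1 S2 b1 b2).

Lemma fp_eq (z : X) : b1 (fp1 z) = b2 (fp2 z).
Proof. exact: (set_mem (valP z)). Qed.

Lemma fp_inj (z z' : X) : fp1 z = fp1 z' -> fp2 z = fp2 z' -> z = z'.
Proof.
move=> h1 h2; apply: val_inj; rewrite -!set_valE; move: h1 h2; rewrite /fp1 /fp2.
by case: (set_val z) (set_val z') => [a b] [a' b'] /= -> ->.
Qed.

Lemma fp1_continuous : continuous (fp1 : X -> S1).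
Proof.
move=> z; apply: (@continuous_comp _ _ _ (set_val : X -> S1 * S2) fst).
  exact: set_val_continuous.
exact: cvg_fst.
Qed.

Lemma fp2_continuous : continuous (fp2 : X -> S2).
Proof.
move=> z; apply: (@continuous_comp _ _ _ (set_val : X -> S1 * S2) snd).
  exact: set_val_continuous.
exact: cvg_snd.
Qed.

Lemma fp_continuous_into (Z : topologicalType) (f : Z -> X) (z : Z) :
  {for z, continuous (fun u => fp1 (f u))} -> {for z, continuous (fun u => fp2 (f u))} ->
  {for z, continuous f}.
Proof.
move=> c1 c2; apply: continuous_into_set_type.
have -> : (fun u => set_val (f u)) = (fun u => (fp1 (f u), fp2 (f u))).
  by apply/funext => u; rewrite /fp1 /fp2; case: (set_val (f u)).
exact: cvg_pair.
Qed.

(** The conditions on a puncture chart that are local, at an arbitrary centre x: the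
    branches at regular points serve to show that the fiber product is locally compact
    and locally connected. *)
Definition branch (x : X) (c : chart R X) :=
  [/\ ~ cdom c x, cmap c @` cdom c = [set w | 0 < `|w| < 1],
      cinv c w @[w --> 0^'] --> x &
      forall w, (cmap c @` cdom c) w ->
        holomorphic_at (fp1 \o cinv c) w /\ holomorphic_at (fp2 \o cinv c) w].

Lemma holomorphic_at_comp (S : riemannSurface R) (g : C -> S) (h : C -> C) w :
  cdiff h w -> holomorphic_at g (h w) -> holomorphic_at (g \o h) w.
Proof.
move=> dh [cg dg]; split.
  have ch : {for w, continuous h} by apply/continuousC; exact: cdiff_cont dh.
  exact: (continuous_comp ch cg).
move=> b rb bw; apply/derivableC.
exact: (@cdiff_comp _ h (cmap b \o g) w dh ((derivableC _ _).1 (dg b rb bw))).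
Qed.

Lemma holomorphic_at_near (S : riemannSurface R) (g h : C -> S) w :
  (\forall u \near w, g u = h u) -> holomorphic_at g w -> holomorphic_at h w.
Proof.
move=> gh [cg dg]; have ghw : g w = h w by exact: nbhs_singleton gh.
split.
  move=> A; rewrite -ghw => /cg; apply: filterS2 gh => u; rewrite /= => ->.
  by [].
move=> b rb; rewrite -ghw => bw; apply/derivableC.
apply: (@cdiff_near _ (cmap b \o g)); last exact/derivableC/dg.
by apply: filterS gh => u /= ->.
Qed.

(** In the coordinates w1, w2 of the factors centred at the components of x, the fiber
    product is given by w1 ^ n1 = w2 ^ n2. Let d be the gcd of n1 and n2, and n1 = k1 * d,
    n2 = k2 * d. For w1 != 0, the quotient xi = w2 ^ k2 / w1 ^ k1 is a root of unity of
    order d; each such root defines a branch w2 ^ k2 = xi * w1 ^ k1, parametrized by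
    t |-> (t ^ k2, zeta * t ^ k1) where zeta ^ k2 = xi. As k1 and k2 are coprime, Bezout's
    relation al * k2 = be * k1 + 1 recovers t = w1 ^ al / (w2 / zeta) ^ be. *)
Section AtPoint.
Variables (x : X) (c : chart R S0) (U1 : set S1) (U2 : set S2).
Variables (p1 : power_coordinate b1 c (fp1 x) U1) (p2 : power_coordinate b2 c (fp2 x) U2).

Let n1 := pc_deg p1.
Let n2 := pc_deg p2.
Let d := gcdn n1 n2.
Let k1 := (n1 %/ d)%N.
Let k2 := (n2 %/ d)%N.
Let al := (egcdn k2 k1).1.
Let be := (egcdn k2 k1).2.
Let e := Num.min 1 (Num.min (pc_rad p1) (pc_rad p2)).
Let Psi1 := pc_inv p1.
Let Psi2 := pc_inv p2.
Let Phi1 := pc_map p1.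
Let Phi2 := pc_map p2.

Let d_gt0 : (0 < d)%N.
Proof. by rewrite gcdn_gt0 (pc_deg_gt0 p1). Qed.

Let n1E : n1 = (k1 * d)%N.
Proof. by rewrite divnK// dvdn_gcdl. Qed.

Let n2E : n2 = (k2 * d)%N.
Proof. by rewrite divnK// dvdn_gcdr. Qed.

Let k1_gt0 : (0 < k1)%N.
Proof. by have := pc_deg_gt0 p1; rewrite -/n1 n1E muln_gt0 => /andP[]. Qed.

Let k2_gt0 : (0 < k2)%N.
Proof. by have := pc_deg_gt0 p2; rewrite -/n2 n2E muln_gt0 => /andP[]. Qed.

Let bezout : (al * k2 = be * k1 + 1)%N.
Proof.
rewrite /al /be; case: egcdnP => // km kn -> _ /=; congr (_ + _)%N.
apply/eqP; rewrite -(eqn_pmul2r d_gt0) mul1n muln_gcdl -n1E -n2E.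
by rewrite gcdnC.
Qed.

Let e_gt0 : 0 < e.
Proof. by rewrite !lt_min ltr01 !pc_rad_gt0. Qed.

Let e_le1 : e <= 1.
Proof. by rewrite ge_min lexx. Qed.

Let e_rad1 r : r < e -> r < pc_rad p1.
Proof. by rewrite !lt_min => /and3P[]. Qed.

Let e_rad2 r : r < e -> r < pc_rad p2.
Proof. by rewrite !lt_min => /and3P[]. Qed.

Lemma params_agree w1 w2 : cabs w1 < e -> cabs w2 < e ->
  b1 (Psi1 w1) = b2 (Psi2 w2) <-> w1 ^+ n1 = w2 ^+ n2.
Proof.
move=> /e_rad1 h1 /e_rad2 h2; have E1 := pc_power h1; have E2 := pc_power h2.
rewrite -fp_eq in E2; split=> [E|E].
  by move: E1 E2; rewrite -/Psi1 -/Psi2 E => -> /addrI.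
apply: (cmap_inj (pc_dom h1) (pc_dom h2)).
by rewrite E1 E2 E.
Qed.

Definition at_params (z : X) (w1 w2 : C) :=
  [/\ cabs w1 < e, cabs w2 < e, fp1 z = Psi1 w1 & fp2 z = Psi2 w2].

Let at_params_Phi z w1 w2 : at_params z w1 w2 -> Phi1 (fp1 z) = w1 /\ Phi2 (fp2 z) = w2.
Proof.
by move=> [h1 h2 -> ->]; split; apply: pc_invK; [exact: e_rad1|exact: e_rad2].
Qed.

Let at_params_near z w1 w2 : at_params z w1 w2 ->
  \forall z' \near z, exists w1' w2', at_params z' w1' w2'.
Proof.
move=> [h1 h2 E1 E2].
have er1 : e <= pc_rad p1 by rewrite !ge_min lexx orbT.
have er2 : e <= pc_rad p2 by rewrite !ge_min lexx !orbT.
have N1 : nbhs (fp1 z) (Psi1 @` [set w | cabs w < e]).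
  by apply: open_nbhs_nbhs; split; [exact: pc_open|exists w1].
have N2 : nbhs (fp2 z) (Psi2 @` [set w | cabs w < e]).
  by apply: open_nbhs_nbhs; split; [exact: pc_open|exists w2].
have M1 : nbhs z (fp1 @^-1` (Psi1 @` [set w | cabs w < e])) := fp1_continuous N1.
have M2 : nbhs z (fp2 @^-1` (Psi2 @` [set w | cabs w < e])) := fp2_continuous N2.
apply: filterS2 M1 M2 => z' [w1' h1' Z1] [w2' h2' Z2].
by exists w1', w2'.
Qed.

Let Phi_tcont z w1 w2 : at_params z w1 w2 ->
  tcont (Phi1 \o fp1) z /\ tcont (Phi2 \o fp2) z.
Proof.
move=> zw; have [E1 E2] := at_params_Phi zw; have [h1 h2 Z1 Z2] := zw.
split=> r r0 /=.
  have := pc_cont (e_rad1 h1) r0; rewrite -/Psi1 -Z1 => /(@fp1_continuous z).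
  by rewrite E1.
have := pc_cont (e_rad2 h2) r0; rewrite -/Psi2 -Z2 => /(@fp2_continuous z).
by rewrite E2.
Qed.

Let at_params_relation z w1 w2 : at_params z w1 w2 -> w1 ^+ n1 = w2 ^+ n2.
Proof.
by move=> [h1 h2 Z1 Z2]; apply/params_agree => //; rewrite -Z1 -Z2; exact: fp_eq.
Qed.

Section Root.
Variable xi : C.
Hypothesis xid : xi ^+ d = 1.

Let zeta : C := k2.-root xi.

Let zeta_k2 : zeta ^+ k2 = xi.
Proof. exact: rootCK. Qed.

Let abs_zeta : cabs zeta = 1.
Proof.
have : cabs zeta ^+ (k2 * d) == 1 by rewrite -cabsX exprM zeta_k2 xid cabs1.
by rewrite pexpr_eq1 ?cabs_ge0 ?muln_gt0 ?k2_gt0// => /eqP.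
Qed.

Let zeta0 : zeta != 0.
Proof. by rewrite -cabs_gt0 abs_zeta. Qed.

Let xi0 : xi != 0.
Proof. by rewrite -zeta_k2 expf_neq0. Qed.

Let coord (w1 w2 : C) : C := w1 ^+ al / (w2 / zeta) ^+ be.

Let coordK t : t != 0 -> coord (t ^+ k2) (zeta * t ^+ k1) = t.
Proof.
move=> t0; rewrite /coord [zeta * _]mulrC mulfK// -!exprM mulnC bezout exprD.
by rewrite mulnC [X in X / _]mulrC mulfK ?expr1// expf_neq0.
Qed.

Let coord_param w1 w2 : w1 != 0 -> w2 ^+ k2 = xi * w1 ^+ k1 ->
  coord w1 w2 ^+ k2 = w1 /\ zeta * coord w1 w2 ^+ k1 = w2.
Proof.
move=> w10 E; rewrite /coord; set v := w2 / zeta.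
have vE : v ^+ k2 = w1 ^+ k1.
  by rewrite /v expr_div_n E zeta_k2 mulrC mulKf.
have v0 : v != 0.
  have : v ^+ k2 != 0 by rewrite vE expf_neq0.
  by apply: contraNneq => ->; rewrite expr0n eqn0Ngt k2_gt0.
have V n : v ^+ (n * k2) = w1 ^+ (n * k1) by rewrite ![(n * _)%N]mulnC !exprM vE.
split.
  rewrite expr_div_n -!exprM bezout V exprD.
  by rewrite [X in X / _]mulrC mulfK ?expr1// expf_neq0.
have -> : w2 = zeta * v by rewrite /v mulrCA mulfV// mulr1.
congr (_ * _); rewrite expr_div_n -!exprM -V bezout exprD.
by rewrite [X in X / _]mulrC mulfK ?expr1// expf_neq0.
Qed.

Let small t k : (0 < k)%N -> cabs t < e -> cabs (t ^+ k) < e.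
Proof.
move=> k0 te; have t1 : cabs t <= 1 := ltW (lt_le_trans te e_le1).
rewrite cabsX; apply: le_lt_trans te.
by case: k k0 => // k _; rewrite exprS ler_piMr ?cabs_ge0// exprn_ile1 ?cabs_ge0.
Qed.

Let arc1 t := Psi1 (t ^+ k2).
Let arc2 t := Psi2 (zeta * t ^+ k1).

Let small2 t : cabs t < e -> cabs (zeta * t ^+ k1) < e.
Proof. by move=> te; rewrite cabsM abs_zeta mul1r; exact: small. Qed.

Let arcE t : cabs t < e -> b1 (arc1 t) = b2 (arc2 t).
Proof.
move=> te; apply/params_agree; [exact: small|exact: small2|].
rewrite n1E n2E exprMn (exprM zeta) zeta_k2 xid mul1r -!exprM.
by congr (_ ^+ _); rewrite mulnCA.
Qed.

(** The parameter is rescaled by e to range over the unit disc. Where the two arcs do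
    not lie over the same point of S0, no point of the fiber product is available, hence
    the default x. *)
Definition branch_inv (s : C) : X :=
  match pselect (b1 (arc1 (cR e * s)) = b2 (arc2 (cR e * s))) with
  | left h => @SigSub _ _ _ (arc1 (cR e * s), arc2 (cR e * s)) (mem_set h)
  | right _ => x
  end.

Let scale s : cabs s < 1 -> cabs (cR e * s) < e.
Proof. by move=> s1; rewrite cabsM cabs_cR gtr0_norm// gtr_pMr. Qed.

Lemma branch_invE s : cabs s < 1 ->
  fp1 (branch_inv s) = arc1 (cR e * s) /\ fp2 (branch_inv s) = arc2 (cR e * s).
Proof.
move=> s1; rewrite /branch_inv; case: pselect => [h|]; last by have := arcE (scale s1).
by rewrite /fp1 /fp2 !set_valE /=.
Qed.

Definition branch_map (z : X) : C := coord (Phi1 (fp1 z)) (Phi2 (fp2 z)) / cR e.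

Definition branch_dom : set X := branch_inv @` [set s | 0 < cabs s < 1].

Let e0 : cR e != 0.
Proof. by rewrite -cabs_gt0 cabs_cR gtr0_norm. Qed.

Let Phi_branch s : cabs s < 1 -> Phi1 (fp1 (branch_inv s)) = (cR e * s) ^+ k2 /\
  Phi2 (fp2 (branch_inv s)) = zeta * (cR e * s) ^+ k1.
Proof.
move=> s1; have [-> ->] := branch_invE s1; have te := scale s1; split.
  by apply: pc_invK; apply: e_rad1; exact: small.
by apply: pc_invK; apply: e_rad2; exact: small2.
Qed.

Lemma branch_invK s : 0 < cabs s < 1 -> branch_map (branch_inv s) = s.
Proof.
move=> /andP[s0 s1]; rewrite /branch_map; have [-> ->] := Phi_branch s1.
rewrite coordK ?mulf_neq0 -?cabs_gt0//; last by rewrite cabs_gt0.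
by rewrite mulrC mulKf.
Qed.

Let branch_inv_holo s : cabs s < 1 ->
  holomorphic_at (fp1 \o branch_inv) s /\ holomorphic_at (fp2 \o branch_inv) s.
Proof.
move=> s1; have te := scale s1.
have near1 : \forall u \near s, cabs u < 1.
  apply/nbhsC; exists (1 - cabs s); first by rewrite subr_gt0.
  by move=> u us; have := cabs_tri s u 0; rewrite !subr0; lra.
have dlin u : cdiff (fun s => cR e * s) u.
  exact: (cdiffM (cdiff_cst _ u) (cdiff_id u)).
split.
  apply: (@holomorphic_at_near _ (Psi1 \o (fun s => (cR e * s) ^+ k2))).
    by apply: filterS near1 => u u1; have [] := branch_invE u1.
  apply: holomorphic_at_comp; first exact: cdiffX.
  by apply: pc_holo; apply: e_rad1; exact: small.
apply: (@holomorphic_at_near _ (Psi2 \o (fun s => zeta * (cR e * s) ^+ k1))).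
  by apply: filterS near1 => u u1; have [] := branch_invE u1.
apply: holomorphic_at_comp; first by apply: (cdiffM (cdiff_cst _ s)); exact: cdiffX.
by apply: pc_holo; apply: e_rad2; exact: small2.
Qed.

Let branch_inv_continuous s : cabs s < 1 -> {for s, continuous branch_inv}.
Proof.
by move=> /branch_inv_holo[[c1 _] [c2 _]]; exact: fp_continuous_into.
Qed.

Let branch_inv0 : branch_inv 0 = x.
Proof.
have [|h1 h2] := @branch_invE 0; first by rewrite cabs0.
apply: fp_inj.
  by rewrite h1 /arc1 mulr0 expr0n eqn0Ngt k2_gt0 /Psi1 pc_inv0.
by rewrite h2 /arc2 mulr0 expr0n eqn0Ngt k1_gt0 mulr0 /Psi2 pc_inv0.
Qed.

Let branch_lift z w1 w2 r : at_params z w1 w2 -> w1 != 0 -> w2 ^+ k2 = xi * w1 ^+ k1 ->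
  0 < r -> r <= 1 -> cabs w1 < (e * r) ^+ k2 -> exists2 s, 0 < cabs s < r & z = branch_inv s.
Proof.
move=> zw w10 E r0 r1 wr; have [T1 T2] := coord_param w10 E.
set t := coord w1 w2 in T1 T2; have [h1 h2 Z1 Z2] := zw.
have t0 : t != 0 by apply: contraNneq w10 => t0; rewrite -T1 t0 expr0n eqn0Ngt k2_gt0.
have tr : cabs t < e * r.
  rewrite ltNge; apply/negP => ert; move: wr; rewrite -T1 cabsX ltNge lerXn2r//.
    by rewrite nnegrE mulr_ge0// ltW.
  by rewrite nnegrE cabs_ge0.
have es : cR e * (t / cR e) = t by rewrite mulrCA mulfV// mulr1.
have sr : 0 < cabs (t / cR e) < r.
  rewrite cabsM cabsV cabs_cR (gtr0_norm e_gt0) ltr_pdivrMr// [r * e]mulrC tr andbT.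
  by rewrite mulr_gt0 ?invr_gt0// cabs_gt0.
exists (t / cR e) => //.
have [|B1 B2] := @branch_invE (t / cR e).
  by case/andP: sr => _ /lt_le_trans; apply.
by apply: fp_inj; rewrite ?B1 ?B2 es /arc1 /arc2 ?T1 ?T2.
Qed.

Let dom_params z : branch_dom z -> exists w1 w2, [/\ at_params z w1 w2, w1 != 0,
  w2 ^+ k2 = xi * w1 ^+ k1 & cabs w1 < e ^+ k2].
Proof.
move=> [s /= /andP[s0 s1] <-]; have te := scale s1.
exists ((cR e * s) ^+ k2), (zeta * (cR e * s) ^+ k1).
have [B1 B2] := branch_invE s1; split.
- by split=> //; [exact: small|exact: small2].
- by rewrite expf_neq0// mulf_neq0// -cabs_gt0.
- by rewrite exprMn zeta_k2 -!exprM mulnC.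
- by rewrite cabsX ltrXn2r// ?nnegrE ?cabs_ge0 ?ltW ?eqn0Ngt ?k2_gt0.
Qed.

(** The quotient w2 ^ k2 / w1 ^ k1 varies continuously among the finitely many roots of
    unity of order d, hence is locally constant: a branch is open. *)
Let root_isolated : exists2 r, 0 < r & forall z, z ^+ d = 1 -> cabs (z - xi) < r -> z = xi.
Proof.
have [P PP] := finite_roots (1 : C) d_gt0.
suff [r r0 H] : exists2 r, 0 < r & forall z, z \in P -> cabs (z - xi) < r -> z = xi.
  by exists r => // z /PP; exact: H.
elim: P {PP} => [|a P [r r0 H]]; first by exists 1.
have [->|ax] := eqVneq a xi.
  by exists r => // z; rewrite inE => /orP[/eqP|/H].
exists (Num.min r (cabs (a - xi))); first by rewrite lt_min r0 cabs_gt0 subr_eq0.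
move=> z; rewrite inE lt_min => /orP[/eqP->|zP] /andP[zr zax]; last exact: H.
by rewrite ltxx in zax.
Qed.

Let branch_dom_open : open branch_dom.
Proof.
rewrite openE => z /dom_params[w1 [w2 [zw w10 E w1e]]]; rewrite /interior /=.
have [E1 E2] := at_params_Phi zw; have [c1 c2] := Phi_tcont zw.
have [r r0 iso] := root_isolated.
pose q z' := (Phi2 (fp2 z')) ^+ k2 / (Phi1 (fp1 z')) ^+ k1.
have cq : tcont q z.
  apply: (tcontM (tcontX k2 c2)); apply: tcontV (tcontX k1 c1) => /=.
  by rewrite E1 expf_neq0.
have qz : q z = xi by rewrite /q E1 E2 E mulfK// expf_neq0.
have N1 : \forall z' \near z, cabs (Phi1 (fp1 z') - w1) < e ^+ k2 - cabs w1.
  by rewrite -E1; apply: c1; rewrite /= E1 subr_gt0.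
have N2 : \forall z' \near z, Phi1 (fp1 z') != 0.
  by apply: (tcont_ne0 _ c1); rewrite /= E1.
have N3 : \forall z' \near z, cabs (q z' - xi) < r by rewrite -qz; exact: cq.
have N4 := at_params_near zw.
have N34 : \forall z' \near z, cabs (q z' - xi) < r /\ exists w1' w2', at_params z' w1' w2'.
  by apply: filterS2 N3 N4 => z'.
apply: filterS3 N1 N2 N34 => z' n1' n2' [n3 [w1' [w2' zw']]].
have [F1 F2] := at_params_Phi zw'.
rewrite F1 in n1' n2'; rewrite /q F1 F2 in n3.
have w1d : w1' ^+ k1 != 0 by rewrite expf_neq0.
have E' : w2' ^+ k2 = xi * w1' ^+ k1.
  rewrite -(iso (w2' ^+ k2 / w1' ^+ k1))//; first by rewrite mulfVK.
  rewrite expr_div_n -!exprM -n1E -n2E (at_params_relation zw') divff//.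
  by rewrite -(at_params_relation zw') expf_neq0.
have [||s /andP[s0 s1] ->] := branch_lift zw' n2' E' ltr01 _ _ => //.
  by rewrite mulr1; have := cabs_tri w1 w1' 0; rewrite !subr0; lra.
by exists s => //=; rewrite s0.
Qed.

Let branch_img : branch_map @` branch_dom = [set s | 0 < cabs s < 1].
Proof.
apply/seteqP; split=> [_ [_ [s /= s1 <-] <-]|s /= s1]; first by rewrite branch_invK.
by exists (branch_inv s); [exists s|rewrite branch_invK].
Qed.

Let branch_img_open : open (branch_map @` branch_dom).
Proof.
rewrite branch_img openE => s /= /andP[s0 s1]; rewrite /interior; apply/nbhsC.
exists (Num.min (cabs s) (1 - cabs s)); first by rewrite lt_min s0 subr_gt0.
move=> u; rewrite lt_min => /andP[us1 us2].
have := cabs_tri s u 0; have := cabs_tri u s 0; rewrite [cabs (s - u)]cabsC !subr0 /= => A B.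
by apply/andP; split; lra.
Qed.

Let branch_map_continuous z : branch_dom z -> {for z, continuous branch_map}.
Proof.
move=> /dom_params[w1 [w2 [zw w10 E w1e]]]; apply: tcontP.
have [E1 E2] := at_params_Phi zw; have [c1 c2] := Phi_tcont zw.
have w20 : w2 != 0.
  have : w2 ^+ k2 != 0 by rewrite E mulf_neq0 ?expf_neq0.
  by apply: contraNneq => ->; rewrite expr0n eqn0Ngt k2_gt0.
rewrite /branch_map /coord.
apply: (tcontM _ (tcont_cst _ z)).
apply: (tcontM (tcontX al c1)); apply: tcontV; last first.
  by apply: tcontX; apply: (tcontM c2); exact: tcont_cst.
by rewrite expf_neq0// mulf_neq0 ?invr_eq0//= E2.
Qed.

Let branch_mapK z : branch_dom z -> branch_inv (branch_map z) = z.
Proof. by move=> [s /= s1 <-]; rewrite branch_invK. Qed.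

Let branch_inv_cont_img s : (branch_map @` branch_dom) s -> {for s, continuous branch_inv}.
Proof. by rewrite branch_img => /= /andP[_ s1]; exact: branch_inv_continuous. Qed.

Definition branch_chart : chart R X :=
  Chart branch_dom_open branch_img_open branch_map_continuous branch_inv_cont_img branch_mapK.

Lemma branch_chart_exists : exists c0, [/\ branch x c0,
  forall z, cdom c0 z -> exists w1 w2, [/\ at_params z w1 w2, w1 != 0 & w2 ^+ k2 = xi * w1 ^+ k1] &
  forall z w1 w2 r, at_params z w1 w2 -> w1 != 0 -> w2 ^+ k2 = xi * w1 ^+ k1 ->
    0 < r <= 1 -> cabs w1 < (e * r) ^+ k2 -> cdom c0 z /\ cabs (cmap c0 z) < r].
Proof.
exists branch_chart; split.
- split.
  + move=> /dom_params[w1 [w2 [zw w10 _ _]]]; have [E1 _] := at_params_Phi zw.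
    move: w10; rewrite -E1 -(pc_inv0 p1) /Phi1 pc_invK ?eqxx//.
    by rewrite cabs0 pc_rad_gt0.
  + by rewrite [LHS]branch_img; apply/seteqP; split=> s /=;
      rewrite normcE -cR0 -cR1 !cR_lt.
  + have c0 : {for 0, continuous branch_inv} by apply: branch_inv_continuous; rewrite cabs0.
    by move=> A xA; apply: (@nbhs_dnbhs _ (0 : C)); apply: c0; rewrite branch_inv0.
  + by move=> s; rewrite [X in X s]branch_img => /= /andP[_ s1]; exact: branch_inv_holo.
- by move=> z /dom_params[w1 [w2 [zw w10 E _]]]; exists w1, w2.
- move=> z w1 w2 r zw w10 E /andP[r0 r1] wr.
  have [s sr ->] := branch_lift zw w10 E r0 r1 wr.
  case/andP: sr => s0 sr; have s1 : 0 < cabs s < 1 by rewrite s0 (lt_le_trans sr).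
  by split; [exists s|rewrite /= branch_invK].
Qed.

End Root.

Lemma branches_at_params : exists (I : finType) (br : I -> chart R X), [/\
  forall i, branch x (br i),
  forall i z, cdom (br i) z -> U1 (fp1 z) /\ U2 (fp2 z),
  forall i j z, cdom (br i) z -> cdom (br j) z -> i = j &
  forall r, 0 < r -> \forall z \near x, z = x \/
    exists i, cdom (br i) z /\ cabs (cmap (br i) z) < r].
Proof.
have [P PP] := finite_roots (1 : C) d_gt0.
pose I : finType := seq_sub [seq z <- P | z ^+ d == 1].
have Ixi (i : I) : ssval i ^+ d = 1.
  by have := ssvalP i; rewrite mem_filter => /andP[/eqP].
have /choice[br brP] := fun i : I => branch_chart_exists (Ixi i).
exists I, br; split.
- by move=> i; have [] := brP i.
- move=> i z iz; have [_ /(_ z iz)[w1 [w2 [[h1 h2 -> ->] _ _]]] _] := brP i.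
  by split; apply: pc_sub; [exact: e_rad1|exact: e_rad2].
- move=> i j z iz jz.
  have [_ /(_ z iz)[w1 [w2 [zw w10 Ei]]] _] := brP i.
  have [_ /(_ z jz)[w1' [w2' [zw' _ Ej]]] _] := brP j.
  have [E1 E2] := at_params_Phi zw; have [E1' E2'] := at_params_Phi zw'.
  move: Ej; rewrite -E1' -E2' E1 E2 Ei => /mulIf E.
  by apply: val_inj; apply: E; rewrite expf_neq0.
move=> r0 r00; pose r := Num.min r0 1.
have r_gt0 : 0 < r by rewrite lt_min r00 ltr01.
have r1 : r <= 1 by rewrite ge_min lexx orbT.
have x00 : at_params x 0 0.
  by split; rewrite ?cabs0// /Psi1 /Psi2 pc_inv0.
have [c1 _] := Phi_tcont x00; have [E1 _] := at_params_Phi x00.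
have N1 : \forall z \near x, cabs (Phi1 (fp1 z)) < (e * r) ^+ k2.
  have := c1 ((e * r) ^+ k2) _; rewrite /= E1 exprn_gt0 ?mulr_gt0// => /(_ isT).
  by apply: filterS => z; rewrite subr0.
have N2 := at_params_near x00.
apply: filterS2 N1 N2 => z w1e [w1 [w2 zw]].
have [F1 F2] := at_params_Phi zw; rewrite F1 in w1e.
have rel := at_params_relation zw.
have [w10|w10] := eqVneq w1 0.
  left; have w20 : w2 = 0.
    apply/eqP; move: rel; rewrite w10 expr0n.
    have -> : n1 == 0%N = false by apply/negbTE; rewrite -lt0n (pc_deg_gt0 p1).
    by move=> /esym/eqP; rewrite expf_eq0 => /andP[].
  have [_ _ Z1 Z2] := zw; have [_ _ X1 X2] := x00.
  by apply: fp_inj; rewrite ?Z1 ?Z2 ?w10 ?w20.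
right.
have w1d : w1 ^+ k1 != 0 by rewrite expf_neq0.
have qd : (w2 ^+ k2 / w1 ^+ k1) ^+ d = 1.
  by rewrite expr_div_n -!exprM -n1E -n2E -rel divff// expf_neq0.
have qP : w2 ^+ k2 / w1 ^+ k1 \in [seq z <- P | z ^+ d == 1].
  by rewrite mem_filter qd eqxx PP.
pose i : I := SeqSub qP; exists i.
have [_ _ H] := brP i.
have [||zi zr] := H z w1 w2 r zw w10 _ _ w1e.
- by rewrite /= mulfVK.
- by rewrite r_gt0.
by split=> //; apply: lt_le_trans zr _; rewrite ge_min lexx.
Qed.

End AtPoint.

Hypotheses (hol1 : holomorphic b1) (hol2 : holomorphic b2).
Hypotheses (surj1 : set_surj [set: S1] [set: S0] b1).
Hypotheses (surj2 : set_surj [set: S2] [set: S0] b2).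

(** Take power coordinates of both factors over the same coordinate of S0. By the last
    conclusion the branches fill a neighbourhood of x, which is thus a finite family of
    discs glued at their centres. *)
Theorem local_branches (x : X) (N : set X) : nbhs x N ->
  exists (I : finType) (br : I -> chart R X), [/\
  forall i, branch x (br i),
  forall i, cdom (br i) `<=` N,
  forall i j z, cdom (br i) z -> cdom (br j) z -> i = j &
  forall r, 0 < r -> \forall z \near x, z = x \/
    exists i, cdom (br i) z /\ cabs (cmap (br i) z) < r].
Proof.
move=> /nbhs_set_type[V [[U1 U2] /= [xU1 xU2] UV] VN].
have [c rc cx] := rs_cover (b1 (fp1 x)).
have cx2 : cdom c (b2 (fp2 x)) by rewrite -fp_eq.
have [p1] := power_coordinate_exists hol1 surj1 rc cx xU1.
have [p2] := power_coordinate_exists hol2 surj2 rc cx2 xU2.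
have [I [br [h1 h2 h3 h4]]] := branches_at_params p1 p2.
exists I, br; split=> // i z /h2[u1 u2]; by apply: VN; apply: UV.
Qed.

End Branches.

(** * Punctured discs *)

Section PuncturedDiscs.
Variable R : realType.
Local Notation C := (cplx R).

Definition punctured (r : R) : set C := [set w | 0 < cabs w < r].

Lemma convex_connected (A : set C) :
  (forall x y t, A x -> A y -> 0 <= t <= 1 -> A (x + cR t * (y - x))) -> connected A.
Proof.
move=> cA; have [[x Ax]|/set0P/negP] := pselect (A !=set0); last first.
  by rewrite negbK => /eqP ->; exact: connected0.
pose seg y := (fun t : R => x + cR t * (y - x)) @` `[0, 1].
have -> : A = \bigcup_(y in A) seg y.
  apply/seteqP; split=> [y Ay|z [y Ay [t]]].
    by exists y => //; exists 1; [rewrite /= in_itv /= lexx ler01|rewrite mul1r addrC subrK].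
  by rewrite /= in_itv /= => t01 <-; exact: cA.
apply: bigcup_connected.
  by exists x => y Ay; exists 0; [rewrite /= in_itv /= lexx ler01|rewrite mul0r addr0].
move=> y Ay; apply: connected_continuous_connected; first exact: segment_connected.
apply: continuous_subspaceT => t B /nbhsC[r r0 rB].
suff : nbhs t ((fun t : R => x + cR t * (y - x)) @^-1` B) by [].
have k0 : 0 < cabs (y - x) + 1 by have := cabs_ge0 (y - x); lra.
apply/nbhs_ballP; exists (r / (cabs (y - x) + 1)); first by rewrite /= divr_gt0.
move=> u; rewrite -ball_normE /= ltr_pdivlMr// => ut; apply: rB.
have -> : x + cR u * (y - x) - (x + cR t * (y - x)) = cR (u - t) * (y - x).
  by rewrite cRB; ring.
rewrite cabsM cabs_cR distrC; apply: le_lt_trans ut.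
by apply: ler_wpM2l => //; lra.
Qed.

Lemma cabs_convex (x y : C) (t r : R) : 0 <= t <= 1 -> cabs x < r -> cabs y < r ->
  cabs (x + cR t * (y - x)) < r.
Proof.
move=> /andP[t0 t1] xr yr.
have -> : x + cR t * (y - x) = cR (1 - t) * x + cR t * y by rewrite cRB; ring.
apply: le_lt_trans (cabsD _ _) _; rewrite !cabsM !cabs_cR !ger0_norm; [|lra..].
have [->|tn0] := eqVneq t 0; first by rewrite subr0 mul1r mul0r addr0.
have tp : 0 < t by rewrite lt_def tn0.
have : t * cabs y < t * r by rewrite ltr_pM2l.
have : (1 - t) * cabs x <= (1 - t) * r by apply: ler_wpM2l; [lra|exact: ltW].
lra.
Qed.

Lemma disc_connected (r : R) : connected [set w : C | cabs w < r].
Proof. by apply: convex_connected => x y t xr yr t01; exact: cabs_convex. Qed.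

(** The image of a convex half disc under the fourth power; the square of an open half
    disc would miss a radius. *)
Lemma punctured_connected (r : R) : connected (punctured r).
Proof.
pose H : set C := [set w | 0 < complex.Re w /\ cabs w ^+ 4 < r].
have cH : connected H.
  apply: convex_connected => x y t [x0 xr] [y0 yr] t01; split.
    rewrite cReD cReM /= cReB mul0r subr0.
    case/andP: t01 => t0 t1; have [->|tn0] := eqVneq t 0; first by rewrite mul0r addr0.
    have tp : 0 < t by rewrite lt_def tn0.
    have : 0 < t * complex.Re y by rewrite mulr_gt0.
    have : 0 <= (1 - t) * complex.Re x by apply: mulr_ge0; [lra|exact: ltW].
    lra.
  have H4 a b : cabs a <= cabs b -> cabs b ^+ 4 < r ->
      forall z, (forall s, cabs b < s -> cabs z < s) -> cabs z ^+ 4 < r.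
    move=> ab br z zs; apply: le_lt_trans br.
    rewrite lerXn2r ?nnegrE ?cabs_ge0// leNgt; apply/negP => bz.
    by have := zs _ bz; rewrite ltxx.
  have [xy|/ltW yx] := leP (cabs x) (cabs y).
    by apply: (H4 _ _ xy yr) => s ys; apply: cabs_convex => //; exact: le_lt_trans ys.
  by apply: (H4 _ _ yx xr) => s xs; apply: cabs_convex => //; exact: le_lt_trans xs.
have -> : punctured r = (fun w : C => w ^+ 4) @` H.
  apply/seteqP; split=> [z /andP[z0 zr]|_ [w [w0 wr] <-]]; last first.
    rewrite /punctured /= cabsX wr andbT exprn_gt0// cabs_gt0.
    by apply: contraTneq w0 => ->; rewrite ltxx.
  pose y : C := 4.-root z.
  have y4 : y ^+ 4 = z by rewrite /y rootCK.
  have yr : cabs y ^+ 4 < r by rewrite -cabsX y4.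
  have y0 : y != 0.
    by apply: contraTneq z0 => y0; rewrite -y4 y0 expr0n cabs0 ltxx.
  have rot (u : C) : cabs u = 1 -> u ^+ 4 = 1 -> 0 < complex.Re (u * y) ->
      ((fun w : C => w ^+ 4) @` H) z.
    move=> u1 u4 uy; exists (u * y); last by rewrite exprMn u4 mul1r.
    by split=> //; rewrite cabsM u1 mul1r.
  have i4 : (iC R) ^+ 4 = 1.
    by rewrite (exprM _ 2 2) [(iC R) ^+ 2]iC_sqr expr2 mulrNN mulr1.
  case: (ltrgt0P (complex.Re y)) => [Re0|Re0|Re0].
  - by apply: (rot 1); rewrite ?cabs1 ?expr1n ?mul1r.
  - apply: (rot (-1)); rewrite ?cabsN ?cabs1//; first by rewrite (exprM _ 2 2) sqrrN !expr1n.
    by rewrite cReM /= oppr0 mul0r subr0 mulN1r oppr_gt0.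
  case: (ltrgt0P (complex.Im y)) => [Im0|Im0|Im0].
  - apply: (rot (- iC R)); rewrite ?cabsN ?cabs_iC//.
      by rewrite (exprM _ 2 2) sqrrN -exprM i4.
    by rewrite cReM /= oppr0 mul0r sub0r mulN1r opprK.
  - apply: (rot (iC R)); rewrite ?cabs_iC//.
    by rewrite cReM /= mul0r sub0r mul1r oppr_gt0.
  by move/negP: y0; case; apply/eqP; case: (y) Re0 Im0 => a b /= -> ->.
apply: connected_continuous_connected => //; apply: continuous_subspaceT => w.
by apply/continuousC; exact: ccontX (ccont_id w).
Qed.

Variable X : topologicalType.

(** The inverse of c parametrizes a disc of X punctured at its centre x *)
Definition disc_at (x : X) (c : chart R X) :=
  cmap c @` cdom c = [set w | 0 < `|w| < 1] /\ cinv c w @[w --> 0^'] --> x.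

Definition cext (c : chart R X) (x : X) (w : C) : X := if w == 0 then x else cinv c w.

Section Disc.
Variables (x : X) (c : chart R X).
Hypothesis dc : disc_at x c.

Lemma disc_img w : 0 < cabs w < 1 -> (cmap c @` cdom c) w.
Proof. by have [-> _] := dc; rewrite /= normcE -cR0 -cR1 !cR_lt. Qed.

Lemma disc_cmap z : cdom c z -> 0 < cabs (cmap c z) < 1.
Proof.
have [E _] := dc; move=> cz; have : (cmap c @` cdom c) (cmap c z) by exists z.
by rewrite E /= normcE -cR0 -cR1 !cR_lt.
Qed.

Lemma disc_cinv w : 0 < cabs w < 1 -> cdom c (cinv c w) /\ cmap c (cinv c w) = w.
Proof. by move=> /disc_img[z cz <-]; rewrite cmapK. Qed.

Lemma cext0 : cext c x 0 = x. Proof. by rewrite /cext eqxx. Qed.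

Lemma cext_ne w : 0 < cabs w -> cext c x w = cinv c w.
Proof. by rewrite cabs_gt0 /cext => /negbTE ->. Qed.

Lemma cext_continuous w : cabs w < 1 -> {for w, continuous (cext c x)}.
Proof.
move=> w1; have [->|w0] := eqVneq w 0.
  move=> A; rewrite cext0 => xA; have [_ lim] := dc.
  have := lim _ xA; rewrite /= /dnbhs /within /= => /nbhsC[r r0 H].
  suff : nbhs (0 : C) (cext c x @^-1` A) by [].
  apply/nbhsC; exists r => // u /H; rewrite /preimage /= /cext.
  case: eqVneq => [_ _|u0]; last exact.
  exact: nbhs_singleton xA.
have w01 : 0 < cabs w < 1 by rewrite cabs_gt0 w0.
have ci := cinv_continuous (disc_img w01).
move=> A; rewrite cext_ne ?cabs_gt0// => /ci H.
have {}H : nbhs w (cinv c @^-1` A) := H.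
suff : nbhs w (cext c x @^-1` A) by [].
have N : \forall u \near w, u != 0.
  apply/nbhsC; exists (cabs w); first by rewrite cabs_gt0.
  by move=> u uw; apply: contraTneq uw => ->; rewrite sub0r cabsN ltxx.
by apply: filterS2 N H => u u0; rewrite /preimage /= /cext (negbTE u0).
Qed.

Lemma cext_disc_compact r : r < 1 -> compact (cext c x @` [set w : C | cabs w <= r]).
Proof.
move=> r1; apply: continuous_compact.
  apply: continuous_in_subspaceT => w; rewrite inE /= => wr.
  by apply: cext_continuous; exact: le_lt_trans r1.
have := @compact_disc R 0 r; congr compact.
by apply/seteqP; split=> w /=; rewrite subr0.
Qed.

Lemma cext_disc_connected r : r <= 1 -> connected (cext c x @` [set w : C | cabs w < r]).
Proof.
move=> r1; apply: connected_continuous_connected; first exact: disc_connected.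
apply: continuous_in_subspaceT => w; rewrite inE /= => wr.
by apply: cext_continuous; exact: lt_le_trans r1.
Qed.

Lemma cext_punctured_connected r : r <= 1 -> connected (cext c x @` punctured r).
Proof.
move=> r1; apply: connected_continuous_connected; first exact: punctured_connected.
apply: continuous_in_subspaceT => w; rewrite inE /= => /andP[_ wr].
by apply: cext_continuous; exact: lt_le_trans r1.
Qed.

Lemma cext_nbhs A : nbhs x A -> exists2 r, 0 < r <= 1 & forall w, cabs w < r -> A (cext c x w).
Proof.
move=> xA; have c0 : {for 0, continuous (cext c x)} by apply: cext_continuous; rewrite cabs0.
have /nbhsC[r r0 H] : nbhs (0 : C) (cext c x @^-1` A) by apply: c0; rewrite cext0.
exists (Num.min r 1); first by rewrite lt_min r0 ltr01 ge_min lexx orbT.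
by move=> w; rewrite lt_min => /andP[wr _]; apply: H; rewrite subr0.
Qed.

Lemma cdom_cext : cdom c = cext c x @` punctured 1.
Proof.
apply/seteqP; split=> [z cz|_ [w w01 <-]].
  have z01 := disc_cmap cz; exists (cmap c z) => //.
  by rewrite cext_ne ?cmapK//; case/andP: z01.
by rewrite cext_ne; [have [] := disc_cinv w01|case/andP: w01].
Qed.

Lemma cdom_connected : connected (cdom c).
Proof. by rewrite cdom_cext; exact: cext_punctured_connected. Qed.

End Disc.
End PuncturedDiscs.

(** * Germs of punctured discs in the fiber product *)

Section FiberProductTopology.
Variable R : realType.
Local Notation C := (cplx R).
Variables (S0 S1 S2 : riemannSurface R) (b1 : S1 -> S0) (b2 : S2 -> S0).
Local Notation X := (fiber_product b1 b2).
Local Notation fp1 := (@fp1 R S0 S1 S2 b1 b2).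
Local Notation fp2 := (@fp2 R S0 S1 S2 b1 b2).
Local Notation pn := (@puncture_nbhs R S0 S1 S2 b1 b2).
Local Notation peq := (@puncture_equiv R S0 S1 S2 b1 b2).
Local Notation Sg := (fp_sing b1 b2).

Lemma fp_hausdorff : hausdorff_space X.
Proof.
rewrite open_hausdorff => x y xy.
have [f1|f1] := eqVneq (fp1 x) (fp1 y); last first.
  have := @rs_hausdorff R S1; rewrite open_hausdorff => /(_ _ _ f1).
  move=> [[A B] /= [xA yB] [oA oB AB]]; exists (fp1 @^-1` A, fp1 @^-1` B) => /=.
    by move: xA yB; rewrite !inE.
  split; try by apply: open_comp => // z _; exact: fp1_continuous.
  by rewrite -preimage_setI (eqP AB) preimage_set0.
have f2 : fp2 x != fp2 y by apply: contraNneq xy => f2; apply/eqP; exact: fp_inj.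
have := @rs_hausdorff R S2; rewrite open_hausdorff => /(_ _ _ f2).
move=> [[A B] /= [xA yB] [oA oB AB]]; exists (fp2 @^-1` A, fp2 @^-1` B) => /=.
  by move: xA yB; rewrite !inE.
split; try by apply: open_comp => // z _; exact: fp2_continuous.
by rewrite -preimage_setI (eqP AB) preimage_set0.
Qed.

Lemma pnE c r z : pn c (cR r) z <-> cdom c z /\ cabs (cmap c z) < r.
Proof. by rewrite /puncture_nbhs /= normcE cR_lt. Qed.

Lemma pn_cext x c r : disc_at x c -> r <= 1 -> pn c (cR r) = cext c x @` punctured r.
Proof.
move=> dc r1; apply/seteqP; split=> [z /pnE[cz zr]|_ [w /andP[w0 wr] <-]].
  have /andP[z0 z1] := disc_cmap dc cz.
  by exists (cmap c z); [rewrite /punctured /= z0|rewrite cext_ne ?cmapK].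
have [|cw wE] := disc_cinv dc (w := w); first by rewrite w0 (lt_le_trans wr).
by apply/pnE; rewrite cext_ne// wE.
Qed.

Lemma cdom_near (Y : topologicalType) (c : chart R Y) r :
  open [set z | cdom c z /\ cabs (cmap c z) < r].
Proof.
rewrite openE => z [cz zr]; rewrite /interior.
have r0 : 0 < r - cabs (cmap c z) by rewrite subr_gt0.
apply: filterS (cmap_near cz r0) => y [cy yz]; split=> //.
by have := cabs_tri (cmap c z) (cmap c y) 0; rewrite !subr0; lra.
Qed.

(** The boundary circle of a smaller disc of d is compact and stays away from the centre.
    A punctured disc of c small enough to avoid it is connected and meets that disc of
    d, so it is contained in it. *)
Lemma punctured_germ x c d : disc_at x c -> disc_at x d -> ~ cdom c x -> ~ cdom d x ->
  (forall s, 0 < s -> exists2 r, 0 < r & pn d (cR r) `<=` pn c (cR s)) -> peq c d.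
Proof.
move=> dc dd cx dx sub.
have key r : 0 < r -> exists2 s, 0 < s & pn c (cR s) `<=` pn d (cR r).
  move=> r0; pose rho := Num.min r 1 / 2.
  have m0 : 0 < Num.min r 1 by rewrite lt_min r0 ltr01.
  have rho0 : 0 < rho by rewrite divr_gt0.
  have rhor : rho < r.
    by have : Num.min r 1 <= r; [rewrite ge_min lexx|rewrite /rho; lra].
  have rho1 : rho < 1.
    by have : Num.min r 1 <= 1; [rewrite ge_min lexx orbT|rewrite /rho; lra].
  pose sph := [set w : C | cabs w = rho].
  have csph : compact sph.
    have -> : sph = [set w : C | cabs (w - 0) <= rho] `&` [set w : C | rho <= cabs (w - 0)].
      apply/seteqP; split=> w /=; rewrite !subr0; first by move=> ->; rewrite lexx.
      by case=> h1 h2; apply/eqP; rewrite eq_le h1.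
    apply: compact_closedI; first exact: compact_disc.
    apply: (@closed_comp _ _ (fun z : C => cabs (z - 0)) [set x | rho <= x]).
      by move=> z _; exact: cabs_continuous.
    exact: closed_ge.
  have cF : compact (cext d x @` sph).
    apply: continuous_compact => //; apply: continuous_in_subspaceT => w.
    by rewrite inE => wr; apply: cext_continuous => //; rewrite wr.
  have xF : ~ (cext d x @` sph) x.
    move=> [w wr]; have w0 : 0 < cabs w by rewrite wr.
    rewrite cext_ne// => E; apply: dx; rewrite -E.
    by have [] := disc_cinv dd (w := w); rewrite // w0 wr.
  have nF : nbhs x (~` (cext d x @` sph)).
    apply: open_nbhs_nbhs; split=> //; rewrite openC.
    by apply: compact_closed => //; exact: fp_hausdorff.
  have [s /andP[s0 s1] sF] := cext_nbhs dc nF.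
  exists s => //.
  have cD : connected (pn c (cR s)).
    by rewrite (pn_cext dc s1); exact: cext_punctured_connected.
  pose O := [set z | cdom d z /\ cabs (cmap d z) < rho].
  have DE z : pn c (cR s) z -> exists2 w, cabs w < s & z = cext c x w.
    by rewrite (pn_cext dc s1) => -[w /andP[_ ws] <-]; exists w.
  have E : pn c (cR s) `&` O = pn c (cR s).
    apply: cD.
    - have [r1 r10 r1P] := sub s s0; pose t := Num.min r1 rho / 2.
      have t0 : 0 < t by rewrite divr_gt0// lt_min r10.
      have tr1 : t < r1.
        by have : Num.min r1 rho <= r1; [rewrite ge_min lexx|rewrite /t; lra].
      have tr : t < rho.
        by have : Num.min r1 rho <= rho; [rewrite ge_min lexx orbT|rewrite /t; lra].
      have tc : cabs (cR t) = t by rewrite cabs_cR gtr0_norm.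
      have [|cw wE] := disc_cinv dd (w := cR t); first by rewrite tc t0 (lt_trans tr).
      exists (cinv d (cR t)); split; last by split; rewrite ?wE ?tc.
      by apply: r1P; apply/pnE; rewrite wE tc.
    - by exists O => //; exact: cdom_near.
    exists (cext d x @` [set w : C | cabs w <= rho]).
      by apply: compact_closed; [exact: fp_hausdorff|exact: cext_disc_compact].
    apply/seteqP; split=> z [Dz]; [move=> [dz zr]|move=> [w wr wz]]; split=> //.
      exists (cmap d z); first exact: ltW.
      by rewrite cext_ne ?cmapK//; have /andP[] := disc_cmap dd dz.
    have wn : cabs w != rho.
      have [v vs zv] := DE _ Dz; apply/eqP => wrho.
      by apply: (sF v vs); rewrite -zv -wz; exists w.
    have w0 : 0 < cabs w.
      rewrite cabs_gt0; apply: contra_not_neq cx => w0.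
      by have /pnE[] := Dz; rewrite -wz w0 cext0.
    have [|cw wE] := disc_cinv dd (w := w); first by rewrite w0 (le_lt_trans wr).
    by rewrite -wz cext_ne//; split=> //; rewrite wE lt_neqAle wn.
  move=> z; rewrite -E => -[_ [dz zr]]; apply/pnE; split=> //.
  exact: lt_trans zr _.
move=> _ /posC_real[r r0 ->].
have [s1 s10 H1] := sub r r0; have [s2 s20 H2] := key r r0.
exists (cR (Num.min s1 s2)); first by rewrite -cR0 cR_lt lt_min s10.
split=> z /pnE[cz]; rewrite lt_min => /andP[z1 z2].
  by apply: H1; apply/pnE.
by apply: H2; apply/pnE.
Qed.

Lemma puncture_equiv_refl c : peq c c.
Proof. by move=> r r0; exists r => //; split. Qed.

Lemma puncture_equiv_sym c d : peq c d -> peq d c.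
Proof. by move=> cd r r0; have [s s0 [h1 h2]] := cd r r0; exists s. Qed.

Lemma puncture_equiv_trans c d e : peq c d -> peq d e -> peq c e.
Proof.
move=> cd de r r0.
have [s1 s10 [d1 _]] := cd r r0; have [s2 s20 [e2 _]] := de s1 s10.
have [s3 s30 [_ d3]] := de r r0; have [s4 s40 [_ c4]] := cd s3 s30.
have [u2 u20 E2] := posC_real s20; have [u4 u40 E4] := posC_real s40.
exists (cR (Num.min u2 u4)); first by rewrite -cR0 cR_lt lt_min u20.
split=> z /pnE[cz]; rewrite lt_min => /andP[z1 z2].
  by apply/d1/e2; rewrite E2; apply/pnE.
by apply/d3/c4; rewrite E4; apply/pnE.
Qed.

Lemma disc_center_unique x y c d : disc_at x c -> disc_at y d -> peq c d -> x = y.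
Proof.
move=> dc dd cd; apply/eqP/negPn/negP => xy.
have := fp_hausdorff; rewrite open_hausdorff => /(_ _ _ xy)[[A B] /= [xA yB] [oA oB AB]].
have nA : nbhs x A by apply: open_nbhs_nbhs; split=> //; move: xA; rewrite inE.
have nB : nbhs y B by apply: open_nbhs_nbhs; split=> //; move: yB; rewrite inE.
have [r /andP[r0 r1] rA] := cext_nbhs dc nA; have [s /andP[s0 s1] sB] := cext_nbhs dd nB.
have [|_ /posC_real[u u0 ->] [uc _]] := cd (cR r); first by rewrite -cR0 cR_lt.
pose t := Num.min u s / 2.
have t0 : 0 < t by rewrite divr_gt0// lt_min u0.
have tu : t < u by have : Num.min u s <= u; [rewrite ge_min lexx|rewrite /t; lra].
have ts : t < s by have : Num.min u s <= s; [rewrite ge_min lexx orbT|rewrite /t; lra].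
have tc : cabs (cR t) = t by rewrite cabs_cR gtr0_norm.
have [|cw wE] := disc_cinv dd (w := cR t); first by rewrite tc t0 (lt_le_trans ts).
have : (A `&` B) (cinv d (cR t)).
  split.
    have : pn c (cR r) (cinv d (cR t)) by apply: uc; apply/pnE; rewrite wE tc.
    by rewrite (pn_cext dc r1) => -[w /andP[_ wr] <-]; exact: rA.
  by rewrite -(cext_ne y d) ?tc//; apply: sB; rewrite tc.
by rewrite (eqP AB).
Qed.

End FiberProductTopology.

(** * Ends of spaces that agree off a compact set *)

Section EndsBasics.
Variable X : topologicalType.
Implicit Types (u v w : nat -> set X) (e : Ends X).

Lemma end_seq_mono u m n : end_sequence u -> (m <= n)%N -> u n `<=` u m.
Proof.
move=> [du _ _ _] /subnK <-; elim: (n - m)%N => [|q IH]; first by rewrite add0n.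
by rewrite addSn => x /du/IH.
Qed.

Lemma end_equiv_sym u v : end_equiv u v -> end_equiv v u.
Proof.
move=> uv n; have [j [k [vu uv']]] := uv n.
by exists k, j.
Qed.

Lemma end_equiv_trans u v w : end_equiv u v -> end_equiv v w -> end_equiv u w.
Proof.
move=> uv vw n; have [j [_ [vu _]]] := uv n; have [k [_ [wv _]]] := vw j.
have [_ [j' [_ vw']]] := vw n; have [_ [k' [_ uv']]] := uv j'.
exists k, k'; split; first exact: subset_trans wv vu.
exact: subset_trans uv' vw'.
Qed.

Lemma end_equiv_refl u : end_equiv u u.
Proof. by move=> n; exists n, n; split. Qed.

Lemma set_val_Ends e : exists2 u, end_sequence u &
  set_val e = [set v | end_sequence v /\ end_equiv u v].
Proof. have [u uE e_def] := set_mem (valP e); exists u => //; by rewrite set_valE. Qed.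

Lemma end_rep e : exists u, set_val e u.
Proof.
have [u uE eE] := set_val_Ends e; exists u; rewrite eE; split=> //.
exact: end_equiv_refl.
Qed.

Lemma end_rep_seq e u : set_val e u -> end_sequence u.
Proof. by have [v vE ->] := set_val_Ends e; case. Qed.

Lemma end_rep_equiv e u v : set_val e u -> set_val e v -> end_equiv u v.
Proof.
have [w wE ->] := set_val_Ends e => -[_ wu] [_ wv].
exact: end_equiv_trans (end_equiv_sym wu) wv.
Qed.

Lemma end_rep_closed e u v : set_val e u -> end_sequence v -> end_equiv u v -> set_val e v.
Proof.
have [w wE ->] := set_val_Ends e => -[_ wu] vE uv; split=> //.
exact: end_equiv_trans uv.
Qed.

Lemma end_rep_inj e e' u v : set_val e u -> set_val e' v -> end_equiv u v -> e = e'.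
Proof.
move=> eu ev uv; apply: val_inj; rewrite -!set_valE; apply/seteqP; split=> w ew.
  apply: (end_rep_closed ev (end_rep_seq ew)).
  exact: end_equiv_trans (end_equiv_sym uv) (end_rep_equiv eu ew).
apply: (end_rep_closed eu (end_rep_seq ew)).
exact: end_equiv_trans uv (end_rep_equiv ev ew).
Qed.

Lemma end_of_seq u : end_sequence u -> exists e, set_val e u.
Proof.
move=> uE.
have h : equiv_classes (@end_sequence X) (@end_equiv X) [set v | end_sequence v /\ end_equiv u v].
  by exists u.
by exists (SigSub (mem_set h)); rewrite set_valE /=; split=> //; exact: end_equiv_refl.
Qed.

Lemma end_seq_shift u m : end_sequence u -> end_sequence (fun n => u (n + m)%N).
Proof.
move=> uE; have [du eu cu ku] := uE; split.
- by move=> n; exact: du.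
- by move=> n; exact: eu.
- rewrite -subset0 -cu => x Hx n _.
  exact: (closure_subset (end_seq_mono uE (leq_addr m n))) (Hx n I).
- move=> K /ku[k Kk]; exists k; rewrite -subset0 -Kk => x [Kx ux].
  by split=> //; exact: (end_seq_mono uE (leq_addr m k)).
Qed.

Lemma end_equiv_shift u m : end_sequence u -> end_equiv u (fun n => u (n + m)%N).
Proof.
move=> uE n; exists n, (n + m)%N; split=> //.
exact: end_seq_mono (leq_addr m n).
Qed.

(** Drop the first terms of a sequence. *)
Lemma end_rep_avoid e (K : set X) : compact K ->
  exists2 u, set_val e u & K `&` u 0%N = set0.
Proof.
move=> cK; have [u eu] := end_rep e; have uE := end_rep_seq eu.
have [_ _ _ ku] := uE; have [m Km] := ku K cK.
exists (fun n => u (n + m)%N); last by rewrite add0n.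
exact: end_rep_closed (end_seq_shift m uE) (end_equiv_shift m uE).
Qed.

Lemma ends_inP U e u : set_val e u -> ends_in U e <-> exists j, u j `<=` U.
Proof.
move=> eu; split=> [[v ev [j vU]]|[j uU]]; last by exists u => //; exists j.
have [k [_ [uk _]]] := end_rep_equiv ev eu j.
by exists k; exact: subset_trans vU.
Qed.

Lemma nbhs_EndsP e (A : set (Ends X)) :
  nbhs e A <-> exists U, [/\ end_domain U, ends_in U e & ends_in U `<=` A].
Proof.
split=> [|[U [dU Ue UA]]].
  rewrite nbhsE => -[B [[D DE <-] [U DU Ue]] BA]; exists U; split=> //.
    exact: DE.
  by move=> f Uf; apply: BA; exists U.
rewrite nbhsE; exists (ends_in U) => //; split=> //.
by exists [set U]; [move=> _ ->|rewrite bigcup_set1].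
Qed.

End EndsBasics.

(** The maps pi and j identify an open part C of X with a part of Y. The closure of C
    only adds points of S, so that the sets U inside C that avoid the neighbourhood N of
    S have their closure in C as well. Hence pi @^-1` U and U have the same topological
    properties, compactness of the boundary included, and sequences of such sets define
    ends of X and of Y simultaneously. *)
Section EndsTransfer.
Variables (X Y : topologicalType) (S C N : set X) (pi : Y -> X) (j : X -> Y).
Hypothesis pi_cont : continuous pi.
Hypothesis pi_proper : forall K, compact K -> compact (pi @^-1` K).
Hypothesis j_cont : forall x, C x -> {for x, continuous j}.
Hypothesis jK : forall x, C x -> pi (j x) = x.
Hypothesis piK : forall y, C (pi y) -> j (pi y) = y.
Hypothesis C_open : open C.
Hypothesis C_closure : closure C `<=` C `|` S.
Hypothesis N_nbhs : forall x, S x -> nbhs x N.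

Lemma closure_far U : U `<=` C -> N `&` U = set0 -> closure U `<=` C.
Proof.
move=> UC NU x Ux; case: (C_closure (closure_subset UC Ux)) => // Sx.
have [z [Uz Nz]] := Ux _ (N_nbhs Sx).
by have : (N `&` U) z by []; rewrite NU.
Qed.

Lemma preimage_far U : U `<=` C -> pi @^-1` U = j @` U.
Proof.
move=> UC; apply/seteqP; split=> [y Uy|_ [x Ux <-]].
  by exists (pi y) => //; apply: piK; exact: UC.
by rewrite /preimage /= jK//; exact: UC.
Qed.

Lemma image_preimage_far U : U `<=` C -> pi @` (pi @^-1` U) = U.
Proof.
move=> UC; apply/seteqP; split=> [_ [y Uy <-]//|x Ux].
by exists (j x); rewrite /preimage /= jK//; exact: UC.
Qed.

Lemma preimage_sub U V : U `<=` C -> pi @^-1` U `<=` pi @^-1` V -> U `<=` V.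
Proof.
by move=> UC UV x Ux; have := UV (j x); rewrite /preimage /= jK; [apply|exact: UC].
Qed.

Lemma closure_preimage U : U `<=` C -> N `&` U = set0 ->
  closure (pi @^-1` U) = pi @^-1` (closure U).
Proof.
move=> UC NU; apply/seteqP; split=> y Uy.
  move=> A Ay; have [z [Uz Az]] := Uy _ (pi_cont Ay).
  by exists (pi z).
move=> A Ay; have Cy : C (pi y) by exact: (closure_far UC NU).
have jA : nbhs (pi y) (j @^-1` A) by apply: (j_cont Cy); rewrite piK.
have [x [Ux Ax]] := Uy _ jA; exists (j x); split=> //.
by rewrite /preimage /= jK//; exact: UC.
Qed.

Lemma image_open_far V : open V -> V `<=` pi @^-1` C -> open (pi @` V).
Proof.
move=> oV VC; rewrite openE => _ [y Vy <-]; rewrite /interior.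
have Cy := VC _ Vy.
have N1 : nbhs (pi y) C by exact: open_nbhs_nbhs.
have N2 : nbhs (pi y) (j @^-1` V).
  by apply: (j_cont Cy); rewrite piK//; exact: open_nbhs_nbhs.
apply: filterS2 N1 N2 => x Cx Vx; exists (j x) => //; exact: jK.
Qed.

Lemma connected_preimage U : U `<=` C -> connected U -> connected (pi @^-1` U).
Proof.
move=> UC cU; rewrite preimage_far//; apply: connected_continuous_connected => //.
by apply: continuous_in_subspaceT => x; rewrite inE => /UC; exact: j_cont.
Qed.

Lemma connected_image V : connected V -> connected (pi @` V).
Proof.
move=> cV; apply: connected_continuous_connected => //.
exact: (continuous_subspaceT pi_cont).
Qed.

Lemma boundary_open (T : topologicalType) (U : set T) :
  open U -> boundary U = closure U `\` U.
Proof. by move=> oU; rewrite /boundary (interior_id _).1. Qed.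

Lemma end_domain_preimage U : U `<=` C -> N `&` U = set0 ->
  end_domain U <-> end_domain (pi @^-1` U).
Proof.
move=> UC NU.
have bE : open U -> open (pi @^-1` U) -> boundary (pi @^-1` U) = pi @^-1` boundary U.
  by move=> oU oV; rewrite !boundary_open// closure_preimage// preimage_setD.
have UE := image_preimage_far UC.
split=> [[[x Ux] cU oU bU]|[[y Uy] cV oV bV]].
  have oV : open (pi @^-1` U) by apply: open_comp => // y _; exact: pi_cont.
  split=> //.
  - by exists (j x); rewrite /preimage /= jK//; exact: UC.
  - exact: connected_preimage.
  - by rewrite bE//; exact: pi_proper.
have oU : open U.
  by rewrite -UE; apply: image_open_far => // z Uz; exact: UC.
split=> //; first by exists (pi y).
  by rewrite -UE; exact: connected_image.
have -> : boundary U = pi @` boundary (pi @^-1` U).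
  rewrite bE//; apply/seteqP; split=> [x bx|_ [z bz <-]//].
  have Cx : C x.
    by move: bx; rewrite boundary_open// => -[+ _]; exact: closure_far.
  by exists (j x); rewrite /preimage /= jK.
apply: continuous_compact => //; exact: (continuous_subspaceT pi_cont).
Qed.

Lemma end_sequence_preimage (u : nat -> set X) : u 0%N `<=` C -> N `&` u 0%N = set0 ->
  (forall n, u n.+1 `<=` u n) ->
  end_sequence u <-> end_sequence (fun n => pi @^-1` u n).
Proof.
move=> uC Nu du.
have u0 n : u n `<=` u 0%N by elim: n => [|n IH] // x /du/IH.
have unC n : u n `<=` C by exact: subset_trans (u0 n) uC.
have uN n : N `&` u n = set0.
  by rewrite -subset0 -Nu => x [Nx ux]; split=> //; exact: (u0 n).
split=> [[_ eu cu ku]|[_ ev cv kv]]; split=> //.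
- by move=> n y; exact: du.
- by move=> n; apply/end_domain_preimage.
- rewrite -subset0 => y Hy; have : (\bigcap_n closure (u n)) (pi y).
    by move=> n _; have := Hy n I; rewrite closure_preimage.
  by rewrite cu.
- move=> K cK; have [|m Km] := ku (pi @` K).
    by apply: continuous_compact => //; exact: (continuous_subspaceT pi_cont).
  exists m; rewrite -subset0 => y [Ky uy].
  have : (pi @` K `&` u m) (pi y) by split; [exists y|exact: uy].
  by rewrite Km.
- by move=> n; apply/end_domain_preimage.
- rewrite -subset0 => x Hx; have Cx : C x by exact: (closure_far uC Nu (Hx 0%N I)).
  have : (\bigcap_n closure (pi @^-1` u n)) (j x).
    by move=> n _; rewrite closure_preimage// /preimage /= jK//; exact: Hx.
  by rewrite cv.
- move=> K cK; have [m Km] := kv _ (pi_proper cK); exists m.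
  rewrite -subset0 => x [Kx ux].
  have : (pi @^-1` K `&` pi @^-1` u m) (j x).
    by rewrite /preimage; split; rewrite /= jK//; exact: (unC m).
  by rewrite Km.
Qed.

End EndsTransfer.

(** The space X is cut along S into disjoint open parts C i, which are the images of the
    parts of the Y i over them. An end of X has a representative avoiding the compact
    neighbourhood N of S; its members are connected, hence lie in one C i, and their
    preimages define an end of Y i. *)
Section EndsSum.
Variables (X : topologicalType) (I : choiceType) (Y : I -> topologicalType).
Variables (S N : set X) (C : I -> set X) (pi : forall i, Y i -> X) (j : forall i, X -> Y i).
Arguments pi : clear implicits.
Hypothesis pi_cont : forall i, continuous (pi i).
Hypothesis pi_proper : forall i K, compact K -> compact (pi i @^-1` K).
Hypothesis j_cont : forall i x, C i x -> {for x, continuous (j i)}.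
Hypothesis jK : forall i x, C i x -> pi i (j i x) = x.
Hypothesis piK : forall i y, C i (pi i y) -> j i (pi i y) = y.
Hypothesis pi_range : forall i y, (C i `|` S) (pi i y).
Hypothesis C_open : forall i, open (C i).
Hypothesis C_closure : forall i, closure (C i) `<=` C i `|` S.
Hypothesis C_disjoint : forall i i' x, C i x -> C i' x -> i = i'.
Hypothesis C_connected_cover : forall U, connected U -> U !=set0 -> S `&` U = set0 ->
  exists i, U `<=` C i.
Hypothesis N_nbhs : forall x, S x -> nbhs x N.
Hypothesis N_compact : compact N.

(** The bijection is treated as a relation, which is functional and injective because
    equivalent sequences lie in the same part and have equivalent preimages. *)
Definition end_corr (e : Ends X) (t : {i : I & Ends (Y i)}) : Prop :=
  exists u, [/\ set_val e u, u 0%N `<=` C (projT1 t), N `&` u 0%N = set0 &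
    set_val (projT2 t) (fun n => pi (projT1 t) @^-1` u n)].

Let SN : S `<=` N.
Proof. by move=> x /N_nbhs/nbhs_singleton. Qed.

Let transfer i u : u 0%N `<=` C i -> N `&` u 0%N = set0 -> (forall n, u n.+1 `<=` u n) ->
  end_sequence u <-> end_sequence (fun n => pi i @^-1` u n).
Proof. exact: (end_sequence_preimage (@pi_cont i) (@pi_proper i) (@j_cont i)
  (@jK i) (@piK i) (C_open i) (@C_closure i) N_nbhs). Qed.

Lemma end_corr_total e : exists t, end_corr e t.
Proof.
have [u eu Nu] := end_rep_avoid e N_compact; have uE := end_rep_seq eu.
have [du /(_ 0%N)[u0 cu _ _] _ _] := uE.
have [|i uC] := C_connected_cover cu u0.
  by rewrite -subset0 -Nu => x [/SN Nx ux]; split.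
have [e' e'u] := end_of_seq ((transfer uC Nu du).1 uE).
by exists (existT _ i e'), u.
Qed.

Lemma end_corr_onto t : exists e, end_corr e t.
Proof.
case: t => i e'; have [v e'v Nv] := end_rep_avoid e' (@pi_proper i _ N_compact).
have vE := end_rep_seq e'v; have [dv _ _ _] := vE.
have vC n : v n `<=` pi i @^-1` C i.
  move=> y /(end_seq_mono vE (leq0n n)) vy; case: (pi_range y) => // /SN Ny.
  by have : (pi i @^-1` N `&` v 0%N) y by []; rewrite Nv.
pose u n := pi i @` v n.
have uE n : pi i @^-1` u n = v n.
  apply/seteqP; split=> [y [z vz zy]|y vy]; last by exists y.
  have Cz := vC _ _ vz; have Cy : C i (pi i y) by rewrite -zy.
  by rewrite -(piK Cy) -zy piK.
have uC : u 0%N `<=` C i by move=> _ [y vy <-]; exact: vC vy.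
have Nu : N `&` u 0%N = set0.
  rewrite -subset0 => x [Nx [y vy yx]].
  have : (pi i @^-1` N `&` v 0%N) y by split=> //; rewrite /preimage /= yx.
  by rewrite Nv.
have du n : u n.+1 `<=` u n by move=> _ [y /dv vy <-]; exists y.
have uvE : (fun n => pi i @^-1` u n) = v by apply/funext.
have [|e eu] := @end_of_seq _ u; first by apply/(transfer uC Nu du); rewrite uvE.
by exists e, u; split=> //=; rewrite uvE.
Qed.

Lemma end_corr_inj e e' t : end_corr e t -> end_corr e' t -> e = e'.
Proof.
move=> [u [eu uC Nu tu]] [u' [eu' uC' Nu' tu']].
apply: (end_rep_inj eu eu') => n; have [k [l [uk ul]]] := end_rep_equiv tu tu' n.
have m0 (v : nat -> set X) m : end_sequence v -> v 0%N `<=` C (projT1 t) -> v m `<=` C (projT1 t).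
  by move=> vE vC; exact: subset_trans (end_seq_mono vE (leq0n m)) vC.
exists k, l; split.
  exact: (preimage_sub (@jK _) (m0 _ _ (end_rep_seq eu') uC') uk).
exact: (preimage_sub (@jK _) (m0 _ _ (end_rep_seq eu) uC) ul).
Qed.

(** Any two representatives of an end meet, while the parts are disjoint. *)
Lemma end_corr_part e t u i k : end_corr e t -> set_val e u -> u k `<=` C i -> projT1 t = i.
Proof.
move=> [v [ev vC Nv tv]] eu uC; have [_ [l [_ vl]]] := end_rep_equiv eu ev k.
have [l' [_ [vl' _]]] := end_rep_equiv eu ev k.
have [_ /(_ l')[[x vx] _ _ _] _ _] := end_rep_seq ev.
apply: (C_disjoint (x := x)); last exact/uC/vl'.
exact: vC (end_seq_mono (end_rep_seq ev) (leq0n _) vx).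
Qed.

Lemma end_corr_fun e t t' : end_corr e t -> end_corr e t' -> t = t'.
Proof.
case: t => i e1; case: t' => i' e2 et [u' [/= eu' uC' Nu' tu']].
have /= E := end_corr_part et eu' uC'; subst i'.
case: et => u [/= eu uC Nu tu].
congr existT; apply: (end_rep_inj tu tu') => n.
have [k [l [uk ul]]] := end_rep_equiv eu eu' n.
by exists k, l; split=> y; [exact: uk|exact: ul].
Qed.

Theorem ends_sum_homeomorphic : homeomorphic (Ends X) {i : I & Ends (Y i)}.
Proof.
have /choice[f fP] := end_corr_total; have /choice[g gP] := end_corr_onto.
have gf : cancel f g by move=> e; exact: end_corr_inj (gP (f e)) (fP e).
have fg : cancel g f by move=> t; exact: end_corr_fun (fP (g t)) (gP t).
exists f, g; split=> //.
- move=> e A; have := fP e; case: (f e) => i e1 [u [/= eu uC Nu e1u]].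
  move=> /nbhs_EndsP[W [dW We1 WA]].
  have [k uW] := (ends_inP W e1u).1 We1.
  suff : nbhs e (f @^-1` A) by [].
  apply/nbhs_EndsP; exists (u k); split.
  + by have [_ /(_ k)] := end_rep_seq eu.
  + by apply/(ends_inP _ eu); exists k.
  move=> e2 /= e2u; have := fP e2; case: (f e2) => i2 t2 et2.
  have [v e2v [l vl]] := e2u.
  have uCk : u k `<=` C i by exact: subset_trans (end_seq_mono (end_rep_seq eu) (leq0n k)) uC.
  have vC : v l `<=` C i by exact: subset_trans uCk.
  have /= E := end_corr_part et2 e2v vC; subst i2.
  apply: WA; case: et2 => w [e2w wC Nw t2w].
  apply/(ends_inP _ t2w); have [m wu] := (ends_inP _ e2w).1 e2u.
  by exists m => y wy; apply: uW; exact: wu.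
- move=> [i e1] A; have [u [/= eu uC Nu e1u]] := gP (existT _ i e1).
  move=> /nbhs_EndsP[W [dW We WA]].
  have [k uW] := (ends_inP W eu).1 We.
  suff : nbhs e1 ((fun e1 => g (existT _ i e1)) @^-1` A) by [].
  apply/nbhs_EndsP; exists (pi i @^-1` u k); split.
  + by have [_ /(_ k)] := end_rep_seq e1u.
  + by apply/(ends_inP _ e1u); exists k.
  move=> e2 e2u; apply: WA; have [v [/= ev vC Nv e2v]] := gP (existT _ i e2).
  apply/(ends_inP _ ev); have [m vm] := (ends_inP _ e2v).1 e2u.
  have vCm : v m `<=` C i by exact: subset_trans (end_seq_mono (end_rep_seq ev) (leq0n m)) vC.
  by exists m; apply: subset_trans uW; exact: (preimage_sub (@jK i) vCm vm).
Qed.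

End EndsSum.

(** * The normalization map *)

Lemma finite_bigcup_compact (T : topologicalType) (I : choiceType) (A : set I) (F : I -> set T) :
  finite_set A -> (forall i, compact (F i)) -> compact (\bigcup_(i in A) F i).
Proof.
move=> /finite_seqP[s ->] cF; rewrite bigcup_seq.
by apply: bigsetU_compact => i _; exact: cF.
Qed.

Section Normalization.
Variable R : realType.
Local Notation C := (cplx R).
Variables (S0 S1 S2 : riemannSurface R) (b1 : S1 -> S0) (b2 : S2 -> S0).
Local Notation X := (fiber_product b1 b2).
Local Notation pn := (@puncture_nbhs R S0 S1 S2 b1 b2).
Local Notation peq := (@puncture_equiv R S0 S1 S2 b1 b2).
Local Notation Sg := (fp_sing b1 b2).
Local Notation branch := (@branch R S0 S1 S2 b1 b2).
Local Notation pchart := (@puncture_chart R S0 S1 S2 b1 b2).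
Local Notation puncture := (@puncture R S0 S1 S2 b1 b2).
Local Notation irr := (@irreducible_component R S0 S1 S2 b1 b2).
Hypotheses (hol1 : holomorphic b1) (hol2 : holomorphic b2).
Hypotheses (surj1 : set_surj [set: S1] [set: S0] b1).
Hypotheses (surj2 : set_surj [set: S2] [set: S0] b2).
Hypothesis sing_finite : finite_set Sg.

Lemma disc0 r : 0 < r -> [set w : C | cabs w < r] 0.
Proof. by move=> r0; suff : cabs (0 : C) < r by []; rewrite cabs0. Qed.

Lemma branch_disc x c : branch x c -> disc_at x c.
Proof. by case. Qed.

(** The finitely many closed half discs of branches lying in V have a compact union,
    which fills a neighbourhood of x. *)
Lemma locally_compact_fp (x : X) (V : set X) : nbhs x V ->
  exists2 K : set X, compact K & nbhs x K /\ K `<=` V.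
Proof.
move=> xV.
have [I [br [brP brV _ brN]]] := local_branches hol1 hol2 surj1 surj2 xV.
pose K i := cext (br i) x @` [set w : C | cabs w <= 1 / 2].
have h2 : 0 < 1 / 2 :> R by lra.
exists ([set x] `|` \bigcup_i K i).
  apply: compactU; first exact: compact_set1.
  apply: finite_bigcup_compact; first exact: finite_finset.
  by move=> i; apply: (cext_disc_compact (branch_disc (brP i))); lra.
split.
  apply: filterS (brN _ h2) => z [->|[i [iz zr]]]; [by left|right].
  exists i => //; exists (cmap (br i) z); first exact: ltW.
  have /andP[z0 _] := disc_cmap (branch_disc (brP i)) iz.
  by rewrite cext_ne// cmapK.
move=> z [->|[i _ [w wr <-]]]; first exact: nbhs_singleton.
have [->|w0] := eqVneq w 0; first by rewrite cext0; exact: nbhs_singleton.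
rewrite -cabs_gt0 in w0; rewrite cext_ne//; apply: brV.
apply: (disc_cinv (branch_disc (brP i)) _).1; rewrite w0.
by move: wr => /=; lra.
Qed.

Lemma sing_closed : closed Sg.
Proof.
exact: (accessible_finite_set_closed.1 (hausdorff_accessible (@fp_hausdorff _ _ _ _ b1 b2))).
Qed.

Lemma sing_compl_nbhs x : ~ Sg x -> nbhs x (~` Sg).
Proof. by move=> xS; apply: open_nbhs_nbhs; split=> //; exact/closed_openC/sing_closed. Qed.

Lemma comp_sub D : components b1 b2 D -> D `<=` ~` Sg.
Proof. by move=> [x _ <-]; exact: connected_component_sub. Qed.

Lemma comp_nonempty D : components b1 b2 D -> D !=set0.
Proof. by move=> [x Sx <-]; exists x; exact: connected_component_refl. Qed.

Lemma compE D y : components b1 b2 D -> D y -> D = connected_component (~` Sg) y.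
Proof. by move=> [x _ <-]; exact: same_connected_component. Qed.

Lemma comp_max D U : components b1 b2 D -> connected U -> U `<=` ~` Sg ->
  U `&` D !=set0 -> U `<=` D.
Proof.
by move=> cD cU US [y [Uy /(compE cD) ->]]; exact: connected_component_max.
Qed.

Lemma comp_disjoint D D' x : components b1 b2 D -> components b1 b2 D' -> D x -> D' x -> D = D'.
Proof. by move=> cD cD' Dx D'x; rewrite (compE cD Dx) (compE cD' D'x). Qed.

(** Near a regular point, the fiber product is a union of connected discs through it. *)
Lemma comp_open D : components b1 b2 D -> open D.
Proof.
move=> cD; rewrite openE => y Dy; rewrite /interior.
have yS := sing_compl_nbhs (comp_sub cD Dy).
have [I [br [brP brS _ brN]]] := local_branches hol1 hol2 surj1 surj2 yS.
apply: filterS (brN 1 ltr01) => z [->//|[i [iz _]]].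
have di := branch_disc (brP i).
apply: (comp_max (U := cext (br i) y @` [set w : C | cabs w < 1])) => //.
- exact: (cext_disc_connected di).
- move=> _ [w w1 <-]; have [->|w0] := eqVneq w 0.
    by rewrite cext0; exact: comp_sub cD _ Dy.
  rewrite -cabs_gt0 in w0; rewrite cext_ne//; apply: brS.
  by apply: (disc_cinv di _).1; rewrite w0.
- exists y; split=> //; exists 0; [exact: (disc0 ltr01)|exact: cext0].
by have := iz; rewrite (cdom_cext di) => -[w /andP[_ w1] wz]; exists w.
Qed.

(** A regular point in the closure of D has its own open component, which meets D. *)
Lemma comp_closure D : components b1 b2 D -> closure D `<=` D `|` Sg.
Proof.
move=> cD x Dx; have [xS|xS] := pselect (Sg x); [by right|left].
have cE : components b1 b2 (connected_component (~` Sg) x) by exists x.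
have Ex : connected_component (~` Sg) x x by exact: connected_component_refl.
have [y [Dy Ey]] := Dx _ (open_nbhs_nbhs (conj (comp_open cE) Ex)).
by rewrite (comp_disjoint cD cE Dy Ey).
Qed.

Lemma pchart_disc D c : pchart D c -> exists2 p, Sg p & disc_at p c.
Proof. by move=> [_ _ im [p Sp lim]]; exists p => //; split. Qed.

Lemma sing_isolated p : nbhs p (~` (Sg `\` [set p])).
Proof.
apply: open_nbhs_nbhs; split; last by move=> [_]; exact.
apply: closed_openC.
apply: (accessible_finite_set_closed.1 (hausdorff_accessible (@fp_hausdorff _ _ _ _ b1 b2))).
exact: finite_setD.
Qed.

(** Every puncture over p is the germ of one of the finitely many branches at p: a small
    punctured disc of d is connected and covered by the disjoint branches, so it lies in
    one of them. This finiteness makes the normalization proper. *)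
Lemma puncture_branch p (I : finType) (br : I -> chart R X) D d :
  (forall i, branch p (br i)) -> (forall i, cdom (br i) `<=` ~` Sg) ->
  (forall i j z, cdom (br i) z -> cdom (br j) z -> i = j) ->
  (forall r, 0 < r -> \forall z \near p, z = p \/
    exists i, cdom (br i) z /\ cabs (cmap (br i) z) < r) ->
  components b1 b2 D -> Sg p -> pchart D d -> disc_at p d ->
  exists i, [/\ cdom (br i) `<=` D, pchart D (br i) & peq (br i) d].
Proof.
move=> brP brS brdis brN cD Sp pd dd; have [_ dD _ _] := pd.
have dnp z : cdom d z -> z <> p by move=> /dD/(comp_sub cD) zS zp; apply: zS; rewrite zp.
have inbr s : 0 < s -> exists2 r, 0 < r <= 1 & forall w, 0 < cabs w < r ->
    exists i, cdom (br i) (cinv d w) /\ cabs (cmap (br i) (cinv d w)) < s.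
  move=> s0; have [r r01 H] := cext_nbhs dd (brN s s0).
  exists r => // w /andP[w0 wr]; have := H w wr; rewrite cext_ne// => -[zp|//].
  have [|dw _] := disc_cinv dd (w := w).
    by case/andP: r01 => _ r1; rewrite w0 (lt_le_trans wr).
  by have := dnp _ dw zp.
have [r1 /andP[r10 r11] r1P] := inbr 1 ltr01.
pose A := cext d p @` punctured r1.
have cA : connected A by exact: (cext_punctured_connected dd).
have tP t : 0 < t -> punctured (t : R) (cR (t / 2)).
  by move=> t0; rewrite /punctured /= cabs_cR gtr0_norm; lra.
have [i [iw _]] := r1P _ (tP _ r10).
have Ai : A `<=` cdom (br i).
  suff <- : A `&` cdom (br i) = A by move=> z [].
  have w00 := tP _ r10; apply: cA.
  - exists (cinv d (cR (r1 / 2))); split=> //; exists (cR (r1 / 2)) => //.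
    by rewrite cext_ne//; case/andP: w00.
  - by exists (cdom (br i)) => //; exact: cdom_open.
  exists (~` \bigcup_(j in [set j | j != i]) cdom (br j)).
    by apply: open_closedC; apply: bigcup_open => j _; exact: cdom_open.
  apply/seteqP; split=> z [Az].
    by move=> iz; split=> // -[j /= ji jz]; rewrite (brdis _ _ _ jz iz) eqxx in ji.
  move=> nz; split=> //; case: (Az) => w wr wz.
  have [j [jz _]] := r1P w wr; have w0 : 0 < cabs w by case/andP: wr.
  rewrite cext_ne// in wz; rewrite wz in jz.
  have [<-//|ji] := eqVneq j i.
  by case: nz; exists j.
have di := branch_disc (brP i); have [ndi _ _ hi] := brP i.
have ndd : ~ cdom d p by move=> /dnp.
have sub s : 0 < s -> exists2 r, 0 < r & pn d (cR r) `<=` pn (br i) (cR s).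
  move=> s0; have [r /andP[r0 r1'] rP] := inbr s s0.
  exists (Num.min r r1); first by rewrite lt_min r0.
  move=> z /pnE[dz]; rewrite lt_min => /andP[zr zr1].
  have z01 := disc_cmap dd dz; have /andP[z0 _] := z01.
  have [|j [jz js]] := rP (cmap d z); first by rewrite z0.
  rewrite cmapK// in jz js.
  have iz : cdom (br i) z.
    by apply: Ai; exists (cmap d z); rewrite /punctured /= ?z0// cext_ne ?cmapK.
  by apply/pnE; rewrite (brdis _ _ _ iz jz).
have brD : cdom (br i) `<=` D.
  apply: (comp_max cD) => //; first exact: (cdom_connected di).
  exists (cinv d (cR (r1 / 2))); split=> //; apply: dD.
  have /andP[w0 wr] := tP _ r10.
  by apply: (disc_cinv dd _).1; rewrite w0 (lt_le_trans wr).
exists i; split=> //; last exact: (punctured_germ di dd ndi ndd sub).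
split=> //; last by exists p => //; exact: di.2.
by case: di.
Qed.

Section Component.
Variable D : set X.
Hypothesis cD : components b1 b2 D.

Lemma puncture_centerP (q : puncture D) :
  exists2 p, Sg p & forall c, set_val q c -> pchart D c /\ disc_at p c.
Proof.
have [u uD qE] := set_mem (valP q); have [p Sp du] := pchart_disc uD.
exists p => // c; rewrite set_valE qE => -[cD' uc]; split=> //.
have [p' _ dc] := pchart_disc cD'.
by rewrite (disc_center_unique du dc uc).
Qed.

Definition puncture_center (q : puncture D) : X := sval (cid2 (puncture_centerP q)).

Lemma puncture_center_sing q : Sg (puncture_center q).
Proof. by rewrite /puncture_center; case: cid2. Qed.

Lemma puncture_center_disc q c : set_val q c -> pchart D c /\ disc_at (puncture_center q) c.
Proof. by rewrite /puncture_center; case: cid2 => p ? H; exact: H. Qed.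

Lemma puncture_rep (q : puncture D) : exists c, set_val q c.
Proof.
have [u uD qE] := set_mem (valP q); exists u; rewrite set_valE qE; split=> //.
exact: puncture_equiv_refl.
Qed.

Lemma puncture_inj (q q' : puncture D) c d :
  set_val q c -> set_val q' d -> peq c d -> q = q'.
Proof.
move=> qc qd cd; apply: val_inj; rewrite -!set_valE.
have [u uD qE] := set_mem (valP q); have [v vD q'E] := set_mem (valP q').
rewrite set_valE qE in qc *; rewrite set_valE q'E in qd *.
have uv : peq u v.
  apply: (puncture_equiv_trans qc.2); apply: (puncture_equiv_trans cd).
  exact: puncture_equiv_sym qd.2.
apply/seteqP; split=> e [eD ue]; split=> //.
  exact: puncture_equiv_trans (puncture_equiv_sym uv) ue.
exact: puncture_equiv_trans uv ue.
Qed.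

Lemma puncture_of_chart c : pchart D c -> exists q : puncture D, set_val q c.
Proof.
move=> cP.
have h : equiv_classes (pchart D) peq [set v | pchart D v /\ peq c v] by exists c.
by exists (SigSub (mem_set h)); rewrite set_valE /=; split=> //; exact: puncture_equiv_refl.
Qed.

(** The normalization map forgets at which branch a puncture sits. *)
Definition normalization (y : irr D) : X :=
  match y with inl x => set_val x | inr q => puncture_center q end.

Lemma open_irrE (U : set (irr D)) : open U = irr_open U.
Proof. by []. Qed.

Lemma normalization_continuous : continuous normalization.
Proof.
apply/continuousP => V oV; rewrite open_irrE; split.
  apply: (@open_comp _ _ (set_val : D -> X)) => // x _; exact: set_val_continuous.
move=> q /= Vq c qc; have [_ dc] := puncture_center_disc qc.
have [|r /andP[r0 r1] rV] := cext_nbhs dc (A := V); first exact: open_nbhs_nbhs.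
exists (cR r); first by rewrite -cR0 cR_lt.
move=> x; rewrite (pn_cext dc r1) => -[w /andP[_ wr] wx].
by rewrite /preimage /= -wx; exact: rV.
Qed.

(** The inverse of the normalization map over D, with a default value elsewhere *)
Definition to_irr (x0 : D) (x : X) : irr D :=
  match pselect (D x) with
  | left h => inl (SigSub (mem_set h))
  | right _ => inl x0
  end.

Lemma to_irrE x0 (x : D) : to_irr x0 (set_val x) = inl x.
Proof.
rewrite /to_irr; case: pselect => [h|]; last by have := set_valP x.
by congr inl; apply: val_inj.
Qed.

Lemma normalization_to_irr x0 x : D x -> normalization (to_irr x0 x) = x.
Proof.
by move=> Dx; rewrite /to_irr; case: pselect => // h; rewrite /= set_valE.
Qed.

Lemma normalization_range y : (D `|` Sg) (normalization y).
Proof.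
by case: y => [x|q]; [left; exact: set_valP|right; exact: puncture_center_sing].
Qed.

Lemma to_irr_normalization x0 y : D (normalization y) -> to_irr x0 (normalization y) = y.
Proof.
case: y => [x _|q /(comp_sub cD)]; first exact: to_irrE.
by case; exact: puncture_center_sing.
Qed.

Lemma to_irr_continuous x0 x : D x -> {for x, continuous (to_irr x0)}.
Proof.
move=> Dx A; pose x' : D := SigSub (mem_set Dx).
have -> : x = set_val x' by rewrite set_valE.
rewrite to_irrE nbhsE => -[U [oU Ux] UA].
move: oU; rewrite open_irrE => -[oU _].
have : nbhs x' [set x : D | U (inl x)] by exact: open_nbhs_nbhs.
move=> /nbhs_set_type[V xV VU].
have Dn : nbhs (set_val x') D.
  by apply: open_nbhs_nbhs; split; [exact: comp_open|exact: set_valP].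
suff : nbhs (set_val x') (to_irr x0 @^-1` A) by [].
apply: filterS2 xV Dn => z Vz Dz; apply: UA.
pose z' : D := SigSub (mem_set Dz).
have zE : z = set_val z' by rewrite set_valE.
by rewrite zE to_irrE; apply: VU; rewrite -zE.
Qed.

(** Over a point of D take a compact neighbourhood in D; over a singular point, the
    finitely many closed half discs, centre included, of the branches contained in D;
    the other points of the fiber product are not in the closure of D. *)
Lemma normalization_proper_near (x : X) :
  exists N, nbhs x N /\ exists2 K, compact K & normalization @^-1` N `<=` K.
Proof.
have [x1 Dx1] := comp_nonempty cD; pose x0 : D := SigSub (mem_set Dx1).
have [Dx|nDx] := pselect (D x).
  have Dn : nbhs x D by apply: open_nbhs_nbhs; split=> //; exact: comp_open.
  have [M cM [xM MD]] := locally_compact_fp Dn; exists M; split=> //.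
  exists (to_irr x0 @` M).
    apply: continuous_compact => //; apply: continuous_in_subspaceT => z.
    by rewrite inE => /MD; exact: to_irr_continuous.
  move=> y My; exists (normalization y) => //.
  by apply: to_irr_normalization; exact: MD.
have [xS|nxS] := pselect (Sg x); last first.
  exists (~` closure D); split.
    apply: open_nbhs_nbhs; split; first exact/closed_openC/closed_closure.
    by move=> /(comp_closure cD)[].
  exists set0; first exact: compact0.
  move=> y /= ny; apply: ny; case: (normalization_range y) => [/subset_closure//|yS].
  (* a puncture lies in the closure of D *)
  case: y yS => [z _|q _]; first exact/subset_closure/set_valP.
  have [c qc] := puncture_rep q; have [[_ cDD _ _] dc] := puncture_center_disc qc.
  move=> A /(cext_nbhs dc)[r /andP[r0 r1] rA].
  have tc : 0 < cabs (cR (r / 2)) < r by rewrite cabs_cR gtr0_norm; lra.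
  have /andP[t0 tr] := tc.
  exists (cinv c (cR (r / 2))); split.
    by apply: cDD; have [|] := disc_cinv dc (w := cR (r / 2)); rewrite // t0 (lt_le_trans tr).
  by rewrite -(cext_ne (puncture_center q) c)//; exact: rA.
(* over a singular point: the closed half discs of the branches lying in D *)
have [I [br [brP brSp brdis brN]]] := local_branches hol1 hol2 surj1 surj2 (@sing_isolated x).
have brS i : cdom (br i) `<=` ~` Sg.
  move=> z iz zS; apply: (brSp i z iz); split=> // zx.
  by have [+ _ _ _] := brP i; rewrite -zx.
have h2 : 0 < 1 / 2 :> R by lra.
pose J := [set i | pchart D (br i)].
have /choice[Q QP] : forall i, exists q : option (puncture D), pchart D (br i) ->
    exists2 q', q = Some q' & set_val q' (br i).
  move=> i; have [pi|npi] := pselect (pchart D (br i)); last by exists None.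
  by have [q qi] := puncture_of_chart pi; exists (Some q) => _; exists q.
pose gam i (w : C) : irr D :=
  if w == 0 then (if Q i is Some q then inr q else inl x0) else to_irr x0 (cinv (br i) w).
have gam_cont i w : J i -> cabs w < 1 -> {for w, continuous (gam i)}.
  move=> Ji w1; have di := branch_disc (brP i).
  have [q Qi qi] := QP i Ji; have [_ iD _ _] := Ji.
  have gam0 : gam i 0 = inr q by rewrite /gam eqxx Qi.
  have gam_ne u : u != 0 -> gam i u = to_irr x0 (cinv (br i) u).
    by rewrite /gam => /negbTE ->.
  have [->|w0] := eqVneq w 0.
    move=> A; rewrite gam0 nbhsE => -[U [+ Uq] UA].
    rewrite open_irrE => -[_ /(_ q Uq _ qi)[_ /posC_real[r r0 ->] rU]].
    suff : nbhs (0 : C) (gam i @^-1` A) by [].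
    apply/nbhsC; exists (Num.min r 1); first by rewrite lt_min r0 ltr01.
    move=> u; rewrite subr0 lt_min => /andP[ur u1]; apply: UA.
    have [->|u0] := eqVneq u 0; first by rewrite gam0.
    rewrite gam_ne//; rewrite -cabs_gt0 in u0.
    have [|ui uE] := disc_cinv di (w := u); first by rewrite u0.
    pose z' : D := SigSub (mem_set (iD _ ui)).
    have zE : cinv (br i) u = set_val z' by rewrite set_valE.
    by rewrite zE to_irrE; apply: rU; rewrite -zE; apply/pnE; rewrite uE.
  have w01 : 0 < cabs w < 1 by rewrite cabs_gt0 w0.
  have ci := cinv_continuous (disc_img di w01).
  have [dw _] := disc_cinv di w01.
  have cc := continuous_comp ci (to_irr_continuous (x0 := x0) (iD _ dw)).
  move=> A; rewrite gam_ne// => /cc H.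
  have {}H : nbhs w ((to_irr x0 \o cinv (br i)) @^-1` A) := H.
  suff : nbhs w (gam i @^-1` A) by [].
  have N : \forall u \near w, u != 0.
    apply/nbhsC; exists (cabs w); first by rewrite cabs_gt0.
    by move=> u uw; apply: contraTneq uw => ->; rewrite sub0r cabsN ltxx.
  by apply: filterS2 N H => u u0; rewrite /preimage /= gam_ne.
exists [set z | z = x \/ exists i, cdom (br i) z /\ cabs (cmap (br i) z) < 1 / 2].
split; first exact: brN.
exists (\bigcup_(i in J) gam i @` [set w : C | cabs w <= 1 / 2]).
  have -> : \bigcup_(i in J) gam i @` [set w : C | cabs w <= 1 / 2] =
      \bigcup_(i in J) (if `[< J i >] then gam i @` [set w : C | cabs w <= 1 / 2] else set0).
    by apply: eq_bigcupr => i Ji; rewrite asboolT.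
  apply: finite_bigcup_compact; first exact: finite_finset.
  move=> i; case: asboolP => [Ji|_]; last exact: compact0.
  apply: continuous_compact.
    apply: continuous_in_subspaceT => w; rewrite inE /= => wr.
    by apply: gam_cont => //; lra.
  have := @compact_disc R 0 (1 / 2); congr compact.
  by apply/seteqP; split=> w /=; rewrite subr0.
case=> [z|q] /=.
  move=> [zx|[i [iz zr]]].
    by have zS := comp_sub cD (set_valP z); case: zS; move: xS; rewrite -zx.
  have di := branch_disc (brP i).
  have iD : cdom (br i) `<=` D.
    apply: (comp_max cD) => //; first exact: (cdom_connected di).
    by exists (set_val z); split=> //; exact: set_valP.
  have Ji : J i.
    have [ndi im lim hol] := brP i.
    by split=> //; exists x.
  exists i => //; exists (cmap (br i) (set_val z)); first exact: ltW.
  rewrite /gam -cabs_eq0; have /andP[z0 _] := disc_cmap di iz.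
  by rewrite gt_eqF// cmapK// to_irrE.
move=> H; have qx : puncture_center q = x.
  by case: H => [//|[i [/brS + _]]]; case; exact: puncture_center_sing.
have [d qd] := puncture_rep q; have [pd dd] := puncture_center_disc qd.
rewrite qx in dd.
have [i [iD Ji ed]] := puncture_branch brP brS brdis brN cD xS pd dd.
exists i => //; exists 0; first by (suff : cabs (0 : C) <= 1 / 2 by []); rewrite cabs0.
have [q' Qi qi] := QP i Ji.
by rewrite /gam eqxx Qi; congr inr; exact: puncture_inj qi qd ed.
Qed.

(** Ultrafilters on the preimage of K push forward to ultrafilters on K, which converge
    to a point near which the normalization is proper. *)
Lemma normalization_proper K : compact K -> compact (normalization @^-1` K).
Proof.
move=> cK.
have clK : closed (normalization @^-1` K).
  apply: (@closed_comp _ _ normalization K) => [z _|]; first exact: normalization_continuous.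
  by apply: compact_closed => //; exact: fp_hausdorff.
rewrite compact_ultra => F UF FK; have PF : ProperFilter F by exact: ultra_proper.
have [z [Kz zF]] := cK (normalization @ F) _ FK.
have [N [zN [L cL NL]]] := normalization_proper_near z.
have FN : F (normalization @^-1` N).
  have [//|FnN] := in_ultra_setVsetC (normalization @^-1` N) UF.
  by have [u [nu Nu]] := zF (~` N) N FnN zN.
have FL : F L by apply: filterS FN.
have := cL; rewrite compact_ultra => /(_ F UF FL)[y [Ly Fy]].
exists y; split=> //; apply: clK => B yB.
exact: (filter_ex (filterI FK (Fy B yB))).
Qed.

End Component.
End Normalization.

Theorem theorem3p1 (R : realType) (S0 S1 S2 : riemannSurface R)
  (b1 : S1 -> S0) (b2 : S2 -> S0)
  (hol1 : holomorphic b1) (hol2 : holomorphic b2)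
  (surj1 : set_surj [set: S1] [set: S0] b1) (surj2 : set_surj [set: S2] [set: S0] b2)
  (fp_connected : connected [set: fiber_product b1 b2])
  (sing_finite : finite_set (fp_sing b1 b2)) :
  homeomorphic (Ends (fiber_product b1 b2)) (normal_fiber_product_Ends b1 b2).
Proof.
have /choice[K KP] (x : fiber_product b1 b2) :
    exists K : set (fiber_product b1 b2), compact K /\ nbhs x K.
  have [K cK [xK _]] := locally_compact_fp hol1 hol2 surj1 surj2 (filterT : nbhs x setT).
  by exists K.
have D0 (D : set_type (components b1 b2)) : exists x0 : set_val D, True.
  have [x Dx] := comp_nonempty (set_valP D).
  by exists (SigSub (mem_set Dx)).
pose x0 D := sval (cid (D0 D)).
pose Y (D : set_type (components b1 b2)) : topologicalType :=
  irreducible_component (set_val D).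
apply: (@ends_sum_homeomorphic (fiber_product b1 b2) _ Y (fp_sing b1 b2)
  (\bigcup_(x in fp_sing b1 b2) K x) (fun D => set_val D)
  (fun D => @normalization R S0 S1 S2 b1 b2 (set_val D))
  (fun D => to_irr (x0 D))).
- by move=> D; exact: normalization_continuous.
- by move=> D L; apply: normalization_proper => //; exact: set_valP.
- by move=> D x; apply: to_irr_continuous => //; exact: set_valP.
- by move=> D x Dx; exact: normalization_to_irr.
- by move=> D y Dy; apply: to_irr_normalization => //; exact: set_valP.
- by move=> D y; exact: normalization_range.
- by move=> D; apply: comp_open => //; exact: set_valP.
- by move=> D; apply: comp_closure => //; exact: set_valP.
- by move=> D D' x Dx D'x; apply: val_inj; exact: (comp_disjoint (set_valP D) (set_valP D') Dx D'x).
- move=> U cU [x Ux] SU.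
  have US : U `<=` ~` fp_sing b1 b2.
    by move=> z Uz zS; have : (fp_sing b1 b2 `&` U) z by []; rewrite SU.
  have cE : components b1 b2 (connected_component (~` fp_sing b1 b2) x).
    by exists x => //; exact: US.
  exists (SigSub (mem_set cE)); rewrite set_valE /=.
  exact: connected_component_max.
- move=> x Sx; have [_ xK] := KP x; apply: filterS xK => z Kz; by exists x.
- by apply: finite_bigcup_compact => // x; have [] := KP x.
Qed.
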